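(* Let $s$ be a complex number with $\operatorname{Re}s<1$ and let $\lambda$ be fixed with $0<\lambda<1$. As a function of $\alpha$ on the unit interval $[0,1]$, $e^{2\pi i\lambda\alpha}\phi(\lambda,\alpha,s)$ has the Fourier series $$e^{2\pi i\lambda\alpha}\phi(\lambda,\alpha,s)=i(2\pi)^{s-1}\Gamma(1-s)\,e^{-\frac{\pi i s}{2}}\sum_{n=-\infty}^{\infty}e^{-2\pi i n\alpha}(n+\lambda)^{s-1},$$ the equality holding for $0<\alpha<1$.
   Context: For complex $\alpha\ne0,-1,-2,\dots$ and real $\lambda$, Lerch's zeta function is defined by $\phi(\lambda,\alpha,s)=\sum_{n\ge0}e^{2\pi i\lambda n}(n+\alpha)^{-s}$ for $\operatorname{Re}s>1$ and by analytic continuation in $s$; it is entire in $s$ when $\lambda$ is not an integer. Complex powers $(n+\lambda)^{s-1}$ use the principal value of the logarithm, so that $\arg(n+\lambda)=\pi$ when $n+\lambda<0$. The Fourier series on $[0,1]$ of an integrable function $f$ is $\sum_{n\in\mathbb Z}c_n e^{2\pi i n\alpha}$ with $c_n=\int_0^1 f(\alpha)e^{-2\pi i n\alpha}\,d\alpha$; doubly infinite series are limits of symmetric partial sums. *)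

(* Defs.v *)
(* MathComp-Analysis; the complex numbers are R[i] over an arbitrary R : realType,
   with the topology that every numFieldType carries. *)
From mathcomp Require Import all_boot all_order all_algebra.
From mathcomp Require Import all_classical all_reals all_analysis.
From mathcomp.real_closed Require Import complex.

Set Implicit Arguments.
Unset Strict Implicit.
Unset Printing Implicit Defensive.

Import Order.TTheory GRing.Theory Num.Theory.
Import numFieldNormedType.Exports.

Local Open Scope classical_set_scope.
Local Open Scope ring_scope.
Local Open Scope complex_scope.

Section ComplexFunctions.
Variable R : realType.
Implicit Types (z w s alpha : R[i]) (x lambda : R).

Definition cexp z : R[i] :=
  (expR (complex.Re z))%:C * (cos (complex.Im z) +i* sin (complex.Im z)).

Definition cmod z : R :=
  Num.sqrt (complex.Re z ^+ 2 + complex.Im z ^+ 2).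

(* Principal argument, in ]-pi, pi]; it is pi on the negative real axis.
   Meaningful for z != 0 only, as are clog z and cpow z w below. *)
Definition carg z : R :=
  if 0 <= complex.Im z then acos (complex.Re z / cmod z)
  else - acos (complex.Re z / cmod z).

Definition clog z : R[i] := ln (cmod z) +i* carg z.

Definition cpow z w : R[i] := cexp (w * clog z).

(* e^(2 pi i x) *)
Definition e2pi x : R[i] := cexp (0 +i* (2 * pi * x)).

Definition analytic_at (F : R[i] -> R[i]) z : Prop :=
  exists (a : nat -> R[i]) (r : R), 0 < r /\
    forall w, `|w - z| < r%:C ->
      series (fun n => a n * (w - z) ^+ n) @ \oo --> (F w : R[i]^o).

(* For an integer lambda the continuation may have a pole at s = 1. *)
Definition is_lerch_zeta lambda alpha (F : R[i] -> R[i]) : Prop :=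
  (forall s, (lambda \is a Num.int -> s != 1) -> analytic_at F s) /\
  (forall s, 1 < complex.Re s ->
     series (fun n => e2pi (lambda * n%:R) * cpow (n%:R + alpha) (- s))
       @ \oo --> (F s : R[i]^o)).

(* phi(lambda, alpha, s), for alpha != 0, -1, -2, ... : the common value at s of
   the functions satisfying is_lerch_zeta (they agree by the identity theorem). *)
Definition lerch_zeta lambda alpha s : R[i] :=
  xget 0 [set F s | F in is_lerch_zeta lambda alpha].

Notation mu := (@lebesgue_measure R).

Definition cintegrable (D : set R) (f : R -> R[i]) : Prop :=
  mu.-integrable D (EFin \o (fun x => complex.Re (f x))) /\
  mu.-integrable D (EFin \o (fun x => complex.Im (f x))).

Definition cintegral (D : set R) (f : R -> R[i]) : R[i] :=
  Rintegral mu D (fun x => complex.Re (f x)) +i*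
  Rintegral mu D (fun x => complex.Im (f x)).

(* Euler's integral: this is Gamma z on the half-plane 0 < Re z. *)
Definition cGamma z : R[i] :=
  cintegral `]0, +oo[ (fun t => cpow t%:C (z - 1) * (expR (- t))%:C).

Definition fourier_coef (f : R -> R[i]) (n : int) : R[i] :=
  cintegral `[0, 1] (fun x => f x * e2pi (- (n%:~R * x))).

(* Symmetric partial sum, over - N <= n <= N. *)
Definition bisum (u : int -> R[i]) (N : nat) : R[i] :=
  \sum_(k < N.*2.+1) u (k%:Z - N%:Z).

End ComplexFunctions.

(* Main.v *)
(* Summing phi(lambda, x, s) by parts k times, with Re s + k >= 4, expresses it for every
   s as x^-s + zeta * A(1 + x), where zeta = e2pi lambda and A is an absolutely convergent
   sum; for 1 < Re s this is the defining series, and the identity theorem does the rest.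

   Since A satisfies A(x) = x^-s + zeta * A(x + 1), for Re w > 0 and zeta = e^-w the integral
   over ]0, 1[ of e^(-wx) (x^-s + zeta A(1 + x)) unfolds to the integral over ]0, +oo[ of
   e^(-wx) x^-s, that is, Gamma(1 - s) w^(s-1), by a linear differential equation along the
   path t |-> e^(t log w). The Fourier coefficient is the limit of this identity as w
   tends to -2 pi i (n + lambda).

   The function is locally Lipschitz on ]0, 1[, so its Fourier series converges to it there. *)

Require Import Defs.
From mathcomp Require Import all_boot all_order all_algebra.
From mathcomp Require Import all_classical all_reals all_analysis.
From mathcomp.real_closed Require Import complex.
From mathcomp Require Import measurable_realfun.
From mathcomp Require Import ring lra zify.

Set Implicit Arguments.
Unset Strict Implicit.
Unset Printing Implicit Defensive.

Import Order.TTheory GRing.Theory Num.Theory.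
Import numFieldNormedType.Exports.

Local Open Scope classical_set_scope.
Local Open Scope ring_scope.
Local Open Scope complex_scope.

(** * Complex-valued functions of a real variable *)

Section ComplexBasics.
Variable R : realType.
Notation C := R[i].
Implicit Types (z w s : C) (x y : R).

(** At w = - 2 pi i (n + lambda) the coefficient is formally a Gamma integral over ]0, +oo[, but on
    the imaginary axis that integral is not absolutely convergent. The unfolded integral over ]0, 1[
    stays dominated up to the axis, so the limit is taken there. The tool behind this is the
    identity (1 - z) sum z^n f(x + n) = f(x) + z sum z^n (f(x + n + 1) - f(x + n)). Each use
    replaces f by a difference, which for x^(-s) gains one power of decay, and costs a division by 1
    - z; this is where lambda must not be an integer. After enough uses the sum converges
    absolutely, with bounds uniform over |z| <= 1 away from z = 1. The same function A is then the
    analytic continuation in s when z lies on the unit circle, and the sum of an ordinary series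
    when |z| < 1. Constants are kept crude: estimates go through real and imaginary parts
    separately, and each such passage costs a factor 2. *)

Lemma cReD z w : complex.Re (z + w) = complex.Re z + complex.Re w.
Proof. by case: z; case: w. Qed.
Lemma cImD z w : complex.Im (z + w) = complex.Im z + complex.Im w.
Proof. by case: z; case: w. Qed.
Lemma cReN z : complex.Re (- z) = - complex.Re z.
Proof. by case: z. Qed.
Lemma cImN z : complex.Im (- z) = - complex.Im z.
Proof. by case: z. Qed.
Lemma cReM z w :
  complex.Re (z * w) = complex.Re z * complex.Re w - complex.Im z * complex.Im w.
Proof. by case: z; case: w. Qed.
Lemma cImM z w :
  complex.Im (z * w) = complex.Re z * complex.Im w + complex.Im z * complex.Re w.
Proof. by case: z => a b; case: w => c d /=; rewrite addrC. Qed.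
Lemma complex_ext z w : complex.Re z = complex.Re w -> complex.Im z = complex.Im w -> z = w.
Proof. by case: z => a b; case: w => c d /= -> ->. Qed.
Lemma RecK x y : complex.Re (x +i* y) = x. Proof. by []. Qed.
Lemma ImcK x y : complex.Im (x +i* y) = y. Proof. by []. Qed.
Lemma Re_nat n : complex.Re (n%:R : C) = n%:R.
Proof. by elim: n => //= n IH; rewrite -addn1 natrD cReD IH natrD. Qed.
Lemma Im_nat n : complex.Im (n%:R : C) = 0.
Proof. by elim: n => //= n IH; rewrite -addn1 natrD cImD IH /= addr0. Qed.

Definition ReIm_simp := (cReD, cImD, cReN, cImN, cReM, cImM, RecK, ImcK, Re_nat, Im_nat).

Lemma normC_cmod z : `|z| = (cmod z)%:C.
Proof. exact: normc_def. Qed.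
Lemma cmodE z : cmod z = complex.Re `|z|. Proof. by rewrite normC_cmod. Qed.

Lemma cmod_ge0 z : 0 <= cmod z. Proof. exact: sqrtr_ge0. Qed.
Lemma cmod0 : cmod (0 : C) = 0. Proof. by rewrite cmodE normr0. Qed.
Lemma cmod1 : cmod (1 : C) = 1. Proof. by rewrite cmodE normr1. Qed.
Lemma cmodM z w : cmod (z * w) = cmod z * cmod w.
Proof. by apply: complexI; rewrite rmorphM /= -!normC_cmod normrM. Qed.
Lemma cmodN z : cmod (- z) = cmod z.
Proof. by rewrite !cmodE normrN. Qed.
Lemma cmodB z w : cmod (z - w) = cmod (w - z).
Proof. by rewrite !cmodE distrC. Qed.
Lemma cmodD z w : cmod (z + w) <= cmod z + cmod w.
Proof. by rewrite -lecR rmorphD /= -!normC_cmod ler_normD. Qed.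
Lemma cmodX z n : cmod (z ^+ n) = cmod z ^+ n.
Proof. by apply: complexI; rewrite rmorphXn /= -!normC_cmod normrX. Qed.
Lemma cmodV z : cmod z^-1 = (cmod z)^-1.
Proof. by apply: complexI; rewrite fmorphV /= -!normC_cmod normfV. Qed.
Lemma cmod_eq0 z : (cmod z == 0) = (z == 0).
Proof. by rewrite -(inj_eq (@complexI R)) -normC_cmod normr_eq0. Qed.
Lemma cmod_gt0 z : (0 < cmod z) = (z != 0).
Proof. by rewrite lt_def cmod_eq0 cmod_ge0 andbT. Qed.
Lemma cmod_real x : cmod x%:C = `|x|.
Proof. by rewrite /cmod /= expr0n addr0 sqrtr_sqr. Qed.
Lemma cmod_sum (I : Type) (r : seq I) (P : pred I) (F : I -> C) :
  cmod (\sum_(i <- r | P i) F i) <= \sum_(i <- r | P i) cmod (F i).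
Proof.
elim/big_rec2: _ => [|i y z _ le]; first by rewrite cmod0.
by rewrite (le_trans (cmodD _ _))// lerD2l.
Qed.
Lemma le_Re_cmod z : `|complex.Re z| <= cmod z.
Proof. by rewrite -sqrtr_sqr ler_wsqrtr// lerDl sqr_ge0. Qed.
Lemma le_Im_cmod z : `|complex.Im z| <= cmod z.
Proof. by rewrite -sqrtr_sqr ler_wsqrtr// lerDr sqr_ge0. Qed.
Lemma cmod_le_ReIm z : cmod z <= `|complex.Re z| + `|complex.Im z|.
Proof.
rewrite -[leRHS]ger0_norm ?addr_ge0// -[leRHS]sqrtr_sqr ler_wsqrtr//.
rewrite -(real_normK (num_real (complex.Re z))) -(real_normK (num_real (complex.Im z))).
by rewrite sqrrD lerD2r lerDl mulrn_wge0// mulr_ge0.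
Qed.

(** * Limits of complex sequences, reduced to real ones *)

Lemma cvgCP (u : nat -> C) (l : C) :
  u @ \oo --> (l : C^o) <-> (fun n => cmod (u n - l)) @ \oo --> (0 : R).
Proof.
split=> [/(@cvgrPdist_lt C C^o) cu|/cvgrPdist_lt cu].
  apply/cvgrPdist_lt => e e0.
  have e0' : 0 < e%:C by rewrite ltcR.
  near=> n; rewrite sub0r normrN ger0_norm ?cmod_ge0//.
  rewrite -ltcR -normC_cmod distrC; near: n; exact: cu.
apply/(@cvgrPdist_lt C C^o) => e e0.
(* The norm of [C] takes values in [C], so [e] is a complex number; being positive, it is real. *)
have -> : e = (complex.Re e)%:C by rewrite RRe_real// gtr0_real.
have e0' : 0 < complex.Re e by move: e0; rewrite ltcE => /andP[].
near=> n; rewrite distrC normC_cmod ltcR.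
rewrite -[ltLHS](@ger0_norm _ (cmod _)) ?cmod_ge0// -[X in `|X|]opprK normrN -sub0r.
near: n; exact: cu.
Unshelve. all: by end_near. Qed.

Lemma cvgC_ReIm (u : nat -> C) (l : C) :
  u @ \oo --> (l : C^o) <->
  ((fun n => complex.Re (u n)) @ \oo --> complex.Re l /\
   (fun n => complex.Im (u n)) @ \oo --> complex.Im l).
Proof.
rewrite cvgCP; split.
  move=> cu; split; apply/subr_cvg0.
    have h n : `|complex.Re (u n) - complex.Re l| <= cmod (u n - l).
      by rewrite -cReN -cReD le_Re_cmod.
    apply: norm_cvg0; apply: squeeze_cvgr cu; last exact: cvg_cst.
    by apply: nearW => n; rewrite normr_ge0 h.
  have h n : `|complex.Im (u n) - complex.Im l| <= cmod (u n - l).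
    by rewrite -cImN -cImD le_Im_cmod.
  apply: norm_cvg0; apply: squeeze_cvgr cu; last exact: cvg_cst.
  by apply: nearW => n; rewrite normr_ge0 h.
move=> [/subr_cvg0 cr /subr_cvg0 ci].
have cs : (fun n => `|complex.Re (u n) - complex.Re l| + `|complex.Im (u n) - complex.Im l|)
    @ \oo --> (0 : R).
  rewrite -[X in _ --> X]addr0 -[X in _ --> X + _](normr0 R) -[X in _ --> _ + X](normr0 R).
  by apply: cvgD; apply: cvg_norm.
apply: squeeze_cvgr cs; last exact: cvg_cst.
apply: nearW => n; rewrite cmod_ge0/= (le_trans (cmod_le_ReIm _))//.
by rewrite !ReIm_simp.
Qed.

Lemma cvg0_le (u e : nat -> R) :
  (forall n, `|u n| <= e n) -> e @ \oo --> (0 : R) -> u @ \oo --> (0 : R).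
Proof.
move=> ue e0; apply: norm_cvg0; apply: squeeze_cvgr e0; last exact: cvg_cst.
by apply: nearW => n; rewrite normr_ge0 ue.
Qed.

Lemma cvgC_unique (u : nat -> C) (l m : C) :
  u @ \oo --> (l : C^o) -> u @ \oo --> (m : C^o) -> l = m.
Proof.
move=> /cvgC_ReIm[lr li] /cvgC_ReIm[mr mi].
by apply: complex_ext; [apply: (cvg_unique _ lr mr)|apply: (cvg_unique _ li mi)].
Qed.

Lemma cvgC_le (u : nat -> C) (l : C) (m : R) :
  u @ \oo --> (l : C^o) -> (forall n, cmod (u n) <= m) -> cmod l <= m.
Proof.
move=> /cvgCP cu um; apply/ler_addgt0Pr => e e0.
have /cvgrPdist_lt/(_ e e0)[N _ /(_ N (leqnn N))] := cu.
rewrite sub0r normrN ger0_norm ?cmod_ge0// => h.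
have := cmodD (l - u N) (u N); rewrite subrK cmodB.
by have := um N; lra.
Qed.

Lemma cvgC_squeeze (u : nat -> C) (l : C) (e : nat -> R) :
  (forall n, cmod (u n - l) <= e n) -> e @ \oo --> 0 -> u @ \oo --> (l : C^o).
Proof.
move=> ue e0; apply/cvgCP; apply: squeeze_cvgr e0; last exact: cvg_cst.
by apply: nearW => n; rewrite cmod_ge0 ue.
Qed.

(** * The exponential, the characters [e2pi], and powers of positive reals *)

Lemma cexpD z w : cexp (z + w) = cexp z * cexp w.
Proof.
apply: complex_ext; rewrite /cexp !ReIm_simp /= expRD ?cosD ?sinD; ring.
Qed.

Lemma cexp0 : cexp (0 : C) = 1.
Proof. by apply: complex_ext; rewrite /cexp !ReIm_simp /= expR0 cos0 sin0; ring. Qed.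

Lemma cmod_cexp z : cmod (cexp z) = expR (complex.Re z).
Proof.
rewrite /cexp cmodM cmod_real ger0_norm ?expR_ge0// /cmod /= cos2Dsin2 sqrtr1 mulr1 //.
Qed.

Lemma cexp_neq0 z : cexp z != 0.
Proof. by rewrite -cmod_gt0 cmod_cexp expR_gt0. Qed.

Lemma cexpN z : cexp (- z) = (cexp z)^-1.
Proof.
by apply: (mulfI (cexp_neq0 z)); rewrite -cexpD subrr cexp0 mulfV ?cexp_neq0.
Qed.

Lemma cexp_real x : cexp x%:C = (expR x)%:C.
Proof. by apply: complex_ext; rewrite /cexp !ReIm_simp /= cos0 sin0; ring. Qed.

Lemma cexpMn z n : cexp (n%:R * z) = cexp z ^+ n.
Proof.
elim: n => [|n IH]; first by rewrite mul0r cexp0 expr0.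
by rewrite -addn1 natrD mulrDl mul1r cexpD IH addn1 exprSr.
Qed.

Lemma e2piD x y : e2pi (x + y) = e2pi x * e2pi y.
Proof. by rewrite /e2pi -cexpD; congr cexp; apply: complex_ext; rewrite !ReIm_simp; ring. Qed.
Lemma e2pi0 : e2pi (0 : R) = 1.
Proof. by rewrite /e2pi mulr0 cexp0. Qed.
Lemma e2piMn x n : e2pi (x * n%:R) = e2pi x ^+ n.
Proof.
rewrite /e2pi -cexpMn; congr cexp; apply: complex_ext; rewrite !ReIm_simp; ring.
Qed.
Lemma cmod_e2pi x : cmod (e2pi x) = 1.
Proof. by rewrite cmod_cexp expR0. Qed.
Lemma e2piN x : e2pi (- x) = (e2pi x)^-1.
Proof. by rewrite /e2pi -cexpN; congr cexp; apply: complex_ext; rewrite !ReIm_simp; ring. Qed.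
Lemma e2pi1 : e2pi (1 : R) = 1.
Proof.
rewrite /e2pi /cexp !ReIm_simp expR0 mul1r mulr1.
have -> : 2 * pi = pi *+ 2 :> R by rewrite mulr_natl.
by rewrite cos2pi sin2pi.
Qed.
Lemma e2pi_nat n : e2pi (n%:R : R) = 1.
Proof. by rewrite -[n%:R]mul1r e2piMn e2pi1 expr1n. Qed.
Lemma e2pi_int (n : int) : e2pi (n%:~R : R) = 1.
Proof.
case: n => n; first exact: e2pi_nat.
by rewrite NegzE rmorphN /= e2piN e2pi_nat invr1.
Qed.

(** The real part is 1 - 2 sin(pi x)^2, and sin(pi x) > 0 for 0 < x < 1. *)
Lemma e2pi_neq1 x : 0 < x < 1 -> e2pi x != 1.
Proof.
move=> /andP[x0 x1]; apply/eqP => /(congr1 (@complex.Re R)).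
rewrite /e2pi /cexp !ReIm_simp /= expR0 mul1r mul0r subr0 => c1.
have : cos (2 * pi * x) = cos (pi * x) ^+ 2 *+ 2 - 1.
  by rewrite -cos_mulr2n; congr cos; rewrite -mulrA mulr_natl.
rewrite c1 cos2sin2 => h.
have : 0 < sin (pi * x).
  by rewrite sin_gt0_pi// mulr_gt0 ?pi_gt0//= gtr_pMr ?pi_gt0.
move=> s0; have : 0 < sin (pi * x) ^+ 2 by rewrite exprn_gt0.
move: h; rewrite mulr2n; lra.
Qed.

Lemma clog_real x : 0 < x -> clog x%:C = (ln x)%:C.
Proof.
move=> x0; rewrite /clog cmod_real gtr0_norm//.
by rewrite /carg /= lexx cmod_real gtr0_norm// divff ?gt_eqF// acos1.
Qed.
Lemma cpow_real x w : 0 < x -> cpow x%:C w = cexp (w * (ln x)%:C).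
Proof. by move=> x0; rewrite /cpow clog_real. Qed.
Lemma cpow_nat_real n x w : 0 < n%:R + x -> cpow (n%:R + x%:C) w = cexp (w * (ln (n%:R + x))%:C).
Proof.
by move=> x0; rewrite -cpow_real//; congr (cpow _ w); rewrite rmorphD /= rmorph_nat.
Qed.

(** Componentwise, so that the real mean value theorem, the fundamental theorem of calculus and
    differentiation under the integral apply to each part. *)
Definition is_cderive (g : R -> C) x (d : C) :=
  is_derive x 1 (fun t => complex.Re (g t)) (complex.Re d) /\
  is_derive x 1 (fun t => complex.Im (g t)) (complex.Im d).

Lemma is_derive_eq2 (f g : R -> R) (x a b : R) :
  is_derive x 1 f a -> f =1 g -> a = b -> is_derive x 1 g b.
Proof. by move=> fa /funext <- <-. Qed.

Lemma is_cderive_eq (f g : R -> C) x (a b : C) :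
  is_cderive f x a -> f =1 g -> a = b -> is_cderive g x b.
Proof. by move=> fa /funext <- <-. Qed.

Lemma is_cderive_cst (c : C) x : is_cderive (fun=> c) x 0.
Proof. by split; apply: is_derive_cst. Qed.

Lemma is_cderiveD (f g : R -> C) x a b :
  is_cderive f x a -> is_cderive g x b -> is_cderive (fun t => f t + g t) x (a + b).
Proof.
move=> [fr fi] [gr gi]; split.
  by apply: is_derive_eq2 (is_deriveD fr gr) _ _ => [t|]; rewrite ?fctE cReD.
by apply: is_derive_eq2 (is_deriveD fi gi) _ _ => [t|]; rewrite ?fctE cImD.
Qed.

Lemma is_cderiveN (f : R -> C) x a :
  is_cderive f x a -> is_cderive (fun t => - f t) x (- a).
Proof.
move=> [fr fi]; split.
  by apply: is_derive_eq2 (is_deriveN fr) _ _ => [t|]; rewrite ?fctE cReN.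
by apply: is_derive_eq2 (is_deriveN fi) _ _ => [t|]; rewrite ?fctE cImN.
Qed.

Lemma is_cderiveB (f g : R -> C) x a b :
  is_cderive f x a -> is_cderive g x b -> is_cderive (fun t => f t - g t) x (a - b).
Proof. by move=> fa gb; apply: is_cderiveD fa _; apply: is_cderiveN. Qed.

Lemma is_cderiveM (f g : R -> C) x a b :
  is_cderive f x a -> is_cderive g x b ->
  is_cderive (fun t => f t * g t) x (a * g x + f x * b).
Proof.
move=> [fr fi] [gr gi]; split.
  apply: is_derive_eq2 (is_deriveB (is_deriveM fr gr) (is_deriveM fi gi)) _ _ => [t|].
    by rewrite ?fctE cReM.
  rewrite !ReIm_simp /GRing.scale/=; ring.
apply: is_derive_eq2 (is_deriveD (is_deriveM fr gi) (is_deriveM fi gr)) _ _ => [t|].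
  by rewrite ?fctE cImM.
rewrite !ReIm_simp /GRing.scale/=; ring.
Qed.

Lemma is_cderiveZ (c : C) (f : R -> C) x a :
  is_cderive f x a -> is_cderive (fun t => c * f t) x (c * a).
Proof.
move=> fa; apply: is_cderive_eq (is_cderiveM (is_cderive_cst c x) fa) _ _ => //.
by rewrite mul0r add0r.
Qed.

Lemma is_cderive_real (f : R -> R) x a :
  is_derive x 1 f a -> is_cderive (fun t => (f t)%:C) x a%:C.
Proof. by move=> fa; split => //; apply: is_derive_cst. Qed.

Lemma is_cderive_cexp (f : R -> C) x a :
  is_cderive f x a -> is_cderive (fun t => cexp (f t)) x (a * cexp (f x)).
Proof.
move=> [fr fi].
have he : is_derive x 1 (fun t => expR (complex.Re (f t))) (complex.Re a * expR (complex.Re (f x))).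
  rewrite mulrC; exact: (@is_derive1_comp _ expR).
have hc : is_derive x 1 (fun t => cos (complex.Im (f t))) (complex.Im a * - sin (complex.Im (f x))).
  rewrite mulrC; exact: (@is_derive1_comp _ (@cos R)).
have hs : is_derive x 1 (fun t => sin (complex.Im (f t))) (complex.Im a * cos (complex.Im (f x))).
  rewrite mulrC; exact: (@is_derive1_comp _ (@sin R)).
have hcs : is_cderive (fun t => cos (complex.Im (f t)) +i* sin (complex.Im (f t))) x
    ((complex.Im a * - sin (complex.Im (f x))) +i* (complex.Im a * cos (complex.Im (f x)))).
  by split.
apply: is_cderive_eq (is_cderiveM (is_cderive_real he) hcs) _ _ => //.
by apply: complex_ext; rewrite /cexp !ReIm_simp /=; ring.
Qed.

Lemma is_cderive_shift (f : R -> C) (c x : R) a :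
  is_cderive f (x + c) a -> is_cderive (fun t => f (t + c)) x a.
Proof.
have h (g : R -> R) b : is_derive (x + c) 1 g b -> is_derive x 1 (fun t => g (t + c)) b.
  move=> gb; rewrite -[b]mulr1.
  exact: (@is_derive1_comp _ g (shift c) x b 1 gb (is_derive_shift x 1 c)).
by move=> [fr fi]; split;
  [exact: (h (fun t => complex.Re (f t)))|exact: (h (fun t => complex.Im (f t)))].
Qed.

Lemma is_cderive_linear (c : C) x : is_cderive (fun t => t%:C * c) x c.
Proof.
have h := is_cderive_real (is_derive_id x (1:R)).
apply: is_cderive_eq (is_cderiveM h (is_cderive_cst c x)) _ _ => //=.
by rewrite mulr0 addr0 mul1r.
Qed.

Lemma is_cderive_pow w x : 0 < x ->
  is_cderive (fun t => cexp (w * (ln t)%:C)) x (w * cexp ((w - 1) * (ln x)%:C)).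
Proof.
move=> x0.
have h := is_cderive_cexp (is_cderiveZ w (is_cderive_real (is_derive1_ln x0))).
apply: is_cderive_eq h _ _ => //=.
rewrite mulrBl mul1r cexpD cexpN cexp_real lnK ?posrE// fmorphV /=; ring.
Qed.

Lemma is_derive_continuous (f : R -> R) x a :
  is_derive x 1 f a -> {for x, continuous f}.
Proof.
by move=> [fa _]; apply/differentiable_continuous/derivable1_diffP.
Qed.

Lemma MVT_le (f : R -> R) (f' : R -> R) (a b M : R) : a <= b ->
  (forall x, a <= x <= b -> is_derive x 1 f (f' x)) ->
  (forall x, a <= x <= b -> `|f' x| <= M) -> `|f b - f a| <= M * (b - a).
Proof.
rewrite le_eqVlt => /predU1P[->|ab] fd fM.
  by rewrite !subrr normr0 mulr0.
have [||c /itvP cab ->] := @MVT _ f f' a b ab.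
- by move=> x xab; apply: fd; rewrite !(itvP xab).
- apply: continuous_in_subspaceT => x; rewrite inE => /itvP xab.
  by apply: is_derive_continuous (fd x _); rewrite !xab.
rewrite normrM [`|b - a|]gtr0_norm ?subr_gt0// ler_wpM2r ?subr_ge0 ?(ltW ab)//.
by apply: fM; rewrite !cab.
Qed.

(** The mean value theorem has no equality form for complex values; the factor 2 comes from applying
    it to both parts. With M = 0 it also shows that a function of zero derivative is constant. *)
Lemma cMVT_le (f : R -> C) (f' : R -> C) (a b M : R) : a <= b ->
  (forall x, a <= x <= b -> is_cderive f x (f' x)) ->
  (forall x, a <= x <= b -> cmod (f' x) <= M) -> cmod (f b - f a) <= 2 * M * (b - a).
Proof.
move=> ab fd fM.
have h1 : `|complex.Re (f b) - complex.Re (f a)| <= M * (b - a).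
  apply: (@MVT_le (fun x => complex.Re (f x)) (fun x => complex.Re (f' x))) => // x xab;
    first by case: (fd x xab).
  exact: le_trans (le_Re_cmod _) (fM _ xab).
have h2 : `|complex.Im (f b) - complex.Im (f a)| <= M * (b - a).
  apply: (@MVT_le (fun x => complex.Im (f x)) (fun x => complex.Im (f' x))) => // x xab;
    first by case: (fd x xab).
  exact: le_trans (le_Im_cmod _) (fM _ xab).
apply: le_trans (cmod_le_ReIm _) _; rewrite !ReIm_simp.
by rewrite (_ : 2 * M * (b - a) = M * (b - a) + M * (b - a)) ?lerD//; ring.
Qed.

End ComplexBasics.

(** * Dominated series *)

Section Summation.
Variable R : realType.
Notation C := R[i].
Implicit Types (z w s h : C) (x y : R) (u : nat -> C).

Lemma seriesE (V : zmodType) (u : nat -> V) n : series u n = \sum_(k < n) u k.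
Proof. by rewrite seriesEord. Qed.

Lemma Re_sum n (u : 'I_n -> C) : complex.Re (\sum_(k < n) u k) = \sum_(k < n) complex.Re (u k).
Proof. by elim/big_rec2: _ => //= i x y _ <-; rewrite cReD. Qed.
Lemma Im_sum n (u : 'I_n -> C) : complex.Im (\sum_(k < n) u k) = \sum_(k < n) complex.Im (u k).
Proof. by elim/big_rec2: _ => //= i x y _ <-; rewrite cImD. Qed.

Lemma cvgC_cst (c : C) : (fun=> c) @ \oo --> (c : C^o).
Proof. by apply/cvgC_ReIm; split; exact: cvg_cst. Qed.

Lemma cvgCD (u v : nat -> C) (l m : C) :
  u @ \oo --> (l : C^o) -> v @ \oo --> (m : C^o) ->
  (fun n => u n + v n) @ \oo --> ((l + m : C) : C^o).
Proof.
move=> /cvgC_ReIm[ur ui] /cvgC_ReIm[vr vi]; apply/cvgC_ReIm; split.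
  by rewrite cReD; under eq_fun do rewrite cReD; apply: cvgD.
by rewrite cImD; under eq_fun do rewrite cImD; apply: cvgD.
Qed.

Lemma cvgCM (u v : nat -> C) (l m : C) :
  u @ \oo --> (l : C^o) -> v @ \oo --> (m : C^o) ->
  (fun n => u n * v n) @ \oo --> ((l * m : C) : C^o).
Proof.
move=> /cvgC_ReIm[ur ui] /cvgC_ReIm[vr vi]; apply/cvgC_ReIm; split.
  by rewrite cReM; under eq_fun do rewrite cReM; apply: cvgB; apply: cvgM.
by rewrite cImM; under eq_fun do rewrite cImM; apply: cvgD; apply: cvgM.
Qed.

Lemma cvgCZ (c : C) (u : nat -> C) (l : C) :
  u @ \oo --> (l : C^o) -> (fun n => c * u n) @ \oo --> ((c * l : C) : C^o).
Proof. by move=> ul; apply: cvgCM ul; exact: cvgC_cst. Qed.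

Lemma cvgCN (u : nat -> C) (l : C) :
  u @ \oo --> (l : C^o) -> (fun n => - u n) @ \oo --> ((- l : C) : C^o).
Proof.
move=> /cvgC_ReIm[ur ui]; apply/cvgC_ReIm; split.
  by rewrite cReN; under eq_fun do rewrite cReN; apply: cvgN.
by rewrite cImN; under eq_fun do rewrite cImN; apply: cvgN.
Qed.

Lemma cvgCB (u v : nat -> C) (l m : C) :
  u @ \oo --> (l : C^o) -> v @ \oo --> (m : C^o) ->
  (fun n => u n - v n) @ \oo --> ((l - m : C) : C^o).
Proof. by move=> ul /cvgCN vm; apply: cvgCD. Qed.

Lemma cvgC_shiftn N u (l : C) :
  (fun n => u (n + N)%N) @ \oo --> (l : C^o) <-> u @ \oo --> (l : C^o).
Proof.
split=> /cvgCP h; apply/cvgCP; first by rewrite -(cvg_shiftn N).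
by move: h; rewrite -(cvg_shiftn N).
Qed.

Lemma cvgC_shiftS u (l : C) :
  (fun n => u n.+1) @ \oo --> (l : C^o) <-> u @ \oo --> (l : C^o).
Proof.
split=> /cvgCP h; apply/cvgCP; first by rewrite -cvg_shiftS.
by move: h; rewrite -cvg_shiftS.
Qed.

(** The fixed summable majorant: every absolutely convergent series of the development is compared
    with it. *)
Definition isq (n : nat) : R := (n.+1%:R ^+ 2)^-1.

Lemma isq_gt0 n : 0 < isq n. Proof. by rewrite invr_gt0 exprn_gt0. Qed.

Lemma sum_isq n : \sum_(k < n) isq k <= 2.
Proof.
have aux (a b c : R) : c <= a - b -> 2 - a + c <= 2 - b by lra.
(* Telescoping, by 1/(m+2)^2 <= 1/(m+1) - 1/(m+2); the subtracted term makes the induction go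
   through. *)
have h m : \sum_(k < m.+1) isq k <= 2 - m.+1%:R^-1.
  elim: m => [|m IH].
    rewrite big_ord_recr big_ord0 /= /isq add0r.
    have -> : (1%:R : R) = 1 by [].
    have h : (1 : R) <= 2 - 1 by rewrite (_ : 2 = 1 + 1 :> R) ?addrK.
    by rewrite expr1n !invr1.
  rewrite big_ord_recr /=.
  apply: le_trans (lerD IH (lexx _)) _.
    suff : isq m.+1 <= m.+1%:R^-1 - m.+2%:R^-1 by apply: aux.
  have m0 : (0 : R) < m.+1%:R by rewrite ltr0n.
  have -> : m.+1%:R^-1 - m.+2%:R^-1 = (m.+1%:R * m.+2%:R)^-1 :> R.
    by rewrite -[m.+2]addn1 natrD; field; apply/andP; split; rewrite gt_eqF// addr_gt0.
  rewrite /isq lef_pV2 ?posrE ?exprn_gt0 ?mulr_gt0 ?ltr0n//.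
  by rewrite expr2 ler_pM2r ?ltr0n// ler_nat.
case: n => [|n]; first by rewrite big_ord0.
by apply: le_trans (h n) _; rewrite gerBl invr_ge0.
Qed.

Lemma cvg_series_isq (u : nat -> R) (B : R) :
  (forall n, `|u n| <= B * isq n) -> cvgn (series u).
Proof.
move=> uB; apply: normed_cvg.
have B0 : 0 <= B.
  by have := le_trans (normr_ge0 _) (uB 0); rewrite pmulr_lge0// isq_gt0.
apply: (@series_le_cvg _ _ (fun n => B * isq n)) => //=.
  by move=> n; rewrite mulr_ge0// ltW// isq_gt0.
apply: nondecreasing_is_cvgn.
  by apply/nondecreasing_seqP => n; rewrite !seriesE big_ord_recr /= lerDl mulr_ge0// ltW// isq_gt0.
exists (B * 2) => _ [n _ <-]; rewrite seriesE -mulr_sumr ler_wpM2l//; exact: sum_isq.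
Qed.

(** A total function; it is the sum of the series under the domination hypothesis of [csum_cvg]. *)
Definition csum (u : nat -> C) : C :=
  limn (series (fun n => complex.Re (u n))) +i* limn (series (fun n => complex.Im (u n))).

Lemma csum_cvg u (B : R) : (forall n, cmod (u n) <= B * isq n) ->
  series u @ \oo --> (csum u : C^o).
Proof.
move=> uB; apply/cvgC_ReIm; split.
  have -> : (fun n => complex.Re (series u n)) = series (fun n => complex.Re (u n)).
    by apply/funext => n; rewrite !seriesE Re_sum.
  by apply: (@cvg_series_isq _ B) => n; exact: le_trans (le_Re_cmod _) (uB n).
have -> : (fun n => complex.Im (series u n)) = series (fun n => complex.Im (u n)).
  by apply/funext => n; rewrite !seriesE Im_sum.
by apply: (@cvg_series_isq _ B) => n; exact: le_trans (le_Im_cmod _) (uB n).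
Qed.

Lemma csum_eq u (B : R) (l : C) : (forall n, cmod (u n) <= B * isq n) ->
  series u @ \oo --> (l : C^o) -> csum u = l.
Proof. by move=> /csum_cvg cu ul; apply: cvgC_unique cu ul. Qed.

Lemma csum_le u (B : R) : (forall n, cmod (u n) <= B * isq n) -> cmod (csum u) <= 2 * B.
Proof.
move=> uB; apply: (cvgC_le (csum_cvg uB)) => n; rewrite seriesE.
apply: le_trans (cmod_sum _ _ _) _.
apply: (@le_trans _ _ (\sum_(k < n) B * isq k)); first exact: ler_sum.
have B0 : 0 <= B.
  by have := le_trans (cmod_ge0 _) (uB 0); rewrite pmulr_lge0// isq_gt0.
by rewrite -mulr_sumr mulrC ler_wpM2r// sum_isq.
Qed.

Lemma csumB u v (B B' : R) : (forall n, cmod (u n) <= B * isq n) ->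
  (forall n, cmod (v n) <= B' * isq n) ->
  csum (fun n => u n - v n) = csum u - csum v.
Proof.
move=> uB vB; apply: (@csum_eq _ (B + B')).
  move=> n; apply: le_trans (cmodD _ _) _; rewrite cmodN mulrDl lerD//.
have -> : series (fun n => u n - v n) = (fun n => series u n - series v n).
  by apply/funext => n; rewrite !seriesE sumrB.
by apply: cvgCB; [exact: csum_cvg uB|exact: csum_cvg vB].
Qed.

Lemma csumZ u (c : C) (B : R) : (forall n, cmod (u n) <= B * isq n) ->
  csum (fun n => c * u n) = c * csum u.
Proof.
move=> uB; apply: (@csum_eq _ (cmod c * B)).
  by move=> n; rewrite cmodM -mulrA ler_wpM2l// cmod_ge0.
have -> : series (fun n => c * u n) = (fun n => c * series u n).
  by apply/funext => n; rewrite !seriesE mulr_sumr.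
exact: cvgCZ (csum_cvg uB).
Qed.

Lemma csumS u (B : R) : (forall n, cmod (u n) <= B * isq n) ->
  csum u = u 0%N + csum (fun n => u n.+1).
Proof.
move=> uB; apply: (csum_eq uB).
apply/cvgC_shiftS.
have -> : (fun n => series u n.+1) = (fun n => u 0%N + series (fun n => u n.+1) n).
  by apply/funext => n; rewrite !seriesE big_ord_recl.
apply: cvgCD; first exact: cvgC_cst.
apply: (@csum_cvg _ B) => n; apply: le_trans (uB _) _.
rewrite ler_wpM2l//.
  by have := le_trans (cmod_ge0 _) (uB 0); rewrite pmulr_lge0// isq_gt0.
by rewrite lef_pV2 ?posrE ?exprn_gt0// ler_sqr ?nnegrE// ler_nat.
Qed.

Lemma csum_sum m (b : nat -> nat -> C) (c : nat -> C) (B : R) :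
  (forall n j, cmod (b n j) <= B * isq n) ->
  csum (fun n => \sum_(j < m) b n j * c j) = \sum_(j < m) csum (fun n => b n j) * c j.
Proof.
move=> bB.
have B0 : 0 <= B.
  by have := le_trans (cmod_ge0 _) (bB 0 0); rewrite pmulr_lge0// isq_gt0.
apply: (@csum_eq _ (\sum_(j < m) B * cmod (c j))).
  move=> n; apply: le_trans (cmod_sum _ _ _) _; rewrite mulr_suml.
  apply: ler_sum => j _; rewrite cmodM mulrAC ler_wpM2r ?cmod_ge0//.
elim: m => [|m IH].
  rewrite (_ : series _ = cst 0); last by apply/funext => n; rewrite seriesE big1// => i _;
    rewrite big_ord0.
  rewrite big_ord0; exact: cvgC_cst.
rewrite big_ord_recr /=.
have -> : series (fun n => \sum_(j < m.+1) b n j * c j) =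
    (fun n => series (fun n => \sum_(j < m) b n j * c j) n + series (fun n => b n m) n * c m).
  apply/funext => n; rewrite !seriesE mulr_suml -big_split /=.
  by apply: eq_bigr => k _; rewrite big_ord_recr.
apply: cvgCD; first exact: IH.
apply: cvgCM; last exact: cvgC_cst.
by apply: csum_cvg => n; exact: bB.
Qed.

(** Interchange of the sum over n with an expansion in powers of h. The bound on [b n j] is uniform
    in j, so for |h| < 1/2 the tail from index J on is at most 2 B 2^(-J) [isq n], which is summable
    in n. *)
Lemma csum_power_series (b : nat -> nat -> C) (f : nat -> C) (B : R) h :
  cmod h < 2^-1 ->
  (forall n j, cmod (b n j) <= B * isq n) ->
  (forall n, series (fun j => b n j * h ^+ j) @ \oo --> (f n : C^o)) ->
  (forall n, cmod (f n) <= 2 * B * isq n) /\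
  series (fun j => csum (fun n => b n j) * h ^+ j) @ \oo --> (csum f : C^o).
Proof.
move=> h2 bB bf.
have B0 : 0 <= B.
  by have := le_trans (cmod_ge0 _) (bB 0 0); rewrite pmulr_lge0// isq_gt0.
have geom m J : \sum_(k < m) (2^-1 : R) ^+ (J + k) <= 2 * 2^-1 ^+ J.
  have e : \sum_(k < m) (2^-1 : R) ^+ (J + k) = 2 * 2^-1 ^+ J - 2 * 2^-1 ^+ (J + m).
    elim: m => [|m IH]; first by rewrite big_ord0 addn0 subrr.
    by rewrite big_ord_recr /= IH addnS exprS; field.
  by rewrite e gerBl mulr_ge0// exprn_ge0.
have bh n j : cmod (b n j * h ^+ j) <= B * isq n * 2^-1 ^+ j.
  rewrite cmodM cmodX ler_pM ?cmod_ge0 ?exprn_ge0 ?cmod_ge0//.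
  by rewrite lerXn2r ?nnegrE ?cmod_ge0 ?invr_ge0// ltW.
have tail n J : cmod (f n - \sum_(j < J) b n j * h ^+ j) <= 2 * B * 2^-1 ^+ J * isq n.
  have cv : (fun m => \sum_(k < m) b n (J + k)%N * h ^+ (J + k)) @ \oo -->
      ((f n - \sum_(j < J) b n j * h ^+ j : C) : C^o).
    have cv := (cvgC_shiftn J _ _).2 (bf n).
    have -> : (fun m => \sum_(k < m) b n (J + k)%N * h ^+ (J + k)) =
        (fun m => series (fun j => b n j * h ^+ j) (m + J)%N - \sum_(j < J) b n j * h ^+ j).
      apply/funext => m; rewrite seriesE addnC big_split_ord /=.
      by rewrite addrAC subrr add0r.
    exact: (cvgCB cv (@cvgC_cst (\sum_(j < J) b n j * h ^+ j))).
  apply: (cvgC_le cv) => m; apply: le_trans (cmod_sum _ _ _) _.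
  apply: (@le_trans _ _ (\sum_(k < m) B * isq n * 2^-1 ^+ (J + k))).
    by apply: ler_sum => k _; exact: bh.
  rewrite -mulr_sumr; apply: le_trans (ler_wpM2l _ (geom m J)) _.
    by rewrite mulr_ge0// ltW// isq_gt0.
  by rewrite le_eqVlt; apply/orP; left; apply/eqP; ring.
have fB n : cmod (f n) <= 2 * B * isq n.
  by have := tail n 0; rewrite big_ord0 subr0 expr0 mulr1.
split=> //.
(* 4 is 2 for the geometric tail times 2 for the sum of [isq]. *)
apply: (@cvgC_squeeze _ _ _ (fun J => 4 * B * 2^-1 ^+ J)) => [J|]; last first.
  rewrite -[X in _ --> X](mulr0 (4 * B)).
  apply: cvgMl_tmp; apply: cvg_expr; rewrite ger0_norm ?invr_ge0//.
  by rewrite invf_lt1// ltr1n.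
rewrite cmodB seriesE -(@csum_sum J b (fun j => h ^+ j) B)//.
have sB n : cmod (\sum_(j < J) b n j * h ^+ j) <= 2 * B * isq n.
  apply: le_trans (cmod_sum _ _ _) _.
  apply: (@le_trans _ _ (\sum_(k < J) B * isq n * 2^-1 ^+ (0 + k))).
    by apply: ler_sum => k _; exact: bh.
  rewrite -mulr_sumr; apply: le_trans (ler_wpM2l _ (geom J 0)) _.
    by rewrite mulr_ge0// ltW// isq_gt0.
  by rewrite expr0 mulr1 mulrC mulrA.
rewrite -(csumB fB sB).
apply: le_trans (csum_le (fun n => tail n J)) _.
by rewrite le_eqVlt; apply/orP; left; apply/eqP; ring.
Qed.

(** Taylor's formula by interpolation: with S the partial sum at w (1 - t), the function S e^(tw)
    runs from the partial sum at t = 0 to e^w at t = 1. Its derivative telescopes to the single term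
    w^(N+1) (1 - t)^N / N! e^(tw), which the mean value inequality bounds. *)
Lemma cexp_series w : series (fun n => w ^+ n / n`!%:R) @ \oo --> (cexp w : C^o).
Proof.
pose p n (t : R) : C := ((1 - t) ^+ n / n`!%:R)%:C.
pose S N (t : R) : C := \sum_(n < N) w ^+ n * p n t.
have d1 (t : R) : is_derive t 1 (fun t : R => 1 - t) (-1).
  by apply: is_derive_eq2 (is_deriveB (is_derive_cst (1 : R) t 1) (is_derive_id t 1)) _ _ => //;
    rewrite sub0r.
have dp n t : is_cderive (p n.+1) t (- p n t).
  have h := is_deriveX n.+1 (d1 t).
  have h2 : is_derive t 1 (fun t : R => (1 - t) ^+ n.+1 / n.+1`!%:R) (- ((1 - t) ^+ n / n`!%:R)).
    apply: is_derive_eq2 (is_deriveZ (n.+1`!%:R^-1) h) _ _ => [x|].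
      by rewrite /GRing.scale /= mulrC exprfctE.
    rewrite /GRing.scale /= factS natrM.
    have f0 : (n`!%:R : R) != 0 by rewrite pnatr_eq0 -lt0n fact_gt0.
    have n0 : (n.+1%:R : R) != 0 by rewrite pnatr_eq0.
    by move: (n.+1%:R : R) n0 => q q0; field; rewrite q0 f0.
  by apply: is_cderive_eq (is_cderive_real h2) _ _ => //; rewrite /p rmorphN.
have dS N t : is_cderive (S N.+1) t (- (w * S N t)).
  elim: N => [|N IH].
    apply: is_cderive_eq (is_cderive_cst 1 t) _ _ => [x|].
      by rewrite /S big_ord_recr big_ord0 /= /p !expr0 fact0 invr1 !mulr1 add0r.
    by rewrite /S big_ord0 mulr0 oppr0.
  apply: is_cderive_eq (is_cderiveD IH (is_cderiveZ (w ^+ N.+1) (dp N t))) _ _ => [x|].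
    by rewrite [in RHS]/S big_ord_recr.
  by rewrite [S N.+1 t]/S big_ord_recr /= -/(S N t) exprS; ring.
have dE N t : is_cderive (fun t => S N.+1 t * cexp (t%:C * w)) t
    (w ^+ N.+1 * p N t * cexp (t%:C * w)).
  apply: is_cderive_eq (is_cderiveM (dS N t) (is_cderive_cexp (is_cderive_linear w t))) _ _ => //.
  by rewrite [S N.+1 t]/S big_ord_recr /= -/(S N t) exprS; ring.
have bnd N : cmod (series (fun n => w ^+ n / n`!%:R) N.+1 - cexp w) <=
    2 * (cmod w * expR (cmod w)) * exp_coeff (cmod w) N.
  have := @cMVT_le _ (fun t => S N.+1 t * cexp (t%:C * w)) _ 0 1
    (cmod w ^+ N.+1 * N`!%:R^-1 * expR (cmod w)) ler01 (fun t _ => dE N t).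
  have -> : S N.+1 1 * cexp (1%:C * w) = cexp w.
    rewrite /S big_ord_recl big1 ?addr0 => [|i _].
      by rewrite /p !expr0 fact0 invr1 mulr1 -[1%:C]/(1 : C) !mul1r.
    by rewrite /p subrr expr0n /= mul0r mulr0.
  have -> : S N.+1 0 * cexp (0%:C * w) = series (fun n => w ^+ n / n`!%:R) N.+1.
    rewrite mul0r cexp0 mulr1 seriesE; apply: eq_bigr => i _.
    by rewrite /p subr0 expr1n mul1r fmorphV rmorph_nat.
  rewrite cmodB => H; apply: le_trans (H _) _ => [t /andP[t0 t1]|].
    rewrite cmodM [cmod (w ^+ _ * _)]cmodM cmodX cmod_cexp /p cmod_real.
    rewrite ler_pM ?expR_ge0 ?mulr_ge0 ?exprn_ge0 ?cmod_ge0//.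
      rewrite ler_wpM2l ?exprn_ge0 ?cmod_ge0//.
      rewrite normrM normrX [`|_^-1|]ger0_norm ?invr_ge0//.
      rewrite ler_piMl ?invr_ge0// exprn_ile1// ger0_norm; lra.
    rewrite ler_expR cReM /= mul0r subr0.
    apply: le_trans (ler_norm _) _; rewrite normrM (ger0_norm t0).
    by rewrite (le_trans _ (le_Re_cmod w))// ler_piMl.
  by rewrite /exp_coeff /= le_eqVlt; apply/orP; left; apply/eqP; rewrite exprS; ring.
apply/cvgC_shiftS; apply: (cvgC_squeeze bnd).
rewrite -[X in _ --> X](mulr0 (2 * (cmod w * expR (cmod w)))).
by apply: cvgMl_tmp; exact: cvg_exp_coeff.
Qed.

End Summation.

Arguments cvgC_cst {R} c [t] _.
Arguments cvgCZ {R} c {u l} _ [t] _.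

(** * Iterated summation by parts *)

Section AbelSummation.
Variable R : realType.
Notation C := R[i].
Implicit Types (z w s h : C) (x y : R) (f g : R -> C).

Definition fdiff f x : C := f (x + 1) - f x.

(* The exponent 3 makes the terms at x + n summable and leaves a factor 1 / x. *)
Definition decay k f (B : R) := forall x, 1 <= x -> cmod (iter k fdiff f x) <= B / x ^+ 3.

(** The exponent is left free because x^(-s) may grow. The bounds serve on [1, 2], where x^p is
    bounded, or against a geometric factor. *)
Definition polyb p f (A : R) := forall x, 1 <= x -> cmod (f x) <= A * x ^+ p.

(* The sum of z^n f (x + n), after k summations by parts. *)
Fixpoint abelsum z k f x : C :=
  if k is k'.+1 then (f x + z * abelsum z k' (fdiff f) x) / (1 - z)
  else csum (fun n => z ^+ n * f (x + n%:R)).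

Lemma decay_ge0 k f B : decay k f B -> 0 <= B.
Proof.
by move=> /(_ 1 (lexx _)); rewrite expr1n divr1; apply: le_trans; exact: cmod_ge0.
Qed.

Lemma decayS k f B : decay k.+1 f B = decay k (fdiff f) B.
Proof. by rewrite /decay iterSr. Qed.

Lemma shift_cube x n : 1 <= x -> ((x + n%:R) ^+ 3)^-1 <= x^-1 * isq R n.
Proof.
move=> x1; have n0 : (0 : R) <= n%:R by rewrite ler0n.
have x0 : 0 < x by lra.
have xn0 : 0 < x + n%:R by lra.
rewrite /isq -invfM lef_pV2 ?posrE ?mulr_gt0 ?exprn_gt0//.
have h : n.+1%:R ^+ 2 <= (x + n%:R) ^+ 2.
  by rewrite lerXn2r ?nnegrE -?natr1; lra.
rewrite [leRHS]exprS; apply: ler_pM; [lra|exact: exprn_ge0|lra|exact: h].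
Qed.

Lemma decay_term z f B x n : cmod z <= 1 -> decay 0 f B -> 1 <= x ->
  cmod (z ^+ n * f (x + n%:R)) <= B / x * isq R n.
Proof.
move=> z1 fB x1; have n0 : (0 : R) <= n%:R by rewrite ler0n.
rewrite cmodM cmodX; apply: le_trans (ler_piMl _ _) _; rewrite ?cmod_ge0//.
  by rewrite exprn_ile1// cmod_ge0.
apply: le_trans (fB _ _) _; first by lra.
by rewrite -mulrA ler_wpM2l ?(decay_ge0 fB)// shift_cube.
Qed.

Lemma decay_term1 z f B x n : cmod z <= 1 -> decay 0 f B -> 1 <= x ->
  cmod (z ^+ n * f (x + n%:R)) <= B * isq R n.
Proof.
move=> z1 fB x1; apply: le_trans (decay_term n z1 fB x1) _.
rewrite ler_wpM2r//; first by rewrite ltW// isq_gt0.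
by rewrite ler_piMr ?(decay_ge0 fB)// invf_le1//; lra.
Qed.

(** The recurrence of the formal sum of z^n f(x + n). It survives the summations by parts and so
    holds even where that series diverges. *)
Lemma abelsum_step z k f B x : cmod z <= 1 -> z != 1 -> decay k f B -> 1 <= x ->
  abelsum z k f x = f x + z * abelsum z k f (x + 1).
Proof.
move=> z1 zn1; elim: k f B x => [|k IH] f B x fB x1 /=.
  rewrite (csumS (fun n => decay_term1 n z1 fB x1)) addr0 expr0 mul1r.
  have x11 : 1 <= x + 1 by rewrite (le_trans x1)// lerDl.
  rewrite -(csumZ z (fun n => decay_term1 n z1 fB x11)).
  congr (_ + csum _); apply/funext => n; rewrite mulrA -exprS; congr (_ * f _).
  by rewrite -natr1; ring.
rewrite decayS in fB; have z0 : 1 - z != 0 by rewrite subr_eq0 eq_sym.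
rewrite (IH _ _ _ fB x1) /fdiff -/(fdiff f); field => //.
Qed.

(** The recurrence iterated: the remainder of a partial sum is explicit. Both the convergence for Re
    s > 1 and the unfolding of the integral rest on it. *)
Lemma abelsum_partial z k f B x N : cmod z <= 1 -> z != 1 -> decay k f B -> 1 <= x ->
  \sum_(n < N) z ^+ n * f (x + n%:R) = abelsum z k f x - z ^+ N * abelsum z k f (x + N%:R).
Proof.
move=> z1 zn1 fB x1; elim: N => [|N IH].
  by rewrite big_ord0 expr0 mul1r addr0 subrr.
have n0 : (0 : R) <= N%:R by rewrite ler0n.
rewrite big_ord_recr /= IH (abelsum_step z1 zn1 fB (x := x + N%:R)); last by lra.
by rewrite -natr1 addrA exprSr; ring.
Qed.

Lemma abelsum_cvg0 z k f B x : cmod z <= 1 -> decay k f B -> 1 <= x ->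
  (fun n => f (x + n%:R)) @ \oo --> ((0 : C) : C^o) ->
  (fun n => abelsum z k f (x + n%:R)) @ \oo --> ((0 : C) : C^o).
Proof.
move=> z1; elim: k f B x => [|k IH] f B x fB x1 f0 /=.
  (* The factor 1 / x left over by the cubic decay gives 2 B / (x + n). *)
  apply: (@cvgC_squeeze _ _ _ (fun n => 2 * B * n.+1%:R^-1)) => [n|]; last first.
    rewrite -[X in _ --> X](mulr0 (2 * B)); apply: cvgMl_tmp.
    exact: (@cvg_harmonic R).
  have n0 : (0 : R) <= n%:R by rewrite ler0n.
  have xn : 1 <= x + n%:R by lra.
  rewrite subr0; apply: le_trans (csum_le (fun m => decay_term m z1 fB xn)) _.
  rewrite -mulrA ler_wpM2l// ler_wpM2l ?(decay_ge0 fB)//.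
  by rewrite lef_pV2 ?posrE -?natr1; lra.
rewrite decayS in fB.
have fd0 : (fun n => fdiff f (x + n%:R)) @ \oo --> ((0 : C) : C^o).
  suff : (fun n => fdiff f (x + n%:R)) @ \oo --> ((0 - 0 : C) : C^o) by rewrite subr0.
  have f0' := f0; apply: cvgCB _ f0'.
  have -> : (fun n => f (x + n%:R + 1)) = (fun n => f (x + n.+1%:R)).
    by apply/funext => n; rewrite -natr1 addrA.
  exact: (cvgC_shiftS (fun n => f (x + n%:R)) 0).2.
have := cvgCM (cvgCD f0 (cvgCZ z (IH _ _ _ fB x1 fd0))) (cvgC_cst (1 - z)^-1).
by rewrite mulr0 addr0 mul0r.
Qed.

Lemma polyb_fdiff p f A : polyb p f A -> polyb p (fdiff f) (A * (2 ^+ p + 1)).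
Proof.
move=> fA x x1.
have A0 : 0 <= A.
  by have := fA 1 (lexx _); rewrite expr1n mulr1; apply: le_trans; exact: cmod_ge0.
apply: le_trans (cmodD _ _) _; rewrite cmodN.
have h1 := fA _ x1; have h2 : cmod (f (x + 1)) <= A * (2 ^+ p * x ^+ p).
  apply: le_trans (fA _ _) _; first by lra.
  by rewrite ler_wpM2l// -exprMn lerXn2r ?nnegrE; lra.
by rewrite mulrDr mulr1 mulrDl -mulrA lerD.
Qed.

Lemma polyb_ge0 p f A : polyb p f A -> 0 <= A.
Proof.
by move=> /(_ 1 (lexx _)); rewrite expr1n mulr1; apply: le_trans; exact: cmod_ge0.
Qed.

(** The bound is uniform in z on the closed disc away from 1, as dominated convergence requires when
    z = e^(-w) moves to the unit circle. *)
Lemma abelsum_polyb p k f A B d : 0 < d -> polyb p f A -> decay k f B ->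
  exists A', forall z, cmod z <= 1 -> d <= cmod (1 - z) -> polyb p (abelsum z k f) A'.
Proof.
move=> d0; elim: k f A B => [|k IH] f A B fA fB.
  exists (2 * B) => z z1 _ x x1 /=.
  apply: le_trans (csum_le (fun m => decay_term1 m z1 fB x1)) _.
  by rewrite ler_peMr ?mulr_ge0 ?(decay_ge0 fB)// exprn_ege1.
rewrite decayS in fB.
have [A' hA'] := IH _ _ _ (polyb_fdiff fA) fB.
exists ((A + A') / d) => z z1 dz x x1 /=.
have /= h := hA' z z1 dz x x1; have h2 := fA x x1.
rewrite cmodM cmodV mulrAC; apply: ler_pM; rewrite ?cmod_ge0 ?invr_ge0 ?cmod_ge0//.
  rewrite mulrDl; apply: le_trans (cmodD _ _) (lerD h2 _).
  by rewrite cmodM; apply: le_trans h; rewrite ler_piMl ?cmod_ge0.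
by rewrite lef_pV2 ?posrE// (lt_le_trans d0).
Qed.

Lemma expn_dist z w n : cmod z <= 1 -> cmod w <= 1 ->
  cmod (z ^+ n - w ^+ n) <= n%:R * cmod (z - w).
Proof.
move=> z1 w1; elim: n => [|n IH]; first by rewrite subrr cmod0 mul0r.
have -> : z ^+ n.+1 - w ^+ n.+1 = z * (z ^+ n - w ^+ n) + (z - w) * w ^+ n.
  by rewrite !exprS; ring.
apply: le_trans (cmodD _ _) _; rewrite !cmodM cmodX -natr1 mulrDl mul1r lerD//.
  by apply: le_trans IH; rewrite ler_piMl ?cmod_ge0.
by rewrite ler_piMr ?cmod_ge0// exprn_ile1// cmod_ge0.
Qed.

(** Continuity in z up to the unit circle. Before any summation by parts, |z^n - w^n| <= n |z - w|,
    and the factor n is absorbed by the cubic decay, since n / (x + n)^3 <= 1 / (n + 1)^2. *)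
Lemma abelsum_lipschitz_z p k f A B d : 0 < d -> polyb p f A -> decay k f B ->
  exists A', forall z w, cmod z <= 1 -> cmod w <= 1 -> d <= cmod (1 - z) -> d <= cmod (1 - w) ->
    polyb p (fun x => abelsum z k f x - abelsum w k f x) (A' * cmod (z - w)).
Proof.
move=> d0; elim: k f A B => [|k IH] f A B fA fB.
  have B0 := decay_ge0 fB.
  exists (2 * B) => z w z1 w1 _ _ x x1 /=.
  rewrite -(csumB (fun m => decay_term1 m z1 fB x1) (fun m => decay_term1 m w1 fB x1)).
  apply: (@le_trans _ _ (2 * (B * cmod (z - w)))).
    apply: csum_le => n; rewrite -mulrBl cmodM.
    have n0 : (0 : R) <= n%:R by rewrite ler0n.
    have xn0 : 0 < x + n%:R by lra.
    apply: (@le_trans _ _ (n%:R * cmod (z - w) * (B / (x + n%:R) ^+ 3))).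
      apply: ler_pM; rewrite ?cmod_ge0 ?expn_dist//; apply: fB; lra.
    have -> : n%:R * cmod (z - w) * (B / (x + n%:R) ^+ 3) =
      B * cmod (z - w) * (n%:R / (x + n%:R) ^+ 3) by ring.
    rewrite ler_wpM2l ?mulr_ge0 ?cmod_ge0// /isq.
    rewrite [leRHS](_ : _ = 1 * (n.+1%:R ^+ 2)^-1); last by rewrite mul1r.
    rewrite exprS invfM mulrA ler_pM//.
    - by rewrite mulr_ge0// invr_ge0// ltW.
    - by rewrite invr_ge0 exprn_ge0// ltW.
    - by rewrite ler_pdivrMr// mul1r; lra.
    - by rewrite lef_pV2 ?posrE ?exprn_gt0// lerXn2r ?nnegrE -?natr1; lra.
  rewrite mulrA ler_peMr ?mulr_ge0 ?cmod_ge0// exprn_ege1//.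
rewrite decayS in fB.
have [L hL] := abelsum_polyb d0 (polyb_fdiff fA) fB.
have [K hK] := IH _ _ _ (polyb_fdiff fA) fB.
exists ((A + L) / d ^+ 2 + K / d) => z w z1 w1 dz dw x x1 /=.
have zn0 : 1 - z != 0 by rewrite -cmod_gt0 (lt_le_trans d0).
have wn0 : 1 - w != 0 by rewrite -cmod_gt0 (lt_le_trans d0).
(* The first summand is the change of z with the inner sum frozen and brings d^(-2); the second is
   the change of the inner sum, bounded by induction, and brings d^(-1). *)
have -> : (f x + z * abelsum z k (fdiff f) x) / (1 - z) -
          (f x + w * abelsum w k (fdiff f) x) / (1 - w) =
  (z - w) * (f x + abelsum z k (fdiff f) x) * ((1 - z)^-1 * (1 - w)^-1) +
  w * (abelsum z k (fdiff f) x - abelsum w k (fdiff f) x) / (1 - w).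
  by field; rewrite zn0 wn0.
have /= h1 := hL z z1 dz x x1; have /= h2 := hK z w z1 w1 dz dw x x1.
have h3 := fA x x1.
have iz : cmod (1 - z)^-1 <= d^-1.
  by rewrite cmodV lef_pV2 ?posrE// (lt_le_trans d0).
have iw : cmod (1 - w)^-1 <= d^-1.
  by rewrite cmodV lef_pV2 ?posrE// (lt_le_trans d0).
apply: le_trans (cmodD _ _) _; rewrite (_ : ((A + L) / d ^+ 2 + K / d) * cmod (z - w) * x ^+ p =
  (A + L) / d ^+ 2 * cmod (z - w) * x ^+ p + K / d * cmod (z - w) * x ^+ p); last by ring.
apply: lerD.
  rewrite !cmodM.
  have -> : (A + L) / d ^+ 2 * cmod (z - w) * x ^+ p =
    cmod (z - w) * ((A + L) * x ^+ p) * (d^-1 * d^-1) by rewrite expr2 invfM; ring.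
  rewrite ler_pM ?mulr_ge0 ?cmod_ge0//; last by rewrite ler_pM ?cmod_ge0.
  by rewrite ler_wpM2l ?cmod_ge0// mulrDl (le_trans (cmodD _ _))// lerD.
rewrite !cmodM.
have -> : K / d * cmod (z - w) * x ^+ p = (K * cmod (z - w) * x ^+ p) * d^-1 by ring.
rewrite ler_pM ?mulr_ge0 ?cmod_ge0//.
by apply: le_trans h2; rewrite ler_piMl ?cmod_ge0.
Qed.

Lemma is_cderive_fdiff k f g : (forall x, 0 < x -> is_cderive f x (g x)) ->
  forall x, 0 < x -> is_cderive (iter k fdiff f) x (iter k fdiff g x).
Proof.
move=> fg; elim: k => [|k IH] x x0 //=; first exact: fg.
apply: is_cderiveB (IH _ x0); apply: is_cderive_shift; apply: IH; lra.
Qed.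

(** Serves twice: for the measurability of the integrand and for the pointwise convergence of its
    Fourier series. The points of [1, 2] are the 1 + x with x in [0, 1]. The derivative g decays as
    well, so the increments are summed term by term. *)
Lemma abelsum_lipschitz_x p z k f g A B B' : cmod z <= 1 -> z != 1 ->
  (forall x, 0 < x -> is_cderive f x (g x)) ->
  polyb p g A -> decay k g B -> decay k f B' ->
  exists K, forall x y, 1 <= x <= 2 -> 1 <= y <= 2 ->
    cmod (abelsum z k f x - abelsum z k f y) <= K * `|x - y|.
Proof.
move=> z1 zn1; elim: k f g A B B' => [|k IH] f g A B B' fg gA gB fB.
  have B0 := decay_ge0 gB.
  exists (4 * B) => x y.
  wlog yx : x y / y <= x => [wl|] hx hy.
    have [|/ltW] := leP y x => xy; first exact: wl.
    by rewrite cmodB distrC; apply: wl.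
  rewrite ger0_norm ?subr_ge0//=.
  have x1 : 1 <= x by case/andP: hx.
  have y1 : 1 <= y by case/andP: hy.
  rewrite -(csumB (fun m => decay_term1 m z1 fB x1) (fun m => decay_term1 m z1 fB y1)).
  rewrite (_ : 4 * B * (x - y) = 2 * (2 * B * (x - y))); last by ring.
  apply: csum_le => n; rewrite -mulrBr cmodM cmodX.
  have n0 : (0 : R) <= n%:R by rewrite ler0n.
  apply: le_trans (ler_piMl _ _) _; rewrite ?cmod_ge0//.
    by rewrite exprn_ile1// cmod_ge0.
  have := @cMVT_le _ f g (y + n%:R) (x + n%:R) (B * isq R n).
  have -> : x + n%:R - (y + n%:R) = x - y by ring.
  move=> h; apply: le_trans (h _ _ _) _.
  - by lra.
  - by move=> t tn; apply: fg; lra.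
  - move=> t /andP[tn _]; have t1 : 1 <= t by lra.
    (* The termwise bound with z = 1 at the point t - n >= 1 bounds g t by B [isq n]. *)
    have := @decay_term1 1 g B (t - n%:R) n _ gB; rewrite expr1n mul1r subrK.
    by apply; rewrite ?cmod1//; lra.
  - by rewrite le_eqVlt; apply/orP; left; apply/eqP; ring.
have gB' := gB; have fB' := fB; rewrite decayS in gB'; rewrite decayS in fB'.
have fg' := is_cderive_fdiff 1 fg; rewrite /= in fg'.
have [K hK] := IH _ _ _ _ _ fg' (polyb_fdiff gA) gB' fB'.
exists ((2 * (A * 2 ^+ p) + K) / cmod (1 - z)) => x y hx hy /=.
have h1 : cmod (f x - f y) <= 2 * (A * 2 ^+ p) * `|x - y|.
  wlog yx : x y hx hy / y <= x => [wl|].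
    have [|/ltW] := leP y x => xy; first exact: wl.
    by rewrite cmodB distrC; apply: wl.
  rewrite ger0_norm ?subr_ge0//; apply: (@cMVT_le _ f g) => // t tn.
    by apply: fg; lra.
  apply: le_trans (gA _ _) _; first by lra.
  rewrite ler_wpM2l ?(polyb_ge0 gA)// lerXn2r ?nnegrE; lra.
have h2 := hK x y hx hy.
rewrite -mulrBl cmodM cmodV mulrAC ler_wpM2r ?invr_ge0 ?cmod_ge0//.
have -> : f x + z * abelsum z k (fdiff f) x - (f y + z * abelsum z k (fdiff f) y) =
  (f x - f y) + z * (abelsum z k (fdiff f) x - abelsum z k (fdiff f) y) by ring.
rewrite mulrDl; apply: le_trans (cmodD _ _) (lerD h1 _).
by rewrite cmodM; apply: le_trans h2; rewrite ler_piMl ?cmod_ge0.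
Qed.

(** The source of analyticity in s: when the coefficients decay uniformly in j, an expansion in
    powers of h passes through the infinite sum at level 0, and through the finitely many operations
    above it by linearity. *)
Lemma abelsum_power_series z k (c : nat -> R -> C) f B h x :
  cmod z <= 1 -> cmod h < 2^-1 -> 1 <= x ->
  (forall j, decay k (c j) B) ->
  (forall x, 1 <= x -> series (fun j => c j x * h ^+ j) @ \oo --> (f x : C^o)) ->
  series (fun j => abelsum z k (c j) x * h ^+ j) @ \oo --> (abelsum z k f x : C^o).
Proof.
move=> z1 h2; elim: k c f B x => [|k IH] c f B x x1 cB cf /=.
  apply: (csum_power_series (B := B) h2 _ _).2.
    by move=> n j; apply: decay_term1.
  move=> n; have n0 : (0 : R) <= n%:R by rewrite ler0n.
  have xn : 1 <= x + n%:R by lra.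
  have := cvgCZ (z ^+ n) (cf _ xn).
  rewrite (_ : (fun m => _) = series (fun j => z ^+ n * c j (x + n%:R) * h ^+ j))//.
  apply/funext => m; rewrite !seriesE mulr_sumr; apply: eq_bigr => i _.
  by rewrite mulrA.
have cB' j : decay k (fdiff (c j)) B by rewrite -decayS.
have cf' y : 1 <= y -> series (fun j => fdiff (c j) y * h ^+ j) @ \oo --> (fdiff f y : C^o).
  move=> y1; have y11 : 1 <= y + 1 by lra.
  have := cvgCB (cf _ y11) (cf _ y1).
  rewrite (_ : (fun m => _) = series (fun j => fdiff (c j) y * h ^+ j))//.
  apply/funext => m; rewrite !seriesE -sumrB; apply: eq_bigr => i _.
  by rewrite /fdiff mulrBl.
have := cvgCM (cvgCD (cf _ x1) (cvgCZ z (IH _ _ _ _ x1 cB' cf'))) (cvgC_cst (1 - z)^-1).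
rewrite (_ : (fun m => _) = series (fun j => (c j x + z * abelsum z k (fdiff (c j)) x) / (1 - z) * h ^+ j))//.
apply/funext => m; rewrite !seriesE mulr_sumr -big_split /= mulr_suml.
by apply: eq_bigr => i _; ring.
Qed.

Lemma iter_fdiffD k f g : iter k fdiff (fun x => f x + g x) =
  (fun x => iter k fdiff f x + iter k fdiff g x).
Proof.
elim: k => //= k ->; apply/funext => x; rewrite /fdiff; ring.
Qed.

Lemma iter_fdiffZ k (a : C) f : iter k fdiff (fun x => a * f x) =
  (fun x => a * iter k fdiff f x).
Proof.
elim: k => //= k ->; apply/funext => x; rewrite /fdiff; ring.
Qed.

(** * The powers x^(-s) and the decay of their differences *)

(* x ^ (- s), and the coefficients of its expansion in powers of h at s + h *)
Definition npow s x : C := cexp (- s * (ln x)%:C).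
Definition npow_coef s (j : nat) x : C := npow s x * ((- ln x) ^+ j / j`!%:R)%:C.

Lemma npow_coef0 s : npow_coef s 0 = npow s.
Proof. by apply/funext => x; rewrite /npow_coef expr0 fact0 divr1 mulr1. Qed.

Lemma cmod_npow s x : cmod (npow s x) = expR (- complex.Re s * ln x).
Proof. by rewrite cmod_cexp cReM /= mulr0 subr0 cReN. Qed.

Lemma is_cderive_npow s x : 0 < x -> is_cderive (npow s) x (- s * npow (s + 1) x).
Proof.
move=> x0; apply: is_cderive_eq (is_cderive_pow (- s) x0) _ _ => //.
by rewrite /npow opprD.
Qed.

Lemma npow_div s x : 0 < x -> npow (s + 1) x = npow s x * (x^-1)%:C.
Proof.
move=> x0; rewrite /npow opprD mulrDl cexpD; congr (_ * _).
by rewrite mulN1r cexpN cexp_real lnK ?posrE// fmorphV.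
Qed.

(** Differentiation stays within the family and raises s by 1; this is the gain of one power of x
    per difference. *)
Lemma is_cderive_npow_coef s j x : 0 < x -> is_cderive (npow_coef s j) x
  (- s * npow_coef (s + 1) j x + - 1 * (if j is j'.+1 then npow_coef (s + 1) j' x else 0)).
Proof.
move=> x0.
have d1 : is_derive x 1 (fun x => - ln x) (- x^-1) := is_deriveN (is_derive1_ln x0).
case: j => [|j].
  rewrite npow_coef0; apply: is_cderive_eq (is_cderive_npow s x0) _ _ => //.
  by rewrite npow_coef0 mulr0 addr0.
have d2 : is_derive x 1 (fun x => (- ln x) ^+ j.+1 / j.+1`!%:R) (- x^-1 * ((- ln x) ^+ j / j`!%:R)).
  apply: is_derive_eq2 (is_deriveZ (j.+1`!%:R^-1) (is_deriveX j.+1 d1)) _ _ => [t|].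
    by rewrite /GRing.scale /= mulrC exprfctE.
  rewrite /GRing.scale /= factS natrM.
  have f0 : (j`!%:R : R) != 0 by rewrite pnatr_eq0 -lt0n fact_gt0.
  have n0 : (j.+1%:R : R) != 0 by rewrite pnatr_eq0.
  by move: (j.+1%:R : R) n0 => q q0; field; rewrite q0 f0 gt_eqF.
apply: is_cderive_eq (is_cderiveM (is_cderive_npow s x0) (is_cderive_real d2)) _ _ => //.
rewrite /npow_coef npow_div//; move: (npow s x) (x^-1) (_ / _) (_ / _) => u a b c.
by apply: complex_ext; rewrite !ReIm_simp /=; ring.
Qed.

(** B does not depend on j. When no difference is left, (ln x)^j / j! <= x costs one power of x,
    hence 4 where the decay has exponent 3. Each difference is traded for a derivative by the mean
    value inequality, and s for s + 1. *)
Lemma npow_coef_decay k s : 4 <= complex.Re s + k%:R ->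
  exists B, forall j, decay k (npow_coef s j) B.
Proof.
elim: k s => [|k IH] s.
  rewrite addr0 => s4; exists 1 => j x x1 /=; rewrite mul1r.
  have l0 : 0 <= ln x by rewrite ln_ge0.
  have x0 : 0 < x by lra.
  rewrite /npow_coef cmodM cmod_npow cmod_real normrM normrX normrN.
  rewrite (ger0_norm l0) ger0_norm ?invr_ge0//.
  have : expR (- complex.Re s * ln x) <= expR (- 4%:R * ln x).
    by rewrite ler_expR ler_wpM2r//; lra.
  rewrite mulNr expRN expRM_natl lnK ?posrE// => h1.
  have h2 : ln x ^+ j / j`!%:R <= x.
    case: j => [|j]; first by rewrite expr0 fact0 divr1.
    by have := expR_ge1Dxn j l0; rewrite lnK ?posrE//; lra.
  rewrite (_ : (x ^+ 3)^-1 = (x ^+ 4)^-1 * x); last by field; rewrite gt_eqF.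
  rewrite ler_pM ?expR_ge0// mulr_ge0 ?exprn_ge0 ?invr_ge0//.
rewrite -natr1 => sk.
have [B hB] := IH (s + 1) ltac:(rewrite cReD /=; lra).
have B0 := decay_ge0 (hB 0%N).
(* |s| + 1 stands for the two terms of the derivative, 2 for the mean value inequality. *)
exists (2 * (cmod s + 1) * B) => j x x1.
have x0 : 0 < x by lra.
pose g y := - s * npow_coef (s + 1) j y + - 1 * (if j is j'.+1 then npow_coef (s + 1) j' y else 0).
have dg := @is_cderive_fdiff k (npow_coef s j) g (is_cderive_npow_coef s j).
have bg y : x <= y -> cmod (iter k fdiff g y) <= (cmod s + 1) * B / x ^+ 3.
  move=> xy; have y1 : 1 <= y by lra.
  have hy : B / y ^+ 3 <= B / x ^+ 3.
    by rewrite ler_wpM2l// lef_pV2 ?posrE ?exprn_gt0 ?lerXn2r ?nnegrE//; lra.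
  rewrite /g iter_fdiffD !iter_fdiffZ -mulrA mulrDl mul1r.
  apply: le_trans (cmodD _ _) _; rewrite !cmodM !cmodN cmod1 mul1r lerD//.
    by rewrite ler_wpM2l ?cmod_ge0// (le_trans (hB _ _ _)).
  apply: le_trans hy; case: (j) => [|j']; last exact: hB.
  have -> : iter k fdiff (fun=> 0) y = 0.
    elim: (k) y {xy y1} => //= k' IH' y; rewrite /fdiff !IH' subr0 //.
  by rewrite cmod0 divr_ge0// exprn_ge0; lra.
have := @cMVT_le _ (iter k fdiff (npow_coef s j)) (iter k fdiff g) x (x + 1)
  ((cmod s + 1) * B / x ^+ 3).
rewrite addrAC subrr add0r mulr1 /= -/(fdiff _ _) => H.
have -> : 2 * (cmod s + 1) * B / x ^+ 3 = 2 * ((cmod s + 1) * B / x ^+ 3) by ring.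
apply: H; first by lra.
- by move=> y /andP[xy _]; apply: dg; lra.
- by move=> y /andP[xy _]; exact: bg.
Qed.

Lemma npow_decay k s : 4 <= complex.Re s + k%:R -> exists B, decay k (npow s) B.
Proof. by move=> /npow_coef_decay[B] /(_ 0%N); rewrite npow_coef0; exists B. Qed.

Lemma npow_series s h x : series (fun j => npow_coef s j x * h ^+ j) @ \oo -->
  (npow (s + h) x : C^o).
Proof.
have := cvgCZ (npow s x) (@cexp_series _ (- h * (ln x)%:C)).
rewrite -cexpD -mulrDl -opprD -/(npow _ _).
rewrite (_ : (fun m => _) = series (fun j => npow_coef s j x * h ^+ j))//.
apply/funext => m; rewrite !seriesE mulr_sumr; apply: eq_bigr => i _.
rewrite /npow_coef rmorphM fmorphV rmorph_nat /= rmorphXn rmorphN /= -[RHS]mulrA; congr (_ * _).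
by rewrite [RHS]mulrAC -exprMn; congr (_ ^+ _ * _); ring.
Qed.

Lemma npow_polyb s : exists p, polyb p (npow s) 1.
Proof.
pose p := Num.bound `|complex.Re s|; exists p => x x1.
have l0 : 0 <= ln x by rewrite ln_ge0.
rewrite mul1r cmod_npow -[x in leRHS]lnK ?posrE; last by lra.
rewrite -expRM_natl ler_expR ler_wpM2r// ltW//.
by apply: le_lt_trans (ler_norm _) _; rewrite normrN archi_boundP.
Qed.

End AbelSummation.

(** * The analytic continuation of Lerch's function *)

Section LerchContinuation.
Variable R : realType.
Notation C := R[i].
Implicit Types (z w s h : C) (x y lambda alpha : R) (f g : R -> C).

Lemma decay_succ k f (B : R) : decay k f B -> decay k.+1 f (2 * B).
Proof.
move=> fB x x1 /=; apply: le_trans (cmodD _ _) _; rewrite cmodN.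
have h1 := fB _ x1; have x11 : 1 <= x + 1 by lra.
have h2 := fB _ x11; have B0 := decay_ge0 fB.
have h3 : B / (x + 1) ^+ 3 <= B / x ^+ 3.
  by rewrite ler_wpM2l// lef_pV2 ?posrE ?exprn_gt0 ?lerXn2r ?nnegrE//; lra.
by rewrite -mulrA; lra.
Qed.

(** At level 0 the sum A of the differences is A(x + 1) - A(x), and the recurrence A(x) = f(x) + z
    A(x + 1) then gives the same value after one more summation by parts. *)
Lemma abelsum_succ z k f (B : R) x : cmod z <= 1 -> z != 1 -> decay k f B -> 1 <= x ->
  abelsum z k.+1 f x = abelsum z k f x.
Proof.
move=> z1 zn1; have z0 : 1 - z != 0 by rewrite subr_eq0 eq_sym.
elim: k f B x => [|k IH] f B x fB x1.
  have x11 : 1 <= x + 1 by lra.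
  have e : abelsum z 0 (fdiff f) x = abelsum z 0 f (x + 1) - abelsum z 0 f x.
    rewrite /= -(csumB (fun m => decay_term1 m z1 fB x11) (fun m => decay_term1 m z1 fB x1)).
    congr csum; apply/funext => n; rewrite /fdiff mulrBr; congr (_ * f _ - _).
    by ring.
  have st := abelsum_step z1 zn1 fB x1.
  rewrite [LHS]/= -/(abelsum z 0 (fdiff f) x) e {1}(_ : f x = abelsum z 0 f x - z * abelsum z 0 f (x + 1)).
    by field.
  by rewrite {1}st addrK.
by rewrite decayS in fB; rewrite [RHS]/= -(IH _ _ _ fB x1).
Qed.

(** The continuation chooses its level as a function of s, whereas a power series around s needs a
    single level. Both levels are compared with their sum. *)
Lemma abelsum_indep z k l f (B B' : R) x : cmod z <= 1 -> z != 1 ->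
  decay k f B -> decay l f B' -> 1 <= x -> abelsum z k f x = abelsum z l f x.
Proof.
move=> z1 zn1 fB fB' x1.
have H m n (B0 : R) : decay m f B0 -> abelsum z (n + m) f x = abelsum z m f x.
  elim: n => // n IH fB0; have [B1 dB1] : exists B1, decay (n + m) f B1.
    elim: n {IH} => [|n [B1 dB1]]; first by exists B0.
    by exists (2 * B1); exact: decay_succ dB1.
  by rewrite addSn (abelsum_succ z1 zn1 dB1 x1) IH.
by rewrite -(H _ l _ fB) addnC (H _ _ _ fB').
Qed.

Lemma cvg_npow0 s x : 0 < complex.Re s -> 1 <= x ->
  (fun n => npow s (x + n%:R)) @ \oo --> ((0 : C) : C^o).
Proof.
move=> s0 x1; apply/cvgCP; apply/cvgrPdist_lt => e e0; near=> n.
rewrite sub0r normrN subr0 ger0_norm ?cmod_ge0// cmod_npow.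
rewrite -[ltRHS]lnK ?posrE// ltr_expR.
have xn : expR (- ln e / complex.Re s) < x + n%:R.
  apply: (@lt_le_trans _ _ n%:R); last by rewrite lerDr; lra.
  by near: n; exact: nbhs_infty_gtr.
have : - ln e / complex.Re s < ln (x + n%:R).
  by rewrite -ltr_expR lnK ?posrE// (lt_trans (expR_gt0 _) xn).
rewrite ltr_pdivrMr// mulrC; lra.
Unshelve. all: by end_near. Qed.

(** The convergence may be conditional: f(x + n) --> 0 suffices. Applied to x^(-s) for Re s > 1, and
    to x^(s-1) for the Fourier series itself. *)
Lemma abelsum_series z k f (B : R) x : cmod z <= 1 -> z != 1 -> decay k f B -> 1 <= x ->
  (fun n => f (x + n%:R)) @ \oo --> ((0 : C) : C^o) ->
  series (fun n => z ^+ n * f (x + n%:R)) @ \oo --> (abelsum z k f x : C^o).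
Proof.
move=> z1 zn1 fB x1 f0; have := abelsum_cvg0 z1 fB x1 f0 => /cvgCP a0.
apply: (@cvgC_squeeze _ _ _ (fun N => cmod (abelsum z k f (x + N%:R)))).
  move=> N; rewrite seriesE (abelsum_partial _ z1 zn1 fB x1) addrAC subrr add0r cmodN cmodM cmodX.
  by rewrite ler_piMl ?cmod_ge0// exprn_ile1// cmod_ge0.
by move: a0; under eq_fun do rewrite subr0.
Qed.

Lemma notin_int01 lambda : 0 < lambda < 1 -> lambda \isn't a Num.int.
Proof.
move=> /andP[l0 l1]; apply/negP => /intrP[m e]; move: l0 l1; rewrite e ltr0z.
by rewrite -[1]/(1%:~R) ltr_int => m0 m1; lia.
Qed.

(** If the coefficients below n vanish, then [a n] t^n is minus the tail of the series, which is
    O(t^(n+1)); hence |[a n]| = O(t), and t tends to 0. *)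
Lemma power_series_coef0 (a : nat -> R) (r : R) : 0 < r ->
  (forall t, 0 < t < r -> series (fun n => a n * t ^+ n) @ \oo --> (0 : R)) ->
  forall n, a n = 0.
Proof.
move=> r0 a0 n; elim/ltn_ind: n => n IH.
pose t1 := r / 2; have t10 : 0 < t1 by rewrite /t1; lra.
(* Convergence at the interior point t1 bounds the terms there, so those at t <= t1 / 2 are
   dominated by a geometric sequence of ratio at most 1/2. *)
have [B HB] : exists B, forall m, `|a m| * t1 ^+ m <= B.
  have : cvgn (series (fun n => a n * t1 ^+ n)).
    by apply/cvg_ex; exists 0; apply: a0; rewrite /t1; lra.
  move=> /cvg_series_bounded[B [_ HB]]; exists (B + 1) => m.
  have /= := HB (B + 1) ltac:(lra) m I; by rewrite normrM normrX (gtr0_norm t10).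
have B0 : 0 <= B by apply: le_trans (HB 0%N); rewrite mulr_ge0// exprn_ge0// ltW.
have key t : 0 < t -> t <= t1 / 2 -> `|a n| <= 2 * B / t1 ^+ n.+1 * t.
  move=> t0 tt.
  pose q := t / t1; have q0 : 0 < q by rewrite divr_gt0.
  have q2 : q <= 2^-1 by rewrite ler_pdivrMr// mulrC.
  have tE : t = q * t1 by rewrite /q mulfVK// gt_eqF.
  have ct : (fun N => series (fun n => a n * t ^+ n) (N + n.+1)%N) @ \oo --> (0 : R).
    rewrite (cvg_shiftn n.+1); apply: a0; rewrite /t1 in tt; lra.
  have geom m : \sum_(k < m) q ^+ (n.+1 + k) <= 2 * q ^+ n.+1.
    have e : \sum_(k < m) (2^-1 : R) ^+ k = 2 - 2 * 2^-1 ^+ m.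
      elim: m => [|m IHm]; first by rewrite big_ord0 expr0; ring.
      by rewrite big_ord_recr /= IHm exprS; field.
    under eq_bigr do rewrite exprD.
    rewrite -mulr_sumr mulrC ler_wpM2r ?exprn_ge0 ?(ltW q0)//.
    apply: (@le_trans _ _ (\sum_(k < m) (2^-1 : R) ^+ k)).
      by apply: ler_sum => k _; rewrite lerXn2r ?nnegrE ?(ltW q0)// invr_ge0.
    by rewrite e gerBl mulr_ge0// exprn_ge0// invr_ge0.
  have h : `|a n * t ^+ n| <= 2 * B * q ^+ n.+1.
    have cs : (fun N => a n * t ^+ n - series (fun n => a n * t ^+ n) (N + n.+1)%N)
        @ \oo --> (a n * t ^+ n - 0 : R).
      by apply: cvgB ct; exact: cvg_cst.
    rewrite subr0 in cs; move/cvg_norm in cs.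
    apply: (cvgr_to_le cs); apply: nearW => N.
    rewrite seriesE addnC big_split_ord /= big_ord_recr /= big1 => [|i _]; last first.
      by rewrite IH ?mul0r.
    rewrite add0r opprD addrA subrr add0r normrN.
    apply: le_trans (ler_norm_sum _ _ _) _.
    apply: (@le_trans _ _ (\sum_(k < N) B * q ^+ (n.+1 + k))).
      apply: ler_sum => k _; rewrite normrM normrX (gtr0_norm t0) {1}tE exprMn.
      by rewrite [q ^+ _ * _]mulrC mulrA ler_wpM2r ?exprn_ge0 ?(ltW q0).
    by rewrite -mulr_sumr mulrAC [leRHS]mulrC ler_wpM2l// mulrC.
  have tn : 0 < t ^+ n by rewrite exprn_gt0.
  move: h; rewrite normrM normrX (gtr0_norm t0) -ler_pdivlMr// => h.
  apply: le_trans h _; rewrite le_eqVlt; apply/orP; left; apply/eqP.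
  rewrite /q expr_div_n exprS; field.
  by rewrite !gt_eqF// exprn_gt0.
apply/eqP; rewrite -normr_eq0 eq_le normr_ge0 andbT.
pose c := 2 * B / t1 ^+ n.+1.
have c0 : 0 <= c by rewrite divr_ge0 ?mulr_ge0// exprn_ge0// ltW.
apply/ler_addgt0Pr => e e0; rewrite add0r.
pose t := Num.min (t1 / 2) (e / (c + 1)).
have t0 : 0 < t by rewrite /t lt_min !divr_gt0//; lra.
have tt1 : t <= t1 / 2 by rewrite /t ge_min lexx.
have te : t <= e / (c + 1) by rewrite /t ge_min lexx orbT.
apply: le_trans (key t t0 tt1) _; rewrite -/c.
rewrite ler_pdivlMr in te; last by lra.
by nra.
Qed.

(** Only the horizontal half-line from s to the right is used. At the supremum of the points where F
    and G differ, the two expansions agree to the right, hence have the same coefficients, hence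
    agree a little to the left as well. *)
Lemma analytic_identity (F G : C -> C) :
  (forall s, analytic_at F s) -> (forall s, analytic_at G s) ->
  (forall s, 1 < complex.Re s -> F s = G s) -> F =1 G.
Proof.
move=> aF aG FG s; apply/eqP/negP => /negP neq.
pose E := [set t : R | 0 <= t /\ F (s + t%:C) <> G (s + t%:C)].
have E0 : E 0 by split=> //; rewrite addr0; exact/eqP.
have Eub : ubound E (2 + `|complex.Re s|).
  move=> t [t0 ne]; rewrite leNgt; apply/negP => tt; apply: ne; apply: FG.
  by rewrite cReD /=; have := ler_norm (- complex.Re s); rewrite normrN; lra.
have Esup : has_sup E by split; [exists 0|exists (2 + `|complex.Re s|)].
pose t0 := sup E.
have t00 : 0 <= t0 by apply: ub_le_sup E0; case: Esup.
have above t : t0 < t -> F (s + t%:C) = G (s + t%:C).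
  move=> tt; apply: contrapT => ne; have : E t by split => //; lra.
  by move=> Et; have := ub_le_sup Esup.2 Et; rewrite -/t0; lra.
have [a [r1 [r10 ha]]] := aF (s + t0%:C).
have [b [r2 [r20 hb]]] := aG (s + t0%:C).
pose r := Num.min r1 r2.
have r0 : 0 < r by rewrite lt_min r10 r20.
have rr1 : r <= r1 by rewrite ge_min lexx.
have rr2 : r <= r2 by rewrite ge_min lexx orbT.
have near w : cmod (w - (s + t0%:C)) < r ->
    series (fun n => (a n - b n) * (w - (s + t0%:C)) ^+ n) @ \oo --> ((F w - G w : C) : C^o).
  move=> wr; have := cvgCB (ha w _) (hb w _); rewrite !normC_cmod !ltcR.
  move=> /(_ (lt_le_trans wr rr1) (lt_le_trans wr rr2)).
  rewrite (_ : (fun n => _) = series (fun n => (a n - b n) * (w - (s + t0%:C)) ^+ n))//.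
  apply/funext => N; rewrite !seriesE -sumrB; apply: eq_bigr => i _.
  by rewrite mulrBl.
have nearR t : 0 < t < r ->
    series (fun n => (a n - b n) * t%:C ^+ n) @ \oo --> ((0 : C) : C^o).
  move=> /andP[tp tr].
  have := near (s + (t0 + t)%:C); rewrite above ?ltrDl// subrr.
  rewrite (_ : s + (t0 + t)%:C - (s + t0%:C) = t%:C); last by rewrite rmorphD /=; ring.
  by apply; rewrite cmod_real gtr0_norm.
(* For real t the real and imaginary parts of the coefficients are those of two real power series
   that vanish on ]0, r[. *)
have ab n : a n - b n = 0.
  apply: complex_ext.
    apply: (power_series_coef0 (a := fun n => complex.Re (a n - b n)) r0) => t tr.
    have /cvgC_ReIm[+ _] := nearR t tr.
    rewrite (_ : (fun n => _) = series (fun n => complex.Re (a n - b n) * t ^+ n))//.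
    apply/funext => N; rewrite !seriesE Re_sum; apply: eq_bigr => i _.
    by rewrite -rmorphXn /= cReM /= mulr0 subr0.
  apply: (power_series_coef0 (a := fun n => complex.Im (a n - b n)) r0) => t tr.
  have /cvgC_ReIm[_] := nearR t tr.
  rewrite (_ : (fun n => _) = series (fun n => complex.Im (a n - b n) * t ^+ n))//.
  apply/funext => N; rewrite !seriesE Im_sum; apply: eq_bigr => i _.
  by rewrite -rmorphXn /= cImM /= mulr0 add0r.
have nearE w : cmod (w - (s + t0%:C)) < r -> F w = G w.
  move=> /near; rewrite (_ : series _ = fun=> 0) => [H|].
    by apply/eqP; rewrite -subr_eq0; apply/eqP; apply: cvgC_unique H (cvgC_cst _).
  by apply/funext => N; rewrite seriesE big1// => i _; rewrite ab mul0r.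
have : ubound E (t0 - r / 2).
  move=> t [tp ne]; rewrite leNgt; apply/negP => tt; apply: ne.
  have [|lt] := leP t t0; last exact: above.
  move=> le; apply: nearE.
  rewrite (_ : s + t%:C - (s + t0%:C) = (t - t0)%:C); last by rewrite rmorphB /=; ring.
  by rewrite cmod_real ler0_norm; lra.
move=> /(ge_sup (ex_intro _ 0 E0)); rewrite -/t0; lra.
Qed.

(** The term n = 0 is split off so that [abelsum] is evaluated at 1 + alpha, where the bounds for x
    >= 1 apply, however small alpha > 0 is. *)
Definition lerch_ext lambda alpha k s : C :=
  npow s alpha + e2pi lambda * abelsum (e2pi lambda) k (npow s) (1 + alpha).

Lemma lerch_ext_indep lambda alpha k l s : 0 < lambda < 1 -> 0 < alpha ->
  4 <= complex.Re s + k%:R -> 4 <= complex.Re s + l%:R ->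
  lerch_ext lambda alpha k s = lerch_ext lambda alpha l s.
Proof.
move=> l01 a0 /npow_decay[B hB] /npow_decay[B' hB'].
congr (_ + _ * _); apply: (abelsum_indep _ _ hB hB'); first by rewrite cmod_e2pi.
  exact: e2pi_neq1.
by lra.
Qed.

Lemma lerch_extP lambda alpha : 0 < lambda < 1 -> 0 < alpha ->
  is_lerch_zeta lambda alpha%:C
    (fun s => lerch_ext lambda alpha (Num.bound `|4 - complex.Re s|) s).
Proof.
move=> l01 a0; set K := fun s : C => Num.bound `|4 - complex.Re s|.
have KP s : 4 <= complex.Re s + (K s)%:R.
  have := ltW (archi_boundP (normr_ge0 (4 - complex.Re s))).
  by have := ler_norm (4 - complex.Re s); rewrite -/(K s); lra.
have z1 : cmod (e2pi lambda) <= 1 by rewrite cmod_e2pi.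
have zn1 := e2pi_neq1 l01.
have a1 : 1 <= 1 + alpha by lra.
split=> s hs.
  (* One level more than s requires, so that the same k serves every w at distance less than 1/2
     from s. *)
  pose k := (K s).+1.
  have ks : 5 <= complex.Re s + k%:R.
    by rewrite /k -natr1; have := KP s; lra.
  have [B hB] := @npow_coef_decay _ k s ltac:(lra).
  exists (fun j => npow_coef s j alpha + e2pi lambda * abelsum (e2pi lambda) k (npow_coef s j) (1 + alpha)), 2^-1.
  split; first by rewrite invr_gt0.
  move=> w; rewrite normC_cmod ltcR => ws.
  have wk : 4 <= complex.Re w + k%:R.
    have := le_Re_cmod (w - s); rewrite ler_norml cReD cReN => /andP[h _].
    have h1 : (2^-1 : R) <= 1 by rewrite invf_le1 ?ler1n//.
    lra.
  rewrite (lerch_ext_indep l01 a0 (KP w) wk) /lerch_ext.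
  have ps x : 1 <= x -> series (fun j => npow_coef s j x * (w - s) ^+ j) @ \oo --> (npow w x : C^o).
    by move=> _; have := @npow_series _ s (w - s) x; rewrite [s + _]addrC subrK.
  have H := abelsum_power_series z1 ws a1 hB ps.
  have H0 := @npow_series _ s (w - s) alpha; rewrite [s + _]addrC subrK in H0.
  have := cvgCD H0 (cvgCZ (e2pi lambda) H).
  rewrite (_ : (fun n => _) = series (fun n => (npow_coef s n alpha + e2pi lambda * abelsum (e2pi lambda) k (npow_coef s n) (1 + alpha)) * (w - s) ^+ n))//.
  apply/funext => N; rewrite !seriesE mulr_sumr -big_split /=.
  by apply: eq_bigr => i _; rewrite [RHS]mulrDl; congr (_ + _); rewrite mulrA.
(* The shift accounts for the term n = 0 that was split off. *)
apply/cvgC_shiftS; rewrite /lerch_ext.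
have [B hB] := npow_decay (KP s).
have H := abelsum_series z1 zn1 hB a1 (cvg_npow0 (lt_trans ltr01 hs) a1).
have := cvgCD (cvgC_cst (npow s alpha)) (cvgCZ (e2pi lambda) H).
rewrite (_ : (fun n => _) = (fun n => series (fun n0 => e2pi (lambda * n0%:R) * cpow (n0%:R + alpha%:C) (- s)) n.+1))//.
apply/funext => N; rewrite !seriesE big_ord_recl mulr0 e2pi0 mul1r.
rewrite cpow_nat_real ?add0r// -/(npow _ _); congr (_ + _).
rewrite mulr_sumr; apply: eq_bigr => i _.
have n0 : (0 : R) <= i%:R by rewrite ler0n.
rewrite /= /bump /= add1n e2piMn cpow_nat_real -?natr1; last by lra.
rewrite -/(npow _ _) exprS mulrA; congr (_ * npow _ _); ring.
Qed.

(** [lerch_zeta] is a choice among the values of all continuations; the identity theorem shows that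
    they agree with the one constructed. *)
Lemma lerch_zetaE lambda alpha k s : 0 < lambda < 1 -> 0 < alpha ->
  4 <= complex.Re s + k%:R ->
  lerch_zeta lambda alpha%:C s = lerch_ext lambda alpha k s.
Proof.
move=> l01 a0 sk; have lz := lerch_extP l01 a0.
set F := (fun s => _) in lz.
have Fs : F s = lerch_ext lambda alpha k s.
  apply: lerch_ext_indep => //.
  have := ltW (archi_boundP (normr_ge0 (4 - complex.Re s))).
  by have := ler_norm (4 - complex.Re s); lra.
rewrite -Fs /lerch_zeta; apply: xget_unique; first by exists F.
move=> _ [G lG <-]; apply: analytic_identity => [t|t|t t1].
- by apply: lG.1 => /(negP (notin_int01 l01)).
- by apply: lz.1 => /(negP (notin_int01 l01)).
- exact: cvgC_unique (lG.2 t t1) (lz.2 t t1).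
Qed.

End LerchContinuation.

(** * Integration of complex-valued functions *)

Section ComplexIntegration.
Variable R : realType.
Notation C := R[i].
Notation mu := (@lebesgue_measure R).
Implicit Types (z w s : C) (x y : R) (f g : R -> C) (D : set R).

Definition cmeasurable D f :=
  measurable_fun D (fun x => complex.Re (f x)) /\
  measurable_fun D (fun x => complex.Im (f x)).

Lemma cmeasurableD D f g : cmeasurable D f -> cmeasurable D g ->
  cmeasurable D (fun x => f x + g x).
Proof.
move=> [fr fi] [gr gi]; split.
  by under eq_fun do rewrite cReD; exact: measurable_funD.
by under eq_fun do rewrite cImD; exact: measurable_funD.
Qed.

Lemma cmeasurableM D f g : cmeasurable D f -> cmeasurable D g ->
  cmeasurable D (fun x => f x * g x).
Proof.
move=> [fr fi] [gr gi]; split.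
  by under eq_fun do rewrite cReM; apply: measurable_funB; exact: measurable_funM.
by under eq_fun do rewrite cImM; apply: measurable_funD; exact: measurable_funM.
Qed.

Lemma cmeasurable_cst D (c : C) : cmeasurable D (fun=> c).
Proof. by split; exact: measurable_cst. Qed.

Lemma cmeasurableZ D (c : C) f : cmeasurable D f -> cmeasurable D (fun x => c * f x).
Proof. by apply: cmeasurableM; exact: cmeasurable_cst. Qed.

Lemma cmeasurableN D f : cmeasurable D f -> cmeasurable D (fun x => - f x).
Proof.
by move=> /(cmeasurableZ (-1)); under [X in cmeasurable D X -> _]eq_fun do rewrite mulN1r.
Qed.

Lemma cmeasurableB D f g : cmeasurable D f -> cmeasurable D g ->
  cmeasurable D (fun x => f x - g x).
Proof. by move=> fm /cmeasurableN; apply: cmeasurableD. Qed.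

Lemma cmeasurableS D E f : measurable D -> E `<=` D ->
  cmeasurable D f -> cmeasurable E f.
Proof. by move=> mD ED [fr fi]; split; [exact: measurable_funS fr|exact: measurable_funS fi]. Qed.

Lemma open_continuous_cmeasurable D f : open D ->
  (forall x, D x -> {for x, continuous (fun x => complex.Re (f x))}) ->
  (forall x, D x -> {for x, continuous (fun x => complex.Im (f x))}) ->
  cmeasurable D f.
Proof.
move=> oD fr fi; split; apply: open_continuous_measurable_fun => // x; rewrite inE => Dx.
  exact: fr.
exact: fi.
Qed.

Lemma open_cderive_cmeasurable D f : open D ->
  (forall x, D x -> exists d, is_cderive f x d) -> cmeasurable D f.
Proof.
move=> oD fd; apply: open_continuous_cmeasurable => // x Dx;
  have [d [dr di]] := fd x Dx; [exact: is_derive_continuous dr|exact: is_derive_continuous di].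
Qed.

Lemma cintegrable_le D f (g : R -> R) : measurable D -> cmeasurable D f ->
  (forall x, D x -> cmod (f x) <= g x) -> mu.-integrable D (EFin \o g) ->
  cintegrable D f.
Proof.
move=> mD [fr fi] fg ig; split.
  apply: (@le_integrable _ _ _ mu D mD _ _ _ _ ig); first exact/measurable_EFinP.
  move=> x Dx /=; rewrite lee_fin (le_trans (le_Re_cmod _))// (le_trans (fg _ Dx))// ler_norm //.
apply: (@le_integrable _ _ _ mu D mD _ _ _ _ ig); first exact/measurable_EFinP.
by move=> x Dx /=; rewrite lee_fin (le_trans (le_Im_cmod _))// (le_trans (fg _ Dx))// ler_norm.
Qed.

Lemma cintegrable_cmeasurable D f : cintegrable D f -> cmeasurable D f.
Proof.
by move=> [/measurable_int/measurable_EFinP fr /measurable_int/measurable_EFinP fi].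
Qed.

Lemma cintegrableD D f g : measurable D -> cintegrable D f -> cintegrable D g ->
  cintegrable D (fun x => f x + g x).
Proof.
move=> mD [fr fi] [gr gi]; split.
  rewrite (_ : _ \o _ = ((EFin \o (fun x => complex.Re (f x))) \+ (EFin \o (fun x => complex.Re (g x))))%E).
    exact: integrableD.
  by apply/funext => x /=; rewrite cReD EFinD.
rewrite (_ : _ \o _ = ((EFin \o (fun x => complex.Im (f x))) \+ (EFin \o (fun x => complex.Im (g x))))%E).
  exact: integrableD.
by apply/funext => x /=; rewrite cImD EFinD.
Qed.

Lemma integrableZl_fin D (c : R) (f : R -> R) : measurable D -> mu.-integrable D (EFin \o f) ->
  mu.-integrable D (EFin \o (fun x => c * f x)).
Proof.
move=> mD fi; rewrite (_ : _ \o _ = (fun x => c%:E * (EFin \o f) x)%E); last exact/funext.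
exact: integrableZl.
Qed.

Lemma integrableD_fin D (f g : R -> R) : measurable D -> mu.-integrable D (EFin \o f) ->
  mu.-integrable D (EFin \o g) -> mu.-integrable D (EFin \o (fun x => f x + g x)).
Proof.
move=> mD fi gi; rewrite (_ : _ \o _ = ((EFin \o f) \+ (EFin \o g))%E); last exact/funext.
exact: integrableD.
Qed.

Lemma integrableB_fin D (f g : R -> R) : measurable D -> mu.-integrable D (EFin \o f) ->
  mu.-integrable D (EFin \o g) -> mu.-integrable D (EFin \o (fun x => f x - g x)).
Proof.
move=> mD fi gi; rewrite (_ : _ \o _ = ((EFin \o f) \- (EFin \o g))%E); last exact/funext.
exact: integrableB.
Qed.

Lemma cintegrableZ D (c : C) f : measurable D -> cintegrable D f ->
  cintegrable D (fun x => c * f x).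
Proof.
move=> mD [fr fi]; split.
  rewrite (_ : (fun x => _) = (fun x => complex.Re c * complex.Re (f x) - complex.Im c * complex.Im (f x))).
    by apply: integrableB_fin => //; exact: integrableZl_fin.
  by apply/funext => x; rewrite cReM.
rewrite (_ : (fun x => _) = (fun x => complex.Re c * complex.Im (f x) + complex.Im c * complex.Re (f x))).
  by apply: integrableD_fin => //; exact: integrableZl_fin.
by apply/funext => x; rewrite cImM.
Qed.

Lemma cintegrableB D f g : measurable D -> cintegrable D f -> cintegrable D g ->
  cintegrable D (fun x => f x - g x).
Proof.
move=> mD fi /(cintegrableZ (-1) mD) gi.
have := cintegrableD mD fi gi.
by under [X in cintegrable D X -> _]eq_fun do rewrite mulN1r.
Qed.

Lemma cintegrableS D E f : measurable D -> measurable E -> E `<=` D ->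
  cintegrable D f -> cintegrable E f.
Proof. by move=> mD mE ED [fr fi]; split; [exact: integrableS fr|exact: integrableS fi]. Qed.

Lemma eq_cintegral D f g : (forall x, D x -> f x = g x) -> cintegral D f = cintegral D g.
Proof.
by move=> fg; congr (_ +i* _); apply: eq_Rintegral => x; rewrite inE => /fg ->.
Qed.

Lemma eq_cintegrable D f g : measurable D -> (forall x, D x -> f x = g x) ->
  cintegrable D f -> cintegrable D g.
Proof.
move=> mD fg [fr fi]; split.
  by apply: eq_integrable fr => // x; rewrite inE => /fg /= ->.
by apply: eq_integrable fi => // x; rewrite inE => /fg /= ->.
Qed.

Lemma cintegralD D f g : measurable D -> cintegrable D f -> cintegrable D g ->
  cintegral D (fun x => f x + g x) = cintegral D f + cintegral D g.
Proof.
move=> mD [fr fi] [gr gi]; apply: complex_ext; rewrite ?cReD ?cImD /=.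
  by rewrite -RintegralD//; apply: eq_Rintegral => x _; rewrite cReD.
by rewrite -RintegralD//; apply: eq_Rintegral => x _; rewrite cImD.
Qed.

Lemma cintegralZ D (c : C) f : measurable D -> cintegrable D f ->
  cintegral D (fun x => c * f x) = c * cintegral D f.
Proof.
move=> mD [fr fi]; apply: complex_ext; rewrite ?cReM ?cImM /=.
  rewrite -!RintegralZl// -RintegralB//; try exact: integrableZl_fin.
  by apply: eq_Rintegral => x _; rewrite cReM.
rewrite -!RintegralZl// -RintegralD//; try exact: integrableZl_fin.
by apply: eq_Rintegral => x _; rewrite cImM.
Qed.

Lemma cintegralB D f g : measurable D -> cintegrable D f -> cintegrable D g ->
  cintegral D (fun x => f x - g x) = cintegral D f - cintegral D g.
Proof.
move=> mD fi gi; have gi' := cintegrableZ (-1) mD gi.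
rewrite -mulN1r -cintegralZ// -cintegralD//.
by apply: eq_cintegral => x _; rewrite mulN1r.
Qed.

Lemma cintegral0 D : cintegral D (fun=> 0) = 0.
Proof.
by apply: complex_ext; rewrite /cintegral /= /Rintegral; rewrite integral0.
Qed.

Lemma cintegrable0 D : measurable D -> cintegrable D (fun=> 0).
Proof. by move=> mD; split; exact: integrable0. Qed.

Lemma cintegrable_sum D n (F : 'I_n -> R -> C) : measurable D ->
  (forall i, cintegrable D (F i)) -> cintegrable D (fun x => \sum_(i < n) F i x).
Proof.
move=> mD; elim: n F => [|n IH] F Fi.
  by under eq_fun do rewrite big_ord0; exact: cintegrable0.
by under eq_fun do rewrite big_ord_recr; apply: cintegrableD => //; exact: IH.
Qed.

Lemma cintegral_sum D n (F : 'I_n -> R -> C) : measurable D ->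
  (forall i, cintegrable D (F i)) ->
  cintegral D (fun x => \sum_(i < n) F i x) = \sum_(i < n) cintegral D (F i).
Proof.
move=> mD; elim: n F => [|n IH] F Fi.
  by under eq_fun do rewrite big_ord0; rewrite big_ord0 cintegral0.
rewrite big_ord_recr /= -IH// -cintegralD//.
  by apply: eq_cintegral => x _; rewrite big_ord_recr.
exact: cintegrable_sum.
Qed.

Lemma cintegral_bound D f (g : R -> R) : measurable D -> cmeasurable D f ->
  (forall x, D x -> cmod (f x) <= g x) -> mu.-integrable D (EFin \o g) ->
  cmod (cintegral D f) <= 2 * Rintegral mu D g.
Proof.
move=> mD fm fg gi; have [fr fi] := cintegrable_le mD fm fg gi.
apply: le_trans (cmod_le_ReIm _) _; rewrite mulr_natl mulr2n; apply: lerD.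
  apply: le_trans (@le_normr_Rintegral _ _ _ mu D _ mD fr) _; apply: le_Rintegral => //.
    exact: integrable_norm.
  by move=> x Dx; exact: le_trans (le_Re_cmod _) (fg _ Dx).
apply: le_trans (@le_normr_Rintegral _ _ _ mu D _ mD fi) _; apply: le_Rintegral => //.
  exact: integrable_norm.
by move=> x Dx; exact: le_trans (le_Im_cmod _) (fg _ Dx).
Qed.

Lemma cintegral_DCT D (f_ : nat -> R -> C) f (g : R -> R) : measurable D ->
  (forall n, cmeasurable D (f_ n)) ->
  (forall n x, D x -> cmod (f_ n x) <= g x) -> mu.-integrable D (EFin \o g) ->
  (forall x, D x -> (fun n => f_ n x) @ \oo --> (f x : C^o)) ->
  cintegrable D f /\ (fun n => cintegral D (f_ n)) @ \oo --> (cintegral D f : C^o).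
Proof.
move=> mD fm fg gi fc.
have key (p_ : nat -> R -> R) (p : R -> R) :
    (forall n, measurable_fun D (p_ n)) -> (forall n x, D x -> `|p_ n x| <= g x) ->
    (forall x, D x -> (fun n => p_ n x) @ \oo --> p x) ->
    mu.-integrable D (EFin \o p) /\
    (fun n => Rintegral mu D (p_ n)) @ \oo --> Rintegral mu D p.
  move=> pm pg pc.
  have pm' n : measurable_fun D (EFin \o p_ n) by apply/measurable_EFinP.
  have pc' x : D x -> ((EFin \o p_ n) x @[n --> \oo] --> (EFin \o p) x)%classic.
    by move=> Dx; apply: cvg_EFin; [exact: nearW|exact: pc].
  have mp : measurable_fun D (EFin \o p).
    by apply: emeasurable_fun_cvg pc'.
  have [] := @dominated_convergence _ _ _ mu D mD (fun n => EFin \o p_ n) (EFin \o p)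
    (EFin \o g) pm' mp (aeW mu pc') gi.
    by apply: aeW => x n Dx /=; rewrite lee_fin pg.
  move=> ip _ cp; split => //; apply: fine_cvg.
  rewrite fineK; last exact: integrable_fin_num.
  exact: cp.
have [ir cr] := key (fun n x => complex.Re (f_ n x)) (fun x => complex.Re (f x))
  (fun n => (fm n).1) (fun n x Dx => le_trans (le_Re_cmod _) (fg n x Dx))
  (fun x Dx => ((cvgC_ReIm _ _).1 (fc x Dx)).1).
have [ii ci] := key (fun n x => complex.Im (f_ n x)) (fun x => complex.Im (f x))
  (fun n => (fm n).2) (fun n x Dx => le_trans (le_Im_cmod _) (fg n x Dx))
  (fun x Dx => ((cvgC_ReIm _ _).1 (fc x Dx)).2).
by split; [split|apply/cvgC_ReIm].
Qed.

(** * Primitives, translations and integrability on the half-line *)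

Lemma Rintegral_FTC (f F : R -> R) (a b : R) : a <= b ->
  (forall x, a <= x <= b -> is_derive x 1 F (f x)) ->
  (forall x, a <= x <= b -> {for x, continuous f}) ->
  mu.-integrable `[a, b] (EFin \o f) /\ Rintegral mu `[a, b] f = F b - F a.
Proof.
move=> ab dF cf.
have cw : {within `[a, b], continuous f}.
  by apply: continuous_in_subspaceT => x; rewrite inE /= in_itv /=; exact: cf.
split; first by apply: continuous_compact_integrable => //; exact: segment_compact.
move: ab; rewrite le_eqVlt => /predU1P[->|ab].
  by rewrite set_itv1 Rintegral_set1 subrr.
rewrite /Rintegral (@continuous_FTC2 _ f F a b)//.
  have cF x : a <= x <= b -> F @ x --> F x by move=> /dF /is_derive_continuous.
  split.
  - move=> x; rewrite in_itv /= => /andP[ax xb].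
    by have [] : is_derive x 1 F (f x) by apply: dF; lra.
  - by apply: cvg_at_right_filter; apply: cF; lra.
  - by apply: cvg_at_left_filter; apply: cF; lra.
move=> x; rewrite in_itv /= => /andP[ax xb].
have h : is_derive x 1 F (f x) by apply: dF; lra.
by rewrite derive1E derive_val.
Qed.

(** The derivative g of the integrand is there to supply its continuity. *)
Lemma cintegral_FTC f g F (a b : R) : a <= b ->
  (forall x, a <= x <= b -> is_cderive F x (f x)) ->
  (forall x, a <= x <= b -> is_cderive f x (g x)) ->
  cintegrable `[a, b] f /\ cintegral `[a, b] f = F b - F a.
Proof.
move=> ab dF df.
have [ir er] := @Rintegral_FTC (fun x => complex.Re (f x)) (fun x => complex.Re (F x)) a b ab
  (fun x h => (dF x h).1) (fun x h => is_derive_continuous (df x h).1).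
have [ii ei] := @Rintegral_FTC (fun x => complex.Im (f x)) (fun x => complex.Im (F x)) a b ab
  (fun x h => (dF x h).2) (fun x h => is_derive_continuous (df x h).2).
by split=> //; apply: complex_ext; rewrite ?cReD ?cImD ?cReN ?cImN /= ?er ?ei.
Qed.

Lemma cintegrable_cderive f g (a b : R) :
  (forall x, a <= x <= b -> is_cderive f x (g x)) -> cintegrable `[a, b] f.
Proof.
move=> df; split; apply: continuous_compact_integrable; try exact: segment_compact;
  apply: continuous_in_subspaceT => x; rewrite inE /= in_itv /= => /df [dr di].
  exact: is_derive_continuous dr.
exact: is_derive_continuous di.
Qed.

Lemma Rintegral_translation (f : R -> R) (c : R) :
  {within `[c, c + 1], continuous f} ->
  Rintegral mu `[c, c + 1] f = Rintegral mu `[0, 1] (fun x => f (x + c)).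
Proof.
move=> cf; rewrite /Rintegral; congr fine.
pose S (x : R) : R := x + c.
have dS x : is_derive x 1 S 1 by exact: (is_derive_shift x 1 c).
have dS1 : derive1 S = cst 1.
  by apply/funext => x; rewrite derive1E derive_val.
have cS x : S @ x --> S x by exact: is_derive_continuous (dS x).
rewrite (_ : `[c, c + 1] = `[S 0, S 1])%classic; last by rewrite /S add0r addrC.
rewrite (@integration_by_substitution_increasing _ S f 0 1)//.
- by apply: eq_integral => x _; rewrite dS1 /= /S mulr1.
- by move=> x y _ _; rewrite ltrD2r.
- by rewrite dS1 => x _; exact: cvg_cst.
- by rewrite dS1; exact: is_cvg_cst.
- by rewrite dS1; exact: is_cvg_cst.
- split; first by move=> x _; have [] := dS x.
    exact: cvg_at_right_filter.
  exact: cvg_at_left_filter.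
- by rewrite /S add0r addrC.
Qed.

Lemma cintegral_translation f g (c : R) :
  (forall x, c <= x <= c + 1 -> is_cderive f x (g x)) ->
  cintegral `[c, c + 1] f = cintegral `[0, 1] (fun x => f (x + c)).
Proof.
move=> df; congr (_ +i* _); apply: Rintegral_translation;
  apply: continuous_in_subspaceT => x; rewrite inE /= in_itv /= => /df [dr di].
  exact: is_derive_continuous dr.
exact: is_derive_continuous di.
Qed.

Lemma cintegral_bndoo f (a b : R) (b0 b1 : bool) : cmeasurable `]a, b[ f ->
  cintegral [set` Interval (BSide b0 a) (BSide b1 b)] f = cintegral `]a, b[ f.
Proof.
move=> [fr fi]; congr (_ +i* _); rewrite /Rintegral integral_itv_bndoo//; exact/measurable_EFinP.
Qed.

(** Monotone convergence along the segments [1/(n+1), n+1]; on each the integral is a difference of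
    two values of F, so at most 2 B. *)
Lemma integrable_bounded_primitive (f F : R -> R) (B : R) :
  (forall x, 0 < x -> 0 <= f x) ->
  (forall x, 0 < x -> is_derive x 1 F (f x)) ->
  (forall x, 0 < x -> {for x, continuous f}) ->
  (forall x, 0 < x -> `|F x| <= B) ->
  mu.-integrable (`]0, +oo[%classic : set R) (EFin \o f).
Proof.
move=> f0 dF cf FB.
have mf : measurable_fun (`]0, +oo[%classic : set R) f.
  apply: open_continuous_measurable_fun => // x; rewrite inE /= in_itv /= andbT; exact: cf.
apply/integrableP; split; first exact/measurable_EFinP.
under eq_integral => x; first rewrite inE /= in_itv /= andbT => x0.
  rewrite ger0_norm ?f0//; over.
pose S (n : nat) := `[n.+1%:R^-1 : R, n.+1%:R]%classic.
have SE : \bigcup_n S n = `]0, +oo[%classic.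
  apply/seteqP; split => x /=.
    by move=> [n _]; rewrite /S /= !in_itv /= andbT => /andP[h _]; apply: lt_le_trans h;
      rewrite invr_gt0.
  rewrite in_itv /= andbT => x0.
  exists (Num.bound x + Num.bound x^-1)%N => //; rewrite /S /= in_itv /=.
  have h1 := archi_boundP (ltW x0).
  have h2 : x^-1 < (Num.bound x^-1)%:R by apply: archi_boundP; rewrite invr_ge0 ltW.
  apply/andP; split; last first.
    by apply: ltW; apply: lt_le_trans h1 _; rewrite ler_nat -addnS leq_addr.
  rewrite -[leRHS]invrK lef_pV2 ?posrE ?invr_gt0//; apply: ltW; apply: lt_le_trans h2 _.
  by rewrite ler_nat leqW// leq_addl.
have Spos n x : S n x -> 0 < x.
  by rewrite /S /= in_itv /= => /andP[h _]; apply: lt_le_trans h; rewrite invr_gt0.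
rewrite -SE.
have Snd : nondecreasing_seq S.
  move=> m n mn; rewrite subsetEset => x; rewrite /S /= !in_itv /= => /andP[h1 h2].
  apply/andP; split; last by apply: le_trans h2 _; rewrite ler_nat.
  by apply: le_trans h1; rewrite lef_pV2 ?posrE// ler_nat.
have := @ge0_nondecreasing_set_cvg_integral _ (measurableTypeR R) R S (EFin \o f) mu Snd.
move=> /(_ _ _ _)/cvg_lim => H.
rewrite -H//; last 3 first.
- by move=> n; exact: measurable_itv.
- move=> n; apply/measurable_EFinP; apply: measurable_funS mf => //.
  by move=> x /Spos; rewrite /= in_itv /= andbT.
- by move=> n x /Spos x0; rewrite /= lee_fin f0.
have h n : (\int[mu]_(x in S n) (EFin \o f) x <= (2 * B)%:E)%E.
  have n1 : n.+1%:R^-1 <= n.+1%:R :> R.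
    by rewrite (@le_trans _ _ 1)// ?invf_le1 ?ler1n.
  have pos x : n.+1%:R^-1 <= x <= n.+1%:R -> 0 < x.
    by move=> /andP[h _]; apply: lt_le_trans h; rewrite invr_gt0.
  have [ii] := @Rintegral_FTC f F _ _ n1 (fun x h => dF x (pos x h)) (fun x h => cf x (pos x h)).
  rewrite /Rintegral => e; rewrite -[leLHS]fineK; last first.
    by apply: integrable_fin_num ii; exact: measurable_itv.
  rewrite lee_fin -/(S n) in e *; rewrite e.
  have p1 : 0 < (n.+1%:R : R) by [].
  have p2 : 0 < (n.+1%:R^-1 : R) by rewrite invr_gt0.
  have := FB _ p1; have := FB _ p2.
  rewrite !ler_norml => /andP[a1 a2] /andP[b1 b2]; lra.
apply: le_lt_trans (ltry (2 * B)); apply: lime_le.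
  apply/cvg_ex; eexists; apply: ge0_nondecreasing_set_cvg_integral => //.
  - by move=> n; exact: measurable_itv.
  - move=> n; apply/measurable_EFinP; apply: measurable_funS mf => //.
    by move=> x /Spos; rewrite /= in_itv /= andbT.
  - by move=> n x /Spos x0; rewrite /= lee_fin f0.
exact: nearW.
Qed.

End ComplexIntegration.

(** * Euler's integral along a rotated ray *)

Section GammaRotation.
Variable R : realType.
Notation C := R[i].
Notation mu := (@lebesgue_measure R).
Notation Rpos := (`]0, +oo[%classic : set R).
Implicit Types (z w s : C) (x y : R) (f g : R -> C).

Lemma RposP x : Rpos x <-> 0 < x.
Proof. by rewrite /= in_itv /= andbT. Qed.

Lemma measurable_Rpos : measurable Rpos. Proof. exact: measurable_itv. Qed.
Lemma open_Rpos : open Rpos. Proof. exact: interval_open. Qed.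

(** This is ln u < u at u = c x / a. It lets e^(-cx) absorb the power x^a with an explicit
    constant. *)
Lemma ln_le_linear (a c x : R) : 0 < a -> 0 < c -> 0 < x -> a * ln x <= c * x + a * ln (a / c).
Proof.
move=> a0 c0 x0; have u0 : 0 < c * x / a by rewrite divr_gt0// mulr_gt0.
have := ltW (ln_sublinear u0).
have -> : ln x = ln (c * x / a) + ln (a / c).
  rewrite -lnM ?posrE ?u0 ?divr_gt0//; congr ln.
  by field; rewrite !gt_eqF.
move=> h; rewrite mulrDr lerD2r.
move: h; rewrite -(ler_pM2l a0) => /le_trans; apply.
by rewrite mulrC divfK ?gt_eqF.
Qed.

Lemma is_derive_expR_comp (F : R -> R) x d : is_derive x 1 F d ->
  is_derive x 1 (fun x => expR (F x)) (d * expR (F x)).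
Proof. by move=> h; rewrite mulrC; exact: (@is_derive1_comp _ expR). Qed.

(** One majorant handles both ends: a x^(a-1) / (1 + x^a)^2 has the bounded primitive - 1 / (1 +
    x^a). *)
Lemma integrable_gamma_kernel (a c : R) : 0 < a -> 0 < c ->
  mu.-integrable Rpos (EFin \o (fun x => expR (- c * x + (a - 1) * ln x))).
Proof.
move=> a0 c0.
pose y x := expR (a * ln x).
pose F x := - (1 + y x)^-1.
pose f x := a * expR ((a - 1) * ln x) / (1 + y x) ^+ 2.
have y0 x : 0 < y x by exact: expR_gt0.
have dl x : 0 < x -> is_derive x 1 (fun x => a * ln x) (a * x^-1).
  by move=> x0; exact: (is_deriveZ a (is_derive1_ln x0)).
have dy x : 0 < x -> is_derive x 1 y (a * x^-1 * y x).
  by move=> /dl/is_derive_expR_comp.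
have dF x : 0 < x -> is_derive x 1 F (f x).
  move=> x0; have d1 := is_deriveD (is_derive_cst (1 : R) x 1) (dy x x0).
  have n0 : 1 + y x != 0 by rewrite gt_eqF// addr_gt0.
  have := is_deriveN (@is_deriveV R (fun x => 1 + y x) x _ 1 n0 d1).
  move=> h; apply: is_derive_eq2 h _ _ => [t|] //.
  rewrite /f /GRing.scale /= mulrBl mul1r expRB lnK ?posrE// -/(y x).
  by field; rewrite n0 gt_eqF.
have cf x : 0 < x -> {for x, continuous f}.
  move=> x0; have n0 : (1 + y x) ^+ 2 != 0 by rewrite gt_eqF// exprn_gt0// addr_gt0.
  have dl' : is_derive x 1 (fun x => (a - 1) * ln x) ((a - 1) * x^-1).
    exact: (is_deriveZ (a - 1) (is_derive1_ln x0)).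
  have d2 := is_deriveX 2 (is_deriveD (is_derive_cst (1 : R) x 1) (dy x x0)).
  have d3 := @is_deriveV R (fun x => (1 + y x) ^+ 2) x _ 1 n0 d2.
  have d4 := is_deriveZ a (is_derive_expR_comp dl').
  exact: is_derive_continuous (is_deriveM d4 d3).
have iF : mu.-integrable Rpos (EFin \o f).
  apply: (@integrable_bounded_primitive _ f F 1) => // x x0.
    by rewrite /f !mulr_ge0 ?expR_ge0 ?invr_ge0 ?exprn_ge0 ?addr_ge0 ?ltW.
  rewrite normrN gtr0_norm ?invr_gt0 ?addr_gt0// invf_le1 ?addr_gt0// lerDl ltW //.
(* From (1 + y)^2 <= 2 + 2 y^2 and e^(-cx) x^(2a) <= (2a/c)^(2a); the division by a cancels the
   factor a of the majorant. *)
pose K := (2 + 2 * expR (2 * a * ln (2 * a / c))) / a.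
apply: (@le_integrable _ _ _ mu Rpos measurable_Rpos _ (EFin \o (fun x => K * f x))).
- apply/measurable_EFinP; apply: open_continuous_measurable_fun; first exact: open_Rpos.
  move=> x; rewrite inE => /RposP x0.
  have dl' := is_deriveD (is_deriveZ (- c) (is_derive_id x (1 : R))) (is_deriveZ (a - 1) (is_derive1_ln x0)).
  exact: is_derive_continuous (is_derive_expR_comp dl').
- move=> x /RposP x0 /=; rewrite lee_fin ger0_norm ?expR_ge0//.
  apply: le_trans (ler_norm _).
  rewrite /K /f expRD.
  have -> : (2 + 2 * expR (2 * a * ln (2 * a / c))) / a *
    (a * expR ((a - 1) * ln x) / (1 + y x) ^+ 2) =
    ((2 + 2 * expR (2 * a * ln (2 * a / c))) / (1 + y x) ^+ 2) * expR ((a - 1) * ln x).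
    by field; rewrite !gt_eqF ?addr_gt0.
  rewrite ler_wpM2r ?expR_ge0// ler_pdivlMr ?exprn_gt0 ?addr_gt0//.
  have h1 : (1 + y x) ^+ 2 <= 2 + 2 * y x ^+ 2 by have := sqr_ge0 (1 - y x); nra.
  apply: le_trans (ler_wpM2l (expR_ge0 _) h1) _.
  rewrite mulrDr; apply: lerD.
    by rewrite ler_piMl// expR_le1 mulNr oppr_le0 mulr_ge0// ltW.
  rewrite mulrCA ler_pM2l// /y -expRM_natl -expRD ler_expR.
  have a20 : 0 < 2 * a by rewrite mulr_gt0.
  by have := ln_le_linear a20 c0 x0; rewrite -mulrA; lra.
- by apply: integrableZl_fin iF; exact: measurable_Rpos.
Qed.

Lemma cintegral_exhaust_sets f (S : nat -> set R) : cintegrable Rpos f ->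
  (forall n, S n `<=` Rpos) -> (forall n, measurable (S n)) ->
  (forall x, 0 < x -> \forall n \near \oo, S n x) ->
  (fun n => cintegral (S n) f) @ \oo --> (cintegral Rpos f : C^o).
Proof.
move=> fi SR mS Sx.
have real_case (h : R -> R) : mu.-integrable Rpos (EFin \o h) ->
    (fun n => Rintegral mu (S n) h) @ \oo --> Rintegral mu Rpos h.
  move=> ih.
  have mh : measurable_fun Rpos h by apply/measurable_EFinP; exact: measurable_int ih.
  have cf : cintegrable Rpos (fun x => (h x)%:C).
    by split=> //=; exact: (@integrable0 _ _ _ mu).
  pose f_ n (x : R) : C := ((h \_ (S n)) x)%:C.
  have mf_ n : cmeasurable Rpos (f_ n).
    split; last exact: measurable_cst.
    apply/(measurable_restrict h (mS n) measurable_Rpos).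
    by apply: measurable_funS mh.
  have [] := @cintegral_DCT _ Rpos f_ (fun x => (h x)%:C) (fun x => `|h x|) measurable_Rpos mf_ _ _ _.
  - move=> n x _; by rewrite cmod_real /f_ patchE; case: ifP => // _; rewrite normr0.
  - exact: (@integrable_norm _ _ _ mu).
  - move=> x /RposP x0; apply/cvgCP.
    apply: cvg_near_cst.
    near=> n; rewrite /f_ patchE ifT ?subrr ?cmod0// inE.
    by near: n; exact: Sx.
  move=> _ /cvgC_ReIm[+ _] /=.
  rewrite (_ : (fun n => _) = (fun n => Rintegral mu (S n) h))//.
  apply/funext => n.
  have -> : S n = Rpos `&` S n by rewrite setIC; apply/esym/setIidPl; exact: SR.
  by rewrite Rintegral_mkcondr.
have [fr fi'] := fi; apply/cvgC_ReIm; split; exact: real_case.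
Unshelve. all: by end_near. Qed.

Lemma cintegral_exhaust f : cintegrable Rpos f ->
  (fun n => cintegral `[n.+1%:R^-1, n.+1%:R] f) @ \oo --> (cintegral Rpos f : C^o).
Proof.
move=> fi; apply: (@cintegral_exhaust_sets f (fun n => `[n.+1%:R^-1, n.+1%:R]%classic)) => //.
  move=> n x; rewrite /= !in_itv /= andbT => /andP[h _].
  by apply: lt_le_trans h; rewrite invr_gt0.
move=> x x0; near=> n; rewrite /= in_itv /=; apply/andP; split; last first.
  apply: ltW; apply: (@lt_trans _ _ n%:R); last by rewrite ltr_nat.
  by near: n; exact: nbhs_infty_gtr.
rewrite -[leRHS]invrK lef_pV2 ?posrE ?invr_gt0//; apply: ltW.
apply: (@lt_trans _ _ n%:R); last by rewrite ltr_nat.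
by near: n; exact: nbhs_infty_gtr.
Unshelve. all: by end_near. Qed.

Lemma cintegral_exact0 f g F : cintegrable Rpos f ->
  (forall x, 0 < x -> is_cderive F x (f x)) ->
  (forall x, 0 < x -> is_cderive f x (g x)) ->
  (fun n => F n.+1%:R) @ \oo --> ((0 : C) : C^o) ->
  (fun n => F n.+1%:R^-1) @ \oo --> ((0 : C) : C^o) ->
  cintegral Rpos f = 0.
Proof.
move=> fi dF df Foo F0; apply: cvgC_unique (cintegral_exhaust fi) _.
have := cvgCB Foo F0; rewrite subr0.
rewrite (_ : (fun n => _) = (fun n => cintegral `[n.+1%:R^-1, n.+1%:R] f))//.
apply/funext => n.
have n1 : n.+1%:R^-1 <= n.+1%:R :> R by rewrite (@le_trans _ _ 1)// ?invf_le1 ?ler1n.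
have pos x : n.+1%:R^-1 <= x <= n.+1%:R -> 0 < x.
  by move=> /andP[h _]; apply: lt_le_trans h; rewrite invr_gt0.
by have [_ ->] := cintegral_FTC n1 (fun x h => dF x (pos x h)) (fun x h => df x (pos x h)).
Qed.

(** * The Laplace transform of x^(-s) *)

Definition lker w s x : C := cexp (- w * x%:C) * npow s x.

Lemma cmod_lker w s x : cmod (lker w s x) = expR (- complex.Re w * x + - complex.Re s * ln x).
Proof.
by rewrite /lker cmodM cmod_cexp cmod_npow -expRD cReM cReN /= mulr0 subr0.
Qed.

Lemma is_cderive_lker w s x : 0 < x ->
  is_cderive (lker w s) x (- w * lker w s x - s * lker w (s + 1) x).
Proof.
move=> x0; have d1 := is_cderive_cexp (is_cderiveZ (- w) (is_cderive_real (is_derive_id x (1 : R)))).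
apply: is_cderive_eq (is_cderiveM d1 (is_cderive_npow s x0)) _ _ => //.
by rewrite /lker [1%:C]/(1 : C); ring.
Qed.

Lemma lker_mulx w s x : 0 < x -> lker w (s - 1) x = x%:C * lker w s x.
Proof.
move=> x0; have := npow_div (s - 1) x0; rewrite subrK /lker => ->.
rewrite fmorphV /=; have X0 : x%:C != 0 by rewrite -cmod_eq0 cmod_real normr_eq0 gt_eqF.
by field.
Qed.

Lemma lker_integrable w s : 0 < complex.Re w -> complex.Re s < 1 ->
  cintegrable Rpos (lker w s).
Proof.
move=> w0 s1; apply: (@cintegrable_le _ _ _ (fun x => expR (- complex.Re w * x + ((1 - complex.Re s) - 1) * ln x))).
- exact: measurable_Rpos.
- apply: open_cderive_cmeasurable; first exact: open_Rpos.
  by move=> x /RposP x0; eexists; exact: is_cderive_lker.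
- move=> x _; rewrite cmod_lker (_ : 1 - complex.Re s - 1 = - complex.Re s)//; ring.
- by apply: integrable_gamma_kernel => //; lra.
Qed.

Lemma cvg_lker_oo w s : 0 < complex.Re w -> complex.Re s < 0 ->
  (fun n => lker w s n.+1%:R) @ \oo --> ((0 : C) : C^o).
Proof.
(* Half of the exponential rate absorbs the power; the other half leaves a geometric sequence. *)
move=> w0 s0; pose c := complex.Re w / 2; have c0 : 0 < c by rewrite divr_gt0.
pose a := - complex.Re s; have a0 : 0 < a by rewrite oppr_gt0.
pose K := expR (a * ln (a / c)).
apply: (@cvgC_squeeze _ _ _ (fun n => K * expR (- c) ^+ n)) => [n|]; last first.
  rewrite -[X in _ --> X](mulr0 K); apply: cvgMl_tmp; apply: cvg_expr.
  by rewrite ger0_norm ?expR_ge0// expR_lt1 oppr_lt0.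
have n0 : 0 < (n.+1%:R : R) by [].
rewrite subr0 cmod_lker -/a -expRM_natl -expRD ler_expR.
have h := ln_le_linear a0 c0 n0.
have : c * n%:R <= c * n.+1%:R by rewrite ler_pM2l// ler_nat.
have -> : - complex.Re w * n.+1%:R = - 2 * (c * n.+1%:R) by rewrite /c; field.
lra.
Qed.

Lemma cvg_lker_0 w s : 0 < complex.Re w -> complex.Re s < 0 ->
  (fun n => lker w s n.+1%:R^-1) @ \oo --> ((0 : C) : C^o).
Proof.
move=> w0 s0; have s0' : 0 < complex.Re (- s) by rewrite cReN oppr_gt0.
have /cvgCP := cvg_npow0 s0' (lexx 1).
under eq_fun do rewrite subr0; apply: cvgC_squeeze => n.
rewrite subr0 cmod_lker cmod_npow cReN opprK ler_expR lnV ?posrE// nat1r.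
by rewrite mulrNN gerDr mulNr oppr_le0 mulr_ge0 ?invr_ge0// ltW.
Qed.

Definition laplace w s : C := cintegral Rpos (lker w s).

(** Integration by parts: the difference of the two sides is, up to sign, the integral of the
    derivative of e^(-wx) x^(1-s), which tends to 0 at both ends because Re (1 - s) > 0. *)
Lemma laplace_parts w s : 0 < complex.Re w -> complex.Re s < 1 ->
  w * laplace w (s - 1) = (1 - s) * laplace w s.
Proof.
move=> w0 s1; have s10 : complex.Re (s - 1) < 0 by rewrite cReD cReN /=; lra.
have s11 : complex.Re (s - 1) < 1 by lra.
have mR := measurable_Rpos.
have i1 := lker_integrable w0 s1; have i2 := lker_integrable w0 s11.
pose f x := (1 - s) * lker w s x - w * lker w (s - 1) x.
have fi : cintegrable Rpos f by apply: cintegrableB => //; exact: cintegrableZ.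
have : cintegral Rpos f = 0.
  apply: (@cintegral_exact0 f
    (fun x => (1 - s) * (- w * lker w s x - s * lker w (s + 1) x) -
              w * (- w * lker w (s - 1) x - (s - 1) * lker w (s - 1 + 1) x))
    (lker w (s - 1)) fi).
  - move=> x x0; apply: is_cderive_eq (is_cderive_lker w (s - 1) x0) _ _ => //.
    by rewrite subrK /f; ring.
  - by move=> x x0; apply: is_cderiveB; apply: is_cderiveZ; exact: is_cderive_lker.
  - exact: cvg_lker_oo.
  - exact: cvg_lker_0.
rewrite cintegralB ?cintegralZ//; try exact: cintegrableZ.
by move=> /eqP; rewrite subr_eq0 => /eqP ->.
Qed.

Lemma cintegral_derive_param (f df : R -> R -> C) (u v t0 : R) (G : R -> R) :
  u < t0 < v ->
  (forall t, u < t < v -> cintegrable Rpos (f t)) ->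
  (forall t x, u < t < v -> 0 < x -> is_cderive (f ^~ x) t (df t x)) ->
  (forall x, 0 <= G x) -> mu.-integrable Rpos (EFin \o G) ->
  (forall t x, u < t < v -> 0 < x -> cmod (df t x) <= G x) ->
  is_cderive (fun t => cintegral Rpos (f t)) t0 (cintegral Rpos (df t0)).
Proof.
move=> t0uv fi fd G0 Gi dG.
have key (h dh : R -> R -> R) :
    (forall t, u < t < v -> mu.-integrable Rpos (EFin \o h t)) ->
    (forall t x, u < t < v -> 0 < x -> is_derive t 1 (h ^~ x) (dh t x)) ->
    (forall t x, u < t < v -> 0 < x -> `|dh t x| <= G x) ->
    is_derive t0 1 (fun t => Rintegral mu Rpos (h t)) (Rintegral mu Rpos (dh t0)).
  move=> hi hd hG.
  have Ia : `]u, v[%classic t0 by rewrite /= in_itv.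
  have i1 t : `]u, v[%classic t -> mu.-integrable Rpos (EFin \o h t) by rewrite /= in_itv;
    exact: hi.
  have p1 t x : `]u, v[%classic t -> Rpos x -> partial1of2 h t x = dh t x.
    rewrite /= in_itv /= => tuv /RposP x0; rewrite partial1of2E.
    by have [_ ->] := hd t x tuv x0.
  have d1 t x : `]u, v[%classic t -> Rpos x -> derivable (h ^~ x) t 1.
    rewrite /= in_itv /= => tuv /RposP x0.
    by have [] := hd t x tuv x0.
  have b1 t x : `]u, v[%classic t -> Rpos x -> `|partial1of2 h t x| <= G x.
    move=> tuv xR; rewrite p1//; apply: hG; last exact/RposP.
    by move: tuv; rewrite /= in_itv.
  apply: DeriveDef.
    exact: (@derivable_under_integral R _ (measurableTypeR R) mu h Rpos measurable_Rpos _ _ _ Ia i1 d1 G G0 Gi b1).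
  rewrite -derive1E (@differentiation_under_integral R _ (measurableTypeR R) mu h Rpos measurable_Rpos _ _ _ Ia i1 d1 G G0 Gi b1).
  by apply: eq_Rintegral => x; rewrite inE => xR; exact: p1.
split.
  apply: (key (fun t x => complex.Re (f t x)) (fun t x => complex.Re (df t x))).
  - by move=> t /fi[].
  - by move=> t x tuv x0; have [] := fd t x tuv x0.
  - by move=> t x tuv x0; exact: le_trans (le_Re_cmod _) (dG t x tuv x0).
apply: (key (fun t x => complex.Im (f t x)) (fun t x => complex.Im (df t x))).
- by move=> t /fi[].
- by move=> t x tuv x0; have [] := fd t x tuv x0.
- by move=> t x tuv x0; exact: le_trans (le_Im_cmod _) (dG t x tuv x0).
Qed.

Lemma Re_cexp z : complex.Re (cexp z) = expR (complex.Re z) * cos (complex.Im z).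
Proof. by rewrite /cexp cReM /= mul0r subr0. Qed.

(** [om] is a logarithm of w. Its imaginary part below pi/2 in modulus keeps the path e^(t om), from
    1 to w, in the right half-plane. *)
Lemma laplace_gamma om s : `|complex.Im om| < pi / 2 -> complex.Re s < 1 ->
  laplace (cexp om) s = cGamma (1 - s) * cexp ((s - 1) * om).
Proof.
move=> vpi s1; set v := complex.Im om in vpi; pose u := complex.Re om.
pose w (t : R) : C := cexp (t%:C * om).
have pih : pi / 2 < 2 :> R by exact: pihalf_lt2.
pose de := (pi / 2 - `|v|) / 4.
pose v' := (`|v| + pi / 2) / 2.
have v0 : 0 <= `|v| := normr_ge0 _.
have de0 : 0 < de by rewrite /de; lra.
have de1 : de < 1 by rewrite /de; lra.
pose c := expR (- 2 * `|u|) * cos v'.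
have c0 : 0 < c by rewrite mulr_gt0 ?expR_gt0// cos_gt0_pihalf// /v'; lra.
have tb t : - de < t < 1 + de -> `|t| < 2 by move=> tt; rewrite ltr_norml; lra.
have wc t : - de < t < 1 + de -> c <= complex.Re (w t).
  move=> tt; rewrite /w Re_cexp cReM cImM /= mul0r subr0 mul0r addr0 -/u -/v.
  have t2 := tb t tt.
  rewrite ler_pM ?expR_ge0//; first by rewrite cos_ge0_pihalf// /v'; lra.
    rewrite ler_expR mulNr lerNl; apply: le_trans (ler_norm _) _.
    by rewrite normrN normrM ler_wpM2r// ltW.
  rewrite -[leRHS]cos_norm normrM.
  have tv : `|t| * `|v| <= v'.
    have : `|t| <= 1 + de by rewrite ler_norml; lra.
    by move=> h; apply: le_trans (ler_wpM2r v0 h) _; rewrite /v' /de; nra.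
  have pi0 := pi_gt0 R.
  have [->//|ne] := eqVneq (`|t| * `|v|) v'.
  apply: ltW; rewrite ltr_cos ?in_itv/=; last 2 first.
  - by rewrite mulr_ge0//= (le_trans tv)// /v'; lra.
  - by rewrite /v'; lra.
  by rewrite lt_neqAle ne.
have w0 t : - de < t < 1 + de -> 0 < complex.Re (w t).
  by move=> /wc; exact: lt_le_trans.
have wM t : - de < t < 1 + de -> cmod (w t) <= expR (2 * `|u|).
  move=> /tb t2; rewrite cmod_cexp cReM /= mul0r subr0 ler_expR.
  by apply: le_trans (ler_norm _) _; rewrite normrM ler_wpM2r// ltW.
have dw t : is_cderive w t (om * w t) by exact: is_cderive_cexp (is_cderive_linear om t).
pose J t := laplace (w t) s.
pose K := cmod om * expR (2 * `|u|).
have K0 : 0 <= K by rewrite mulr_ge0 ?cmod_ge0 ?expR_ge0.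
have s11 : complex.Re (s - 1) < 1 by rewrite cReD cReN /=; lra.
have dJ t : - de < t < 1 + de -> is_cderive J t (- om * (1 - s) * J t).
  move=> tt.
  (* Differentiating in t brings down a factor x, which turns s into s - 1; [laplace_parts] then
     returns to s and closes the differential equation. *)
  have H : is_cderive J t (cintegral Rpos (fun x => - (om * w t) * lker (w t) (s - 1) x)).
    apply: (@cintegral_derive_param (fun t x => lker (w t) s x)
      (fun t x => - (om * w t) * lker (w t) (s - 1) x) (- de) (1 + de) t
      (fun x => K * expR (- c * x + ((2 - complex.Re s) - 1) * ln x)) tt).
    - by move=> t' /w0 h; exact: lker_integrable.
    - move=> t' x tt' x0.
      have d1 := is_cderive_cexp (is_cderiveM (is_cderiveN (dw t')) (is_cderive_cst x%:C t')).
      apply: is_cderive_eq (is_cderiveM d1 (is_cderive_cst (npow s x) t')) _ _ => //.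
      by rewrite lker_mulx// /lker; ring.
    - by move=> x; rewrite mulr_ge0 ?expR_ge0.
    - apply: integrableZl_fin; first exact: measurable_Rpos.
      by apply: integrable_gamma_kernel => //; lra.
    - move=> t' x tt' x0; rewrite cmodM cmodN cmodM cmod_lker.
      rewrite ler_pM ?mulr_ge0 ?cmod_ge0 ?expR_ge0//.
        by rewrite ler_wpM2l ?cmod_ge0// wM.
      rewrite ler_expR cReD cReN /= lerD//.
        by rewrite ler_wpM2r ?(ltW x0)// lerN2 wc.
      by rewrite (_ : 2 - complex.Re s - 1 = - (complex.Re s - 1))//; ring.
  have e : cintegral Rpos (fun x => - (om * w t) * lker (w t) (s - 1) x) =
      - (om * w t) * laplace (w t) (s - 1).
    by apply: cintegralZ; [exact: measurable_Rpos|exact: lker_integrable (w0 _ tt) s11].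
  have e2 : - (om * w t) * laplace (w t) (s - 1) = - om * (1 - s) * J t.
    by rewrite -[RHS]mulrA -laplace_parts ?w0//; ring.
  by rewrite -e2 -e.
(* The product of J with e^(t (1 - s) om) has zero derivative, hence equal values at 0 and 1. *)
have cst : cmod (J 1 * cexp (1%:C * ((1 - s) * om)) - J 0 * cexp (0%:C * ((1 - s) * om))) <= 2 * 0 * (1 - 0).
  apply: (@cMVT_le _ (fun t => J t * cexp (t%:C * ((1 - s) * om))) (fun=> 0) 0 1 0 ler01) => t t01.
    have tt : - de < t < 1 + de by lra.
    apply: is_cderive_eq (is_cderiveM (dJ t tt) (is_cderive_cexp (is_cderive_linear ((1 - s) * om) t))) _ _ => //.
    by ring.
  by rewrite cmod0.
have : J 1 * cexp (1%:C * ((1 - s) * om)) - J 0 * cexp (0%:C * ((1 - s) * om)) = 0.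
  apply/eqP; rewrite -cmod_eq0 eq_le cmod_ge0 andbT; apply: le_trans cst _.
  by rewrite mulr0 mul0r.
rewrite mul0r cexp0 mulr1 -[1%:C]/(1 : C) mul1r => /eqP; rewrite subr_eq0 => /eqP e.
have J1 : J 1 = laplace (cexp om) s by rewrite /J /w -[1%:C]/(1 : C) mul1r.
have J0 : J 0 = cGamma (1 - s).
  rewrite /J /w mul0r cexp0 /laplace /cGamma; apply: eq_cintegral => x /RposP x0.
  rewrite /lker cpow_real// -cexp_real rmorphN mulN1r [RHS]mulrC /npow.
  by rewrite (_ : 1 - s - 1 = - s)//; ring.
rewrite -J0 -e J1 -mulrA -cexpD (_ : _ + _ = 0) ?cexp0 ?mulr1//; ring.
Qed.

End GammaRotation.

(** * Pointwise convergence of Fourier series *)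

Section FourierSeries.
Variable R : realType.
Notation C := R[i].
Notation mu := (@lebesgue_measure R).
Notation I01 := (`[0, 1]%classic : set R).
Implicit Types (z w s : C) (x y : R) (f g : R -> C).

Lemma measurable_I01 : measurable I01. Proof. exact: measurable_itv. Qed.

Lemma mu_I01 : mu I01 = 1%E.
Proof. by have := lebesgue_measure_itv `[0 : R, 1 : R]; rewrite /= lte_fin ltr01 /= sube0. Qed.

Lemma I01P x : I01 x <-> 0 <= x <= 1. Proof. by rewrite /= in_itv. Qed.

(** * The Riemann-Lebesgue lemma *)

Lemma integrable_cst_segment (a b c : R) : mu.-integrable `[a, b] (EFin \o (fun=> c)).
Proof.
apply: continuous_compact_integrable; first exact: segment_compact.
by apply: continuous_subspaceT => x; exact: cvg_cst.
Qed.

Lemma uniform_continuity (h : R -> R) (e : R) : continuous h -> 0 < e ->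
  exists2 d, 0 < d & forall x y, 0 <= x <= 1 -> `|x - y| < d -> `|h x - h y| <= e.
Proof.
move=> ch e0.
have cpt : compact I01 by exact: segment_compact.
have /compact_near_coveringP/(_ _ (nbhs (0 : R)) (fun d x => forall y, `|x - y| < d -> `|h x - h y| <= e)) := cpt.
move=> /(_ _ _)[|d0 /= d0p H].
  move=> x _.
  have e2 : 0 < e / 2 by rewrite divr_gt0.
  have /cvgrPdist_lt/(_ _ e2) := ch x; rewrite near_simpl => -[r /= r0 hr].
  exists (ball x (r / 2), ball (0 : R) (r / 2)) => /=.
    by split; exact: (@nbhsx_ballx _ _ _ (r / 2)%:pos) || (apply: nbhsx_ballx; rewrite divr_gt0).
  move=> [x' d] /= [bx bd] y xy.
  rewrite /ball /= in bx bd.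
  have h1 : `|h x - h x'| < e / 2.
    by apply: hr => /=; rewrite /ball_ /=; apply: lt_trans bx _; rewrite ltr_pdivrMr//; lra.
  have h2 : `|h x - h y| < e / 2.
    apply: hr; rewrite /ball_ /=.
    have -> : x - y = (x - x') + (x' - y) by ring.
    apply: le_lt_trans (ler_normD _ _) _.
    by move: bd; rewrite sub0r normrN => bd; have := ler_norm d; lra.
  have -> : h x' - h y = (h x - h y) - (h x - h x') by ring.
  apply: le_trans (ler_normB _ _) _; lra.
exists (d0 / 2); first by rewrite divr_gt0.
move=> x y x01; apply: H; last exact/I01P.
by rewrite /ball_ /= sub0r normrN gtr0_norm ?divr_gt0// ltr_pdivrMr//; lra.
Qed.

Lemma measurable_mulC (k : R -> R) (c : R) : continuous k -> measurable_fun I01 (fun x => k (c * x)).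
Proof.
move=> ck; apply: measurable_funTS; apply: continuous_measurable_fun => x.
apply: (@continuous_comp _ _ _ (fun x => c * x) k); last exact: ck.
exact: mulrl_continuous.
Qed.

(** k stands for a cosine or a sine; the condition on its primitive K says that k has zero mean
    between consecutive integers. g is approximated in mean by a continuous h, for which
    cancellation over each period is explicit. *)
Lemma riemann_lebesgue (g k K : R -> R) : mu.-integrable I01 (EFin \o g) ->
  continuous k -> (forall x, is_derive x 1 K (k x)) ->
  (forall j : nat, K j%:R = K 0) -> (forall x, `|k x| <= 1) ->
  (fun n : nat => Rintegral mu I01 (fun x => g x * k (n%:R * x))) @ \oo --> (0 : R).
Proof.
move=> gi ck dK KN k1; have mI := measurable_I01.
have ik (h : R -> R) n : mu.-integrable I01 (EFin \o h) ->
    mu.-integrable I01 (EFin \o (fun x => h x * k (n%:R * x))).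
  move=> hi; apply: (@le_integrable _ _ _ mu I01 mI _ _ _ _ hi).
    apply/measurable_EFinP; apply: measurable_funM.
      by apply/measurable_EFinP; exact: measurable_int hi.
    exact: measurable_mulC.
  by move=> x _ /=; rewrite lee_fin normrM ler_piMr.
apply/cvgrPdist_le => e e0.
have [] := @approximation_continuous_integrable R I01 g mI _ gi.
  by rewrite [X in (X < _)%E](_ : _ = 1%E) ?ltry//; exact: mu_I01.
move=> h_ [ch ih /fine_cvgP[_ /cvgrPdist_lt/(_ (e / 2))]].
rewrite divr_gt0// => /(_ isT)[N _ /(_ N (leqnn N))] /=.
move: (h_ N) (ch N) (ih N) => h chN ihN; rewrite sub0r normrN => gh.
have igh : mu.-integrable I01 (EFin \o (fun x => g x - h x)) by exact: integrableB_fin.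
have ghe : Rintegral mu I01 (fun x => `|g x - h x|) < e / 2.
  by apply: le_lt_trans gh; exact: ler_norm.
have e2 : 0 < e / 2 by rewrite divr_gt0.
have [d d0 hd] := uniform_continuity chN e2.
near=> n; have n0 : (0 < n)%N by near: n; exact: nbhs_infty_gt.
have nR0 : 0 < (n%:R : R) by rewrite ltr0n.
have nd : n%:R^-1 < d.
  rewrite -[ltRHS]invrK ltf_pV2 ?posrE ?invr_gt0//.
  by near: n; exact: nbhs_infty_gtr.
rewrite sub0r normrN.
(* On [j/n, (j+1)/n] the integral of k(n x) vanishes, so h may be replaced by h - h(j/n), which is
   at most e/2 in modulus as soon as 1/n < d. *)
have step j : (j <= n)%N ->
    `|Rintegral mu `[0, j%:R / n%:R] (fun x => h x * k (n%:R * x))| <= e / 2 * (j%:R / n%:R).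
  elim: j => [_|j IH jn].
    by rewrite mul0r mulr0 set_itv1 Rintegral_set1 normr0.
  have {}IH := IH (ltnW jn).
  set a := j%:R / n%:R in IH *; set b := j.+1%:R / n%:R.
  have ab : b - a = n%:R^-1 by rewrite /a /b -mulrBl -natr1 addrAC subrr add0r mul1r.
  have iv0 : 0 < (n%:R^-1 : R) by rewrite invr_gt0.
  have a0 : 0 <= a by rewrite divr_ge0.
  have b1 : b <= 1 by rewrite ler_pdivrMr// mul1r ler_nat.
  have i0b : mu.-integrable `[0, b] (EFin \o (fun x => h x * k (n%:R * x))).
    apply: integrableS (ik h n ihN) => //.
    by move=> x /=; rewrite !in_itv /=; lra.
  have := @Rintegral_itvB R (fun x => h x * k (n%:R * x)) (BLeft 0) (BRight b) a i0b.
  rewrite !bnd_simp a0 => /(_ isT) H; have {}H := H ltac:(lra).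
  have iab : mu.-integrable `[a, b] (EFin \o (fun x => h x * k (n%:R * x))).
    apply: integrableS i0b => //.
    by move=> x /=; rewrite !in_itv /=; lra.
  have iab' : mu.-integrable `]a, b] (EFin \o (fun x => h x * k (n%:R * x))).
    apply: integrableS i0b => //.
    by move=> x /=; rewrite !in_itv /=; lra.
  rewrite Rintegral_itv_obnd_cbnd// in H.
  have -> : Rintegral mu `[0, b] (fun x => h x * k (n%:R * x)) =
    Rintegral mu `[0, a] (fun x => h x * k (n%:R * x)) +
    Rintegral mu `[a, b] (fun x => h x * k (n%:R * x)) by rewrite -H; ring.
  have dk (x : R) : is_derive x 1 (fun x => n%:R^-1 * K (n%:R * x)) (k (n%:R * x)).
    have h1 : is_derive x 1 (fun x : R => n%:R * x) n%:R.
      by apply: is_derive_eq2 (is_deriveZ n%:R (is_derive_id x (1 : R))) _ _ => //;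
        rewrite /GRing.scale /= mulr1.
    apply: is_derive_eq2 (is_deriveZ n%:R^-1 (@is_derive1_comp _ K (fun x : R => n%:R * x) x _ _ (dK _) h1)) _ _ => //.
    by rewrite /GRing.scale /=; field; rewrite gt_eqF.
  have ckn : continuous (fun x => k (n%:R * x)).
    by move=> x; apply: (@continuous_comp _ _ _ (fun x => n%:R * x) k);
      [exact: mulrl_continuous|exact: ck].
  have ab' : a <= b by lra.
  have [ik0 ek0] := Rintegral_FTC ab' (fun x _ => dk x) (fun x _ => ckn x).
  have {}ek0 : Rintegral mu `[a, b] (fun x => k (n%:R * x)) = 0.
    rewrite ek0 /a /b ![n%:R * _]mulrC !divfK ?gt_eqF//.
    by rewrite !KN subrr.
  have mab : measurable (`[a, b]%classic : set R) by exact: measurable_itv.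
  have ica : mu.-integrable `[a, b] (EFin \o (fun x => h a * k (n%:R * x))).
    exact: integrableZl_fin.
  have -> : Rintegral mu `[a, b] (fun x => h x * k (n%:R * x)) =
     Rintegral mu `[a, b] (fun x => h x * k (n%:R * x) - h a * k (n%:R * x)).
    by rewrite RintegralB// RintegralZl// ek0 mulr0 subr0.
  have -> : e / 2 * b = e / 2 * a + e / 2 * (b - a) by ring.
  apply: le_trans (ler_normD _ _) (lerD IH _).
  have ibb : mu.-integrable `[a, b] (EFin \o (fun x => h x * k (n%:R * x) - h a * k (n%:R * x))).
    exact: integrableB_fin.
  apply: le_trans (@le_normr_Rintegral _ _ _ mu _ _ mab ibb) _.
  have mfin : fine (mu `[a, b]) = b - a.
    by rewrite lebesgue_measure_itv /= lte_fin ifT// -subr_gt0; lra.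
  rewrite -mfin -Rintegral_cst//; apply: le_Rintegral => //.
  - exact: integrable_norm.
  - exact: integrable_cst_segment.
  - move=> x; rewrite /= in_itv /= => xab; rewrite -mulrBl normrM.
    apply: le_trans (ler_piMr _ (k1 _)) _ => //.
    by apply: hd; [lra|rewrite ger0_norm; lra].
have hn : `|Rintegral mu I01 (fun x => h x * k (n%:R * x))| <= e / 2.
  by have := step n (leqnn n); rewrite divff ?gt_eqF// mulr1.
have -> : Rintegral mu I01 (fun x => g x * k (n%:R * x)) =
    Rintegral mu I01 (fun x => (g x - h x) * k (n%:R * x)) +
    Rintegral mu I01 (fun x => h x * k (n%:R * x)).
  rewrite -RintegralD//; [|exact: ik|exact: ik].
  by apply: eq_Rintegral => x _; rewrite -mulrDl subrK.
rewrite [leRHS]splitr; apply: le_trans (ler_normD _ _) (lerD _ hn).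
apply: le_trans (@le_normr_Rintegral _ _ _ mu _ _ mI (ik _ n igh)) _.
apply: le_trans (ltW ghe); apply: le_Rintegral => //.
- by apply: integrable_norm; exact: ik.
- exact: integrable_norm.
- by move=> x _; rewrite normrM ler_piMr.
Unshelve. all: by end_near. Qed.

Lemma cos2pi_nat j : cos (2 * pi * j%:R) = 1 :> R.
Proof. by have := congr1 (@complex.Re R) (e2pi_nat R j); rewrite /e2pi Re_cexp /= expR0 mul1r. Qed.
Lemma sin2pi_nat j : sin (2 * pi * j%:R) = 0 :> R.
Proof.
by have := congr1 (@complex.Im R) (e2pi_nat R j);
  rewrite /e2pi /cexp cImM /= expR0 mul1r mul0r addr0.
Qed.

Lemma pi2_neq0 : 2 * pi != 0 :> R.
Proof. by rewrite mulf_neq0// gt_eqF// pi_gt0. Qed.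

Lemma is_derive_scaled (F : R -> R) (d c x : R) : is_derive (c * x) 1 F d ->
  is_derive x 1 (fun x => F (c * x)) (d * c).
Proof.
move=> hF; have h1 : is_derive x 1 (fun x : R => c * x) c.
  by apply: is_derive_eq2 (is_deriveZ c (is_derive_id x (1 : R))) _ _ => //;
    rewrite /GRing.scale /= mulr1.
exact: (@is_derive1_comp _ F (fun x : R => c * x) x _ _ hF h1).
Qed.

Lemma riemann_lebesgue_cos (g : R -> R) : mu.-integrable I01 (EFin \o g) ->
  (fun n : nat => Rintegral mu I01 (fun x => g x * cos (2 * pi * (n%:R * x)))) @ \oo --> (0 : R).
Proof.
move=> gi; apply: (@riemann_lebesgue g (fun x => cos (2 * pi * x)) (fun x => (2 * pi)^-1 * sin (2 * pi * x)) gi).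
- move=> x; apply: (@continuous_comp _ _ _ (fun x => 2 * pi * x) (@cos R));
    [exact: mulrl_continuous|exact: continuous_cos].
- move=> x; apply: is_derive_eq2 (is_deriveZ (2 * pi)^-1 (is_derive_scaled (is_derive_sin _))) _ _ => //.
  by rewrite /GRing.scale /= mulrCA mulVf ?mulr1 ?pi2_neq0.
- by move=> j; rewrite sin2pi_nat !mulr0 sin0 mulr0.
- by move=> x; exact: cos_max.
Qed.

Lemma riemann_lebesgue_sin (g : R -> R) : mu.-integrable I01 (EFin \o g) ->
  (fun n : nat => Rintegral mu I01 (fun x => g x * sin (2 * pi * (n%:R * x)))) @ \oo --> (0 : R).
Proof.
move=> gi; apply: (@riemann_lebesgue g (fun x => sin (2 * pi * x)) (fun x => - (2 * pi)^-1 * cos (2 * pi * x)) gi).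
- move=> x; apply: (@continuous_comp _ _ _ (fun x => 2 * pi * x) (@sin R));
    [exact: mulrl_continuous|exact: continuous_sin].
- move=> x; apply: is_derive_eq2 (is_deriveZ (- (2 * pi)^-1) (is_derive_scaled (is_derive_cos _))) _ _ => //.
  by rewrite /GRing.scale /= 2!mulNr mulrN opprK mulrCA mulVf ?mulr1 ?pi2_neq0.
- by move=> j; rewrite cos2pi_nat mulr0 cos0.
- by move=> x; exact: sin_max.
Qed.

Lemma e2pi_cos_sin x : e2pi x = cos (2 * pi * x) +i* sin (2 * pi * x).
Proof. by rewrite /e2pi /cexp /= expR0 mul1r. Qed.

Lemma is_cderive_e2pi (c x : R) :
  is_cderive (fun x => e2pi (c * x)) x ((0 +i* (2 * pi * c)) * e2pi (c * x)).
Proof.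
have h := is_cderive_cexp (is_cderive_linear (0 +i* (2 * pi * c)) x).
have e (t : R) : t%:C * (0 +i* (2 * pi * c)) = 0 +i* (2 * pi * (c * t)).
  by apply: complex_ext; rewrite !ReIm_simp; ring.
by apply: is_cderive_eq h _ _ => [t|]; rewrite /e2pi e.
Qed.

Lemma cmeasurable_e2pi D (c : R) : measurable D -> cmeasurable D (fun x => e2pi (c * x)).
Proof.
move=> mD; apply: (@cmeasurableS _ setT) => //; apply: open_cderive_cmeasurable; first exact: openT.
by move=> x _; eexists; exact: is_cderive_e2pi.
Qed.

Lemma cintegrable_Me2pi g (c : R) : cintegrable I01 g -> cintegrable I01 (fun x => g x * e2pi (c * x)).
Proof.
move=> gi; have mI := measurable_I01.
apply: (@cintegrable_le _ _ _ (fun x => `|complex.Re (g x)| + `|complex.Im (g x)|)) => //.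
- apply: cmeasurableM; first exact: cintegrable_cmeasurable.
  exact: cmeasurable_e2pi.
- by move=> x _; rewrite cmodM cmod_e2pi mulr1 cmod_le_ReIm.
- by case: gi => gr gi; apply: integrableD_fin => //; exact: integrable_norm.
Qed.

Lemma fourier_coefE g (n : int) :
  fourier_coef g n = cintegral I01 (fun x => g x * e2pi (- n%:~R * x)).
Proof. by apply: eq_cintegral => x _; rewrite mulNr. Qed.

(** The flag chooses the direction, +oo or -oo; the telescoped partial sum has one term at each
    end. *)
Lemma fourier_coef_cvg0 g (b : bool) : cintegrable I01 g ->
  (fun N : nat => fourier_coef g (if b then N%:Z else - N%:Z)) @ \oo --> ((0 : C) : C^o).
Proof.
move=> [gr gi]; have mI := measurable_I01; pose sg : R := if b then 1 else -1.
have c1 := riemann_lebesgue_cos gr; have c2 := riemann_lebesgue_cos gi.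
have s1 := riemann_lebesgue_sin gr; have s2 := riemann_lebesgue_sin gi.
have ck (h : R -> R) (n : nat) : mu.-integrable I01 (EFin \o h) ->
    mu.-integrable I01 (EFin \o (fun x => h x * cos (2 * pi * (n%:R * x)))) /\
    mu.-integrable I01 (EFin \o (fun x => h x * sin (2 * pi * (n%:R * x)))).
  move=> hi; have [] := @cintegrable_Me2pi (fun x => (h x)%:C) n%:R.
    by split => //=; exact: (@integrable0 _ _ _ mu).
  move=> h1 h2; split.
    apply: (@eq_integrable _ _ _ mu I01 mI _ _ _ h1).
    by move=> x _; rewrite /comp e2pi_cos_sin !ReIm_simp mul0r subr0.
  apply: (@eq_integrable _ _ _ mu I01 mI _ _ _ h2).
  by move=> x _; rewrite /comp e2pi_cos_sin !ReIm_simp mul0r addr0.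
have eN x (N : nat) : e2pi (- (if b then N%:Z else - N%:Z)%:~R * x) =
    cos (2 * pi * (N%:R * x)) +i* (- sg * sin (2 * pi * (N%:R * x))).
  rewrite /sg; case: (b); rewrite e2pi_cos_sin.
    have -> : 2 * pi * (- (N%:Z)%:~R * x) = - (2 * pi * (N%:R * x)) by ring.
    by rewrite cosN sinN mulN1r.
  have -> : 2 * pi * (- (- N%:Z)%:~R * x) = 2 * pi * (N%:R * x) by rewrite mulrNz opprK.
  by rewrite opprK mul1r.
apply/cvgC_ReIm; split.
  have -> : (fun n : nat => complex.Re (fourier_coef g (if b then n%:Z else - n%:Z))) =
      (fun n => Rintegral mu I01 (fun x => complex.Re (g x) * cos (2 * pi * (n%:R * x))) +
        sg * Rintegral mu I01 (fun x => complex.Im (g x) * sin (2 * pi * (n%:R * x)))).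
    apply/funext => n; rewrite fourier_coefE /=.
    have [i1 _] := ck _ n gr; have [_ i2] := ck _ n gi.
    rewrite -RintegralZl// -RintegralD//; last exact: integrableZl_fin.
    by apply: eq_Rintegral => x _; rewrite eN !ReIm_simp; ring.
  rewrite -[X in _ --> X]addr0 -[X in _ --> _ + X](mulr0 sg).
  by apply: cvgD => //; exact: cvgMl_tmp.
have -> : (fun n : nat => complex.Im (fourier_coef g (if b then n%:Z else - n%:Z))) =
    (fun n => Rintegral mu I01 (fun x => complex.Im (g x) * cos (2 * pi * (n%:R * x))) +
      - sg * Rintegral mu I01 (fun x => complex.Re (g x) * sin (2 * pi * (n%:R * x)))).
  apply/funext => n; rewrite fourier_coefE /=.
  have [i1 _] := ck _ n gi; have [_ i2] := ck _ n gr.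
  rewrite -RintegralZl// -RintegralD//; last exact: integrableZl_fin.
  by apply: eq_Rintegral => x _; rewrite eN !ReIm_simp; ring.
rewrite -[X in _ --> X]addr0 -[X in _ --> _ + X](mulr0 (- sg)).
by apply: cvgD => //; exact: cvgMl_tmp.
Qed.

Lemma fourier_coef_cst (a : C) (n : int) :
  fourier_coef (fun=> a) n = if n == 0 then a else 0.
Proof.
have mI := measurable_I01.
case: eqP => [->|/eqP n0].
  rewrite /fourier_coef (@eq_cintegral _ _ _ (fun=> a)) => [|x _]; last first.
    by rewrite mulr0z mul0r oppr0 e2pi0 mulr1.
  by apply: complex_ext; rewrite /= Rintegral_cst// [X in _ * X](_ : _ = 1) ?mulr1//;
    exact: (congr1 fine mu_I01).
rewrite fourier_coefE.
pose c : R := - n%:~R.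
have c0 : 2 * pi * c != 0 :> R by rewrite mulf_neq0 ?pi2_neq0// /c oppr_eq0 intr_eq0.
pose u : C := 0 +i* (2 * pi * c).
have u0 : u != 0.
  by rewrite /u; apply/eqP => /(congr1 (@complex.Im R)) /= /eqP; exact/negP.
have d1 (x : R) : is_cderive (fun x => a * (u^-1 * e2pi (c * x))) x (a * e2pi (c * x)).
  apply: is_cderive_eq (is_cderiveZ a (is_cderiveZ u^-1 (is_cderive_e2pi c x))) _ _ => //.
  by rewrite -/u mulKf.
have d2 (x : R) : is_cderive (fun x => a * e2pi (c * x)) x (a * (u * e2pi (c * x))).
  by apply: is_cderiveZ; exact: is_cderive_e2pi.
have [_ ->] := cintegral_FTC ler01 (fun x _ => d1 x) (fun x _ => d2 x).
by rewrite mulr0 e2pi0 mulr1 /c e2piN e2pi_int invr1 subrr.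
Qed.

(** * Lower bounds for e^(2 pi i t) - 1, and the pointwise convergence *)

Lemma sin_lower_bound y : `|y| <= 1 -> cos 1 * `|y| <= `|sin y|.
Proof.
wlog y0 : y / 0 <= y => [wl|].
  have [/wl//|/ltW yn] := leP 0 y.
  move=> h; have := wl (- y); rewrite sinN !normrN; apply => //; by rewrite oppr_ge0.
rewrite ger0_norm// => y1; apply: le_trans (ler_norm _).
have [->|yn0] := eqVneq y 0; first by rewrite mulr0 sin0.
have yp : 0 < y by rewrite lt_def yn0.
have [|c] := @MVT R (@sin R) (@cos R) 0 y yp.
  by apply: continuous_subspaceT; exact: continuous_sin.
rewrite in_itv /= => /andP[c0 cy]; rewrite sin0 !subr0 => ->.
rewrite ler_pM2r//; apply: ltW; rewrite ltr_cos ?in_itv /= ?ler01 ?(ltW c0)//=.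
- lra.
- have := pi_ge2 R; lra.
- have := pi_ge2 R; lra.
Qed.

(** Read off the imaginary part sin(2 pi t); 1/8 ensures |2 pi t| <= 1, as pi < 4. *)
Lemma e2pi_sub1_near (t : R) : `|t| <= 8^-1 -> cmod (e2pi t - 1) >= cos 1 * `|t|.
Proof.
move=> t8; have p4 := pihalf_lt2 R; have p2 := pi_ge2 R.
apply: le_trans (le_Im_cmod _); rewrite e2pi_cos_sin !ReIm_simp /= subr0.
have h : `|2 * pi * t| <= 1.
  rewrite normrM gtr0_norm; last by lra.
  have t0 := normr_ge0 t; nra.
apply: le_trans (sin_lower_bound h); rewrite ler_pM2l ?cos1_gt0//.
rewrite normrM gtr0_norm; last by lra.
by rewrite ler_peMl//; lra.
Qed.

(** Read off the real part: the cosine decreases on [0, pi], and the symmetry between |t| and 1 -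
    |t| brings t there. *)
Lemma e2pi_sub1_far (m t : R) : 0 < m -> m <= `|t| <= 1 - m ->
  1 - cos (2 * pi * m) <= cmod (e2pi t - 1).
Proof.
move=> m0 /andP[mt tm]; apply: le_trans (le_Re_cmod _).
rewrite e2pi_cos_sin !ReIm_simp /= distrC; apply: le_trans (ler_norm _).
rewrite lerD2l lerN2.
have p0 := pi_gt0 R.
have key u : m <= u <= 2^-1 -> cos (2 * pi * u) <= cos (2 * pi * m).
  move=> /andP[mu_ u2]; have [->//|ne] := eqVneq u m.
  apply: ltW; rewrite ltr_cos ?in_itv /=.
  - by rewrite ltr_pM2l ?mulr_gt0// lt_neqAle eq_sym ne.
  - apply/andP; split; first by rewrite !mulr_ge0//; lra.
    by rewrite mulrAC -[leRHS]mul1r ler_pM2r//; lra.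
  - apply/andP; split; first by rewrite !mulr_ge0//; lra.
    by rewrite mulrAC -[leRHS]mul1r ler_pM2r//; lra.
have -> : cos (2 * pi * t) = cos (2 * pi * `|t|).
  by rewrite -cos_norm normrM [`|2 * pi|]gtr0_norm ?mulr_gt0.
have [t2|t2] := leP `|t| 2^-1; first by apply: key; rewrite mt.
have -> : cos (2 * pi * `|t|) = cos (2 * pi * (1 - `|t|)).
  rewrite mulrBr mulr1 cosB.
  have -> : 2 * pi = pi *+ 2 :> R by rewrite mulr_natl.
  by rewrite cos2pi sin2pi mul1r mul0r addr0.
by apply: key; lra.
Qed.

Lemma cmeasurable_inv D f : measurable D -> cmeasurable D f -> cmeasurable D (fun x => (f x)^-1).
Proof.
move=> mD [fr fi].
have inv : measurable_fun [set: R] (fun x : R => x^-1).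
  (* The inverse is not continuous at 0, so the point 0 and its open complement are treated
     apart. *)
  rewrite -(setUv [set (0 : R)]); apply/measurable_funU.
  - exact: measurable_set1.
  - by apply: measurableC; exact: measurable_set1.
  split; first exact: measurable_fun_set1.
  apply: open_continuous_measurable_fun; first by rewrite openC; apply: accessible_closed_set1;
    exact: hausdorff_accessible.
  move=> x; rewrite inE => /= /eqP x0; exact: inv_continuous.
have n2 : measurable_fun D (fun x => (complex.Re (f x) ^+ 2 + complex.Im (f x) ^+ 2)^-1).
  apply: (@measurableT_comp _ _ _ _ _ _ (fun x : R => x^-1)) => //.
  by apply: measurable_funD; exact: measurable_funX.
split.
  rewrite (_ : (fun x => _) = (fun x => complex.Re (f x) * (complex.Re (f x) ^+ 2 + complex.Im (f x) ^+ 2)^-1)).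
    exact: measurable_funM.
  by apply/funext => x; case: (f x).
rewrite (_ : (fun x => _) = (fun x => -1 * (complex.Im (f x) * (complex.Re (f x) ^+ 2 + complex.Im (f x) ^+ 2)^-1))).
  by apply: measurable_funM; [exact: measurable_cst|exact: measurable_funM].
by apply/funext => x; case: (f x) => a b /=; rewrite mulN1r.
Qed.

(* Chernoff's argument: writing f - f alpha = g * (e2pi (x - alpha) - 1) with g integrable,
   the symmetric partial sums of the Fourier series telescope. *)
Lemma fourier_series_pointwise f alpha (L d : R) : cintegrable I01 f -> 0 < alpha < 1 ->
  0 < d -> (forall x, 0 <= x <= 1 -> `|x - alpha| < d -> cmod (f x - f alpha) <= L * `|x - alpha|) ->
  bisum (fun n : int => e2pi (- (n%:~R * alpha)) * fourier_coef f (- n)) @ \oo --> (f alpha : C^o).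
Proof.
move=> fi /andP[a0 a1] d0 fL; have mI := measurable_I01.
pose q x : C := e2pi (x - alpha) - 1.
pose g x : C := (f x - f alpha) / q x.
(* Closer to alpha than m, both the Lipschitz hypothesis and the linear lower bound on q apply. As m
   <= alpha and m <= 1 - alpha, the remaining points satisfy m <= |x - alpha| <= 1 - m, away from
   all zeros of q. *)
pose m := Num.min (Num.min d 8^-1) (Num.min alpha (1 - alpha)).
have m0 : 0 < m by rewrite !lt_min d0 a0 invr_gt0 ltr0n/=; lra.
have [md [m8 [ma m1a]]] : m <= d /\ m <= 8^-1 /\ m <= alpha /\ m <= 1 - alpha.
  by rewrite /m !ge_min !lexx !orbT.
have qm x : q x = e2pi (- alpha) * e2pi (1 * x) - 1 by rewrite /q -e2piD mul1r [- alpha + _]addrC.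
have qfar x : 0 <= x <= 1 -> m <= `|x - alpha| -> 1 - cos (2 * pi * m) <= cmod (q x).
  by move=> x01 mx; apply: e2pi_sub1_far => //; rewrite mx /= ler_norml; lra.
have qnear x : `|x - alpha| < m -> cos 1 * `|x - alpha| <= cmod (q x).
  by move=> xm; apply: e2pi_sub1_near; lra.
have c1 : 0 < 1 - cos (2 * pi * m).
  have p0 := pi_gt0 R.
  have h : 0 <= 2 * pi * m <= pi.
    apply/andP; split; first by rewrite !mulr_ge0//; lra.
    by rewrite mulrAC -[leRHS]mul1r ler_pM2r//; lra.
  rewrite subr_gt0 -[ltRHS](cos0 R) ltr_cos ?in_itv /= ?h ?lexx ?(ltW p0)//.
  by rewrite !mulr_gt0.
have q0 x : 0 <= x <= 1 -> x != alpha -> q x != 0.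
  move=> x01 xa; rewrite -cmod_gt0; have [xm|xm] := ltP `|x - alpha| m.
    by apply: lt_le_trans (qnear x xm); rewrite mulr_gt0 ?cos1_gt0// normr_gt0 subr_eq0.
  exact: lt_le_trans (qfar x x01 xm).
have fg x : 0 <= x <= 1 -> f x = f alpha + g x * q x.
  move=> x01; have [->|xa] := eqVneq x alpha; first by rewrite /g subrr mul0r mul0r addr0.
  by rewrite /g divfK ?q0// addrC subrK.
have fm := cintegrable_cmeasurable fi.
have qmeas : cmeasurable I01 q.
  rewrite (_ : q = (fun x => e2pi (- alpha) * e2pi (1 * x) - 1)); last exact/funext.
  apply: cmeasurableB; last exact: cmeasurable_cst.
  by apply: cmeasurableZ; exact: cmeasurable_e2pi.
have gi : cintegrable I01 g.
  pose M := (1 - cos (2 * pi * m))^-1.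
  have M0 : 0 < M by rewrite invr_gt0.
  pose L' := `|L| / cos 1.
  have L0 : 0 <= L' by rewrite divr_ge0// ltW// cos1_gt0.
  (* Near alpha, the Lipschitz bound divided by the linear lower bound on q gives L'; elsewhere |q|
     is at least 1 / M. *)
  apply: (@cintegrable_le _ _ _ (fun x => (L' + M * cmod (f alpha)) + M * (`|complex.Re (f x)| + `|complex.Im (f x)|))) => //.
  - apply: cmeasurableM; last exact: cmeasurable_inv.
    by apply: cmeasurableB => //; exact: cmeasurable_cst.
  - move=> x /I01P x01; rewrite /g cmodM cmodV.
    have fx0 : 0 <= `|complex.Re (f x)| + `|complex.Im (f x)| by rewrite addr_ge0.
    have [xm|xm] := ltP `|x - alpha| m.
      apply: (@le_trans _ _ L'); last first.
        by rewrite -addrA lerDl addr_ge0// mulr_ge0 ?cmod_ge0// ltW.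
      have [->|xa] := eqVneq x alpha; first by rewrite subrr cmod0 mul0r.
      have xa0 : 0 < `|x - alpha| by rewrite normr_gt0 subr_eq0.
      rewrite ler_pdivrMr ?cmod_gt0 ?q0//.
      apply: le_trans (fL x x01 (lt_le_trans xm md)) _.
      apply: (@le_trans _ _ (L' * (cos 1 * `|x - alpha|))); last by rewrite ler_wpM2l// qnear.
      rewrite /L' mulrA divfK ?gt_eqF ?cos1_gt0// ler_wpM2r// ler_norm //.
    have h1 : (cmod (q x))^-1 <= M.
      by rewrite lef_pV2 ?posrE ?qfar// (lt_le_trans c1)// qfar.
    apply: le_trans (ler_pM (cmod_ge0 _) _ (cmodD _ _) h1) _; first by rewrite invr_ge0 cmod_ge0.
    rewrite cmodN -addrA [leRHS]addrC -addrA mulrC mulrDr.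
    have h2 := ler_wpM2l (ltW M0) (cmod_le_ReIm (f x)); lra.
  - apply: integrableD_fin => //.
      exact: integrable_cst_segment.
    apply: integrableZl_fin => //; case: fi => fr fi.
    by apply: integrableD_fin => //; exact: integrable_norm.
(* Multiplication by e^(2 pi i x) shifts the Fourier coefficients by one. *)
have coefs n : fourier_coef f n = (if n == 0 then f alpha else 0) +
    (e2pi (- alpha) * fourier_coef g (n - 1) - fourier_coef g n).
  rewrite -(fourier_coef_cst (f alpha)) !fourier_coefE.
  have ig (c : R) := cintegrable_Me2pi c gi.
  have icst : cintegrable I01 (fun=> f alpha).
    by apply: (@cintegrable_cderive _ _ (fun=> 0)) => x _; exact: is_cderive_cst.
  rewrite -cintegralZ// -cintegralB//; last exact: cintegrableZ.
  rewrite -cintegralD//; last 2 first.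
  - exact: cintegrable_Me2pi.
  - by apply: cintegrableB => //; exact: cintegrableZ.
  apply: eq_cintegral => x /I01P x01; rewrite fg// qm.
  have -> : - (n - 1)%:~R * x = 1 * x + - n%:~R * x by rewrite rmorphB /= rmorph1; ring.
  by rewrite e2piD; ring.
(* Absorbing the phase into the coefficient makes each term a difference of consecutive values of G;
   the modulus is unchanged. *)
pose G (n : int) : C := e2pi (n%:~R * alpha) * fourier_coef g n.
have term n : e2pi (- (n%:~R * alpha)) * fourier_coef f (- n) =
    (if n == 0 then f alpha else 0) + (G (- n - 1) - G (- n)).
  rewrite coefs oppr_eq0 /G mulrDr; congr (_ + _).
    by case: eqP => [->|_]; rewrite ?mulr0// mul0r oppr0 e2pi0 mul1r.
  rewrite mulrBr mulrA -e2piD rmorphN /= mulNr; congr (e2pi _ * _ - _).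
  by rewrite rmorphB rmorphN /= rmorph1; ring.
have sumE N : bisum (fun n : int => e2pi (- (n%:~R * alpha)) * fourier_coef f (- n)) N =
    f alpha + (G (- N.+1%:Z) - G N%:Z).
  rewrite /bisum (eq_bigr (fun k : 'I_N.*2.+1 => (if k == N :> nat then f alpha else 0) +
      (G (N%:Z - k.+1%:Z) - G (N%:Z - k%:Z)))); last first.
    move=> k _; rewrite term; congr (_ + (G _ - G _)).
    - by rewrite subr_eq0 eqz_nat.
    - by rewrite intS; ring.
    - by ring.
  rewrite big_split /=; congr (_ + _).
    have NN : (N < N.*2.+1)%N by rewrite -addnn ltnS leq_addr.
    rewrite (bigD1 (Ordinal NN)) //= eqxx big1 ?addr0// => i /negP ne.
    by case: eqP => // e; case: ne; apply/eqP/val_inj.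
  rewrite -(big_mkord xpredT (fun k => G (N%:Z - k.+1%:Z) - G (N%:Z - k%:Z))).
  rewrite (telescope_sumr (fun k : nat => G (N%:Z - k%:Z)))// subr0; congr (G _ - _).
  lia.
have cG (n : int) : cmod (G n) = cmod (fourier_coef g n) by rewrite cmodM cmod_e2pi mul1r.
have g1 := fourier_coef_cvg0 true gi.
have g2 := (cvgC_shiftS _ _).2 (fourier_coef_cvg0 false gi).
have G1 : (fun N : nat => G N%:Z) @ \oo --> ((0 : C) : C^o).
  by apply/cvgCP; move/cvgCP: g1; under eq_fun do rewrite subr0;
    under [X in _ -> X @ _ --> _]eq_fun do rewrite subr0 cG.
have G2 : (fun N : nat => G (- N.+1%:Z)) @ \oo --> ((0 : C) : C^o).
  by apply/cvgCP; move/cvgCP: g2; under eq_fun do rewrite subr0;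
    under [X in _ -> X @ _ --> _]eq_fun do rewrite subr0 cG.
have := cvgCD (cvgC_cst (f alpha)) (cvgCB G2 G1); rewrite subrr addr0.
by rewrite (_ : bisum _ = (fun N : nat => f alpha + (G (- N.+1%:Z) - G N%:Z)))//; apply/funext.
Qed.

End FourierSeries.

(** * The unfolded integral *)

Section LerchFourierCoefficients.
Variable R : realType.
Notation C := R[i].
Notation mu := (@lebesgue_measure R).
Notation Rpos := (`]0, +oo[%classic : set R).
Notation I01 := (`[0, 1]%classic : set R).
Notation D01 := (`]0, 1[%classic : set R).
Implicit Types (z w s zeta : C) (x y : R) (f g : R -> C).

Lemma D01P x : D01 x <-> 0 < x < 1. Proof. by rewrite /= in_itv. Qed.
Lemma measurable_D01 : measurable D01. Proof. exact: measurable_itv. Qed.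

(** Through continuity on the open interval, which the Lipschitz bound in x supplies. *)
Lemma abelsum_shift_cmeasurable zeta k s : cmod zeta <= 1 -> zeta != 1 ->
  4 <= complex.Re s + k%:R -> cmeasurable D01 (fun x => abelsum zeta k (npow s) (1 + x)).
Proof.
move=> z1 zn1 sk; have [p ps] := npow_polyb (s + 1).
have [B hB] := @npow_decay _ k s sk.
have [B' hB'] := @npow_decay _ k (s + 1) ltac:(rewrite cReD /=; lra).
have gp : polyb p (fun x => - s * npow (s + 1) x) (cmod s).
  by move=> x x1; rewrite cmodM cmodN ler_wpM2l ?cmod_ge0//; have := ps x x1; rewrite mul1r.
have gd : decay k (fun x => - s * npow (s + 1) x) (cmod s * B').
  move=> x x1; rewrite iter_fdiffZ cmodM cmodN -mulrA ler_wpM2l ?cmod_ge0//; exact: hB'.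
have [K HK] := abelsum_lipschitz_x z1 zn1 (@is_cderive_npow _ s) gp gd hB.
have cont (h : R -> R) : (forall x y, 1 <= x <= 2 -> 1 <= y <= 2 -> `|h x - h y| <= K * `|x - y|) ->
    forall x, D01 x -> {for x, continuous (fun x => h (1 + x))}.
  move=> hh x /D01P x01; apply/cvgrPdist_lt => e e0; near=> t.
  have t01 : 0 < t < 1.
    suff : t \in `]0, 1[ by rewrite in_itv.
    by near: t; apply: near_in_itvoo; rewrite in_itv.
  have K1 : 0 < `|K| + 1 by have := normr_ge0 K; lra.
  apply: le_lt_trans (hh _ _ _ _) _; [lra|lra|].
  have -> : 1 + x - (1 + t) = x - t by ring.
  have xt : `|x - t| < e / (`|K| + 1).
    by near: t; exists (e / (`|K| + 1)) => //=; rewrite divr_gt0.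
  rewrite ltr_pdivlMr// in xt; apply: le_lt_trans xt.
  rewrite mulrC ler_wpM2l//; have := ler_norm K; lra.
apply: open_continuous_cmeasurable; first exact: interval_open.
  apply: (cont (fun t => complex.Re (abelsum zeta k (npow s) t))) => x y hx hy.
  by rewrite -cReN -cReD (le_trans (le_Re_cmod _))// HK.
apply: (cont (fun t => complex.Im (abelsum zeta k (npow s) t))) => x y hx hy.
by rewrite -cImN -cImD (le_trans (le_Im_cmod _))// HK.
Unshelve. all: by end_near. Qed.

Lemma npow_cmeasurable s : cmeasurable D01 (npow s).
Proof.
apply: open_cderive_cmeasurable; first exact: interval_open.
by move=> x /D01P/andP[x0 _]; eexists; exact: is_cderive_npow.
Qed.

Lemma cexp_linear_cmeasurable (c : C) : cmeasurable D01 (fun x => cexp (c * x%:C)).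
Proof.
apply: open_cderive_cmeasurable; first exact: interval_open.
move=> x _; eexists; apply: is_cderive_cexp; apply: is_cderiveZ.
exact: is_cderive_real (is_derive_id x (1 : R)).
Qed.

(** Comparison with Euler's kernel, as 1 <= e . e^(-x) on ]0, 1[. *)
Lemma integrable_npow01 s : complex.Re s < 1 -> mu.-integrable D01 (EFin \o (fun x => cmod (npow s x))).
Proof.
move=> s1; have s10 : 0 < 1 - complex.Re s by lra.
have H := @integrable_gamma_kernel R (1 - complex.Re s) 1 s10 ltr01.
have H1 : mu.-integrable D01 (EFin \o (fun x => expR 1 * expR (- 1 * x + (1 - complex.Re s - 1) * ln x))).
  apply: integrableZl_fin; first exact: measurable_D01.
  apply: integrableS H => //.
  by move=> x /D01P/andP[x0 _]; exact/RposP.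
apply: (@le_integrable _ _ _ mu D01 measurable_D01 _ _ _ _ H1).
  apply/measurable_EFinP; apply: open_continuous_measurable_fun; first exact: interval_open.
  move=> x; rewrite inE => /D01P/andP[x0 _].
  rewrite (_ : (fun x => cmod _) = (fun x => expR (- complex.Re s * ln x)));
    last by apply/funext => t; rewrite cmod_npow.
  exact: is_derive_continuous (is_derive_expR_comp (is_deriveZ (- complex.Re s) (is_derive1_ln x0))).
move=> x /D01P/andP[x0 x1] /=; rewrite lee_fin ger0_norm ?cmod_ge0//.
rewrite ger0_norm ?mulr_ge0 ?expR_ge0// -expRD cmod_npow ler_expR.
have -> : 1 - complex.Re s - 1 = - complex.Re s by ring.
lra.
Qed.

(** w and zeta are independent here: measurability and domination hold for any zeta of modulus at
    most 1 away from 1. Only the unfolding and its limit link them by zeta = e^(-w). *)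
Definition lerch_integrand w zeta k s x : C :=
  cexp (- w * x%:C) * (npow s x + zeta * abelsum zeta k (npow s) (1 + x)).

Lemma lerch_integrand_cmeasurable w zeta k s : cmod zeta <= 1 -> zeta != 1 ->
  4 <= complex.Re s + k%:R -> cmeasurable D01 (lerch_integrand w zeta k s).
Proof.
move=> z1 zn1 sk; apply: cmeasurableM; first exact: cexp_linear_cmeasurable.
apply: cmeasurableD; first exact: npow_cmeasurable.
by apply: cmeasurableZ; exact: abelsum_shift_cmeasurable.
Qed.

Lemma npow_abelsum_bound k s (d : R) : 0 < d -> 4 <= complex.Re s + k%:R ->
  exists p A, forall zeta, cmod zeta <= 1 -> d <= cmod (1 - zeta) ->
    forall x, 1 <= x -> cmod (abelsum zeta k (npow s) x) <= A * x ^+ p.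
Proof.
move=> d0 sk; have [p ps] := npow_polyb s; have [B hB] := npow_decay sk.
by have [A hA] := abelsum_polyb d0 ps hB; exists p, A => zeta z1 dz x x1; exact: hA.
Qed.

(** One dominating function for all w and zeta of the region, for the passage to the imaginary
    axis. *)
Lemma lerch_integrand_le k s (d : R) : 0 < d -> 4 <= complex.Re s + k%:R ->
  exists M, forall w zeta, 0 <= complex.Re w -> cmod zeta <= 1 -> d <= cmod (1 - zeta) ->
    forall x, 0 < x < 1 -> cmod (lerch_integrand w zeta k s x) <= cmod (npow s x) + M.
Proof.
move=> d0 sk; have [p [A hA]] := npow_abelsum_bound d0 sk.
exists (A * 2 ^+ p) => w zeta w0 z1 dz x /andP[x0 x1].
have x11 : 1 <= 1 + x by lra.
have A0 : 0 <= A.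
  by have := hA _ z1 dz 1 (lexx _); rewrite expr1n mulr1; apply: le_trans; exact: cmod_ge0.
rewrite /lerch_integrand cmodM cmod_cexp cReM /= mulr0 subr0 cReN.
apply: le_trans (ler_piMl (cmod_ge0 _) _) _.
  by rewrite expR_le1 mulNr oppr_le0 mulr_ge0// ltW.
apply: le_trans (cmodD _ _) _; rewrite lerD2l cmodM.
apply: le_trans (ler_piMl (cmod_ge0 _) z1) _.
apply: le_trans (hA _ z1 dz _ x11) _.
by rewrite ler_wpM2l// lerXn2r ?nnegrE; lra.
Qed.

Lemma integrable_npow01D s (M : R) : complex.Re s < 1 ->
  mu.-integrable D01 (EFin \o (fun x => cmod (npow s x) + M)).
Proof.
move=> s1; apply: integrableD_fin; first exact: measurable_D01.
  exact: integrable_npow01.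
apply: (@integrableS _ _ _ mu I01) (integrable_cst_segment 0 1 M);
  [exact: measurable_I01|exact: measurable_D01|].
by move=> x /D01P /andP[x0 x1]; apply/I01P; rewrite !ltW.
Qed.

Lemma lerch_integrand_cintegrable w zeta k s : 0 <= complex.Re w -> cmod zeta <= 1 -> zeta != 1 ->
  complex.Re s < 1 -> 4 <= complex.Re s + k%:R -> cintegrable D01 (lerch_integrand w zeta k s).
Proof.
move=> w0 z1 zn1 s1 sk.
have d0 : 0 < cmod (1 - zeta) by rewrite cmod_gt0 subr_eq0 eq_sym.
have [M HM] := lerch_integrand_le d0 sk.
apply: (@cintegrable_le _ _ _ (fun x => cmod (npow s x) + M)).
- exact: measurable_D01.
- exact: lerch_integrand_cmeasurable.
- by move=> x /D01P x01; exact: HM.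
- exact: integrable_npow01D.
Qed.

Lemma cvg_expr_poly (p : nat) (q : R) : 0 <= q < 1 ->
  (fun N : nat => q ^+ N.+1 * (2 + N%:R) ^+ p) @ \oo --> (0 : R).
Proof.
move=> /andP[q0 q1]; have [->|qn0] := eqVneq q 0.
  by under eq_fun do rewrite expr0n mul0r; exact: cvg_cst.
have qp : 0 < q by rewrite lt_def qn0.
(* Half of the geometric rate is spent on the polynomial. *)
pose c := - ln q / 2; have c0 : 0 < c.
  by rewrite divr_gt0// oppr_gt0 ln_lt0// qp.
pose K := expR ((p%:R + 1) * ln ((p%:R + 1) / c) + 2 * c).
apply: (@cvg0_le _ _ (fun N => K * expR (- c) ^+ N)) => [N|]; last first.
  rewrite -[X in _ --> X](mulr0 K); apply: cvgMl_tmp; apply: cvg_expr.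
  by rewrite ger0_norm ?expR_ge0// expR_lt1 oppr_lt0.
have n2 : 1 <= 2 + N%:R :> R by have : (0 : R) <= N%:R by []; lra.
have np : 0 < 2 + N%:R :> R by lra.
have l0 := ln_ge0 n2.
rewrite ger0_norm ?mulr_ge0 ?exprn_ge0 ?(ltW np)//.
rewrite -[q]lnK ?posrE// -expRM_natl -[2 + _ in leLHS]lnK ?posrE// -!expRM_natl -!expRD ler_expR.
have p1 : 0 < p%:R + 1 :> R by rewrite ltr_wpDl.
have h := ln_le_linear p1 c0 np.
have -> : ln q = - 2 * c by rewrite /c; field.
have : 0 <= c * N%:R by rewrite mulr_ge0// ltW.
rewrite -natr1 mulrDl mul1r in h *; nra.
Qed.

Lemma cintegral_lker_partial w s M : 0 < complex.Re w -> complex.Re s < 1 ->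
  cintegral D01 (lker w s) +
  \sum_(n < M) cintegral D01 (fun x => lker w s (x + n.+1%:R)) =
  cintegral `]0, M.+1%:R] (lker w s).
Proof.
move=> w0 s1; have li := lker_integrable w0 s1.
have lm := cintegrable_cmeasurable li.
elim: M => [|M IH].
  rewrite big_ord0 addr0 -(@cintegral_bndoo _ (lker w s) 0 1 false false)//.
  apply: cmeasurableS lm; first exact: measurable_Rpos.
  by move=> x /D01P/andP[x0 _]; exact/RposP.
rewrite big_ord_recr /= addrA IH.
have M0 : (0 : R) < M.+1%:R by [].
have MM : (M.+1%:R : R) <= M.+2%:R by rewrite ler_nat.
have i2 : cintegrable `]0, M.+2%:R] (lker w s).
  apply: cintegrableS li; [exact: measurable_Rpos|exact: measurable_itv|].
  by move=> x; rewrite /= !in_itv /= andbT => /andP[].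
have split (h : R -> R) : mu.-integrable `]0, M.+2%:R] (EFin \o h) ->
    Rintegral mu `]0, M.+2%:R] h =
    Rintegral mu `]0, M.+1%:R] h + Rintegral mu `[M.+1%:R, M.+2%:R] h.
  move=> ih; have := @Rintegral_itvB R h (BRight 0) (BRight M.+2%:R) M.+1%:R ih.
  rewrite !bnd_simp => /(_ (ltW M0) MM); rewrite (@Rintegral_itv_obnd_cbnd _ M.+1%:R) => [<-|].
    by rewrite addrC subrK.
  apply: integrableS ih; [exact: measurable_itv|exact: measurable_itv|].
  by move=> x; rewrite /= !in_itv /=; lra.
have -> : cintegral `]0, M.+2%:R] (lker w s) =
    cintegral `]0, M.+1%:R] (lker w s) + cintegral `[M.+1%:R, M.+2%:R] (lker w s).
  by case: i2 => ir ii; apply: complex_ext; rewrite ?cReD ?cImD /=; exact: split.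
congr (_ + _).
have dl x : M.+1%:R <= x <= M.+1%:R + 1 -> is_cderive (lker w s) x (- w * lker w s x - s * lker w (s + 1) x).
  by move=> /andP[h _]; apply: is_cderive_lker; exact: lt_le_trans h.
have -> : M.+2%:R = M.+1%:R + 1 :> R by rewrite natr1.
rewrite (cintegral_translation dl).
rewrite -(@cintegral_bndoo _ _ 0 1 true false)//.
apply: open_cderive_cmeasurable; first exact: interval_open.
move=> x /D01P/andP[x0 _]; eexists; apply: is_cderive_shift; apply: is_cderive_lker.
by rewrite addr_gt0.
Qed.

Lemma cvg_cintegral_lker w s : 0 < complex.Re w -> complex.Re s < 1 ->
  (fun M : nat => cintegral `]0, M.+1%:R] (lker w s)) @ \oo --> (laplace w s : C^o).
Proof.
move=> w0 s1.
apply: (@cintegral_exhaust_sets _ (lker w s) (fun M : nat => `]0, M.+1%:R]%classic : set R)).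
- exact: lker_integrable.
- by move=> n x; rewrite /= !in_itv /= andbT => /andP[].
- by move=> n; exact: measurable_itv.
- move=> x x0; near=> n; rewrite /= in_itv /= x0 /=.
  apply: ltW; apply: (@lt_trans _ _ n%:R); last by rewrite ltr_nat.
  by near: n; exact: nbhs_infty_gtr.
Unshelve. all: by end_near. Qed.

(** After M translates the remainder is exactly e^(-wx) zeta^(M+1) A(1 + x + M). As |zeta| < 1, it
    tends to 0 uniformly on ]0, 1[ against the polynomial growth of A. *)
Lemma lerch_integrand_laplace w k s : 0 < complex.Re w -> complex.Re s < 1 ->
  4 <= complex.Re s + k%:R ->
  cintegral D01 (lerch_integrand w (cexp (- w)) k s) = laplace w s.
Proof.
move=> w0 s1 sk; set zeta := cexp (- w).
have mD := measurable_D01.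
have zl1 : cmod zeta < 1 by rewrite cmod_cexp cReN expR_lt1 oppr_lt0.
have z1 := ltW zl1.
have zn1 : zeta != 1 by apply/eqP => e; move: zl1; rewrite e cmod1 ltxx.
have d0 : 0 < cmod (1 - zeta) by rewrite cmod_gt0 subr_eq0 eq_sym.
have [p [A hA]] := npow_abelsum_bound d0 sk.
have [B hB] := npow_decay sk.
have A0 : 0 <= A.
  by have := hA _ z1 (lexx _) 1 (lexx _); rewrite expr1n mulr1; apply: le_trans; exact: cmod_ge0.
have Fi := lerch_integrand_cintegrable (ltW w0) z1 zn1 s1 sk.
pose P M x := lker w s x + \sum_(n < M) lker w s (x + n.+1%:R).
have li0 : cintegrable D01 (lker w s).
  apply: cintegrableS (lker_integrable w0 s1) => //.
  by move=> x /D01P/andP[x0 _]; exact/RposP.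
have lin (n : nat) : cintegrable D01 (fun x => lker w s (x + n.+1%:R)).
  apply: (@cintegrableS _ I01) => //.
    by move=> x /D01P /andP[x0 x1]; apply/I01P; rewrite !ltW.
  apply: (@cintegrable_cderive _ _ (fun x => - w * lker w s (x + n.+1%:R) - s * lker w (s + 1) (x + n.+1%:R))) => x /andP[x0 _].
  by apply: is_cderive_shift; apply: is_cderive_lker; rewrite ltr_wpDl.
have Pi M : cintegrable D01 (P M).
  by apply: cintegrableD => //; exact: cintegrable_sum.
have PE M : cintegral D01 (P M) = cintegral `]0, M.+1%:R] (lker w s).
  rewrite -cintegral_lker_partial// cintegralD//; last exact: cintegrable_sum.
  by rewrite cintegral_sum.
apply: cvgC_unique (cvg_cintegral_lker w0 s1).
apply: (@cvgC_squeeze _ _ _ (fun M => 2 * A * (cmod zeta ^+ M.+1 * (2 + M%:R) ^+ p))) => [M|];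
  last first.
  rewrite -[X in _ --> X](mulr0 (2 * A)); apply: cvgMl_tmp; apply: cvg_expr_poly.
  by rewrite cmod_ge0.
have cm : cmeasurable D01 (fun x => lerch_integrand w zeta k s x - P M x).
  by apply: cmeasurableB; exact: cintegrable_cmeasurable.
rewrite cmodB -PE -cintegralB//.
have bnd x : D01 x -> cmod (lerch_integrand w zeta k s x - P M x) <= A * (cmod zeta ^+ M.+1 * (2 + M%:R) ^+ p).
  move=> /D01P/andP[x0 x1].
  have x11 : 1 <= 1 + x by lra.
  have M0 : (0 : R) <= M%:R by [].
  (* This is where zeta = e^(-w) enters: translating x by n + 1 multiplies e^(-wx) by zeta^(n+1). *)
  have e n : lker w s (x + n.+1%:R) = cexp (- w * x%:C) * (zeta * (zeta ^+ n * npow s (1 + x + n%:R))).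
    have -> : cexp (- w * x%:C) * (zeta * (zeta ^+ n * npow s (1 + x + n%:R))) =
      (cexp (- w * x%:C) * zeta ^+ n.+1) * npow s (1 + x + n%:R) by rewrite exprS; ring.
    rewrite /zeta -cexpMn -cexpD /lker; congr (cexp _ * npow _ _).
      by rewrite rmorphD /= rmorph_nat; ring.
    by rewrite -natr1; ring.
  rewrite /P (eq_bigr _ (fun (n : 'I_M) _ => e n)) -!mulr_sumr (abelsum_partial _ z1 zn1 hB x11).
  have -> : lerch_integrand w zeta k s x - (lker w s x + cexp (- w * x%:C) *
    (zeta * (abelsum zeta k (npow s) (1 + x) - zeta ^+ M * abelsum zeta k (npow s) (1 + x + M%:R)))) =
    cexp (- w * x%:C) * (zeta ^+ M.+1 * abelsum zeta k (npow s) (1 + x + M%:R)).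
    by rewrite /lerch_integrand /lker exprS; ring.
  rewrite cmodM cmod_cexp cReM /= mulr0 subr0 cReN.
  apply: le_trans (ler_piMl (cmod_ge0 _) _) _.
    by rewrite expR_le1 mulNr oppr_le0 mulr_ge0// ltW.
  rewrite cmodM cmodX mulrCA ler_wpM2l ?exprn_ge0 ?cmod_ge0//.
  have xM : 1 <= 1 + x + M%:R by lra.
  apply: le_trans (hA _ z1 (lexx _) _ xM) _.
  by rewrite ler_wpM2l// lerXn2r ?nnegrE; lra.
have ic : mu.-integrable D01 (EFin \o (fun=> A * (cmod zeta ^+ M.+1 * (2 + M%:R) ^+ p))).
  apply: (@integrableS _ _ _ mu I01) (integrable_cst_segment 0 1 _);
    [exact: measurable_I01|exact: measurable_D01|].
  by move=> x /D01P /andP[x0 x1]; apply/I01P; rewrite !ltW.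
apply: le_trans (cintegral_bound mD cm bnd ic) _.
rewrite -mulrA ler_pM2l// Rintegral_cst// [X in _ * X](_ : _ = 1) ?mulr1//.
by have := lebesgue_measure_itv `]0 : R, 1 : R[; rewrite /= lte_fin ltr01 /= sube0 => ->.
Qed.

End LerchFourierCoefficients.

(** * Passage to the boundary *)

Section LerchFourierExpansion.
Variable R : realType.
Notation C := R[i].
Notation mu := (@lebesgue_measure R).
Notation I01 := (`[0, 1]%classic : set R).
Notation D01 := (`]0, 1[%classic : set R).
Implicit Types (z w s zeta : C) (x y : R) (f g : R -> C).

Lemma cvg_cexp (u : nat -> C) (l : C) : u @ \oo --> (l : C^o) ->
  (fun n => cexp (u n)) @ \oo --> (cexp l : C^o).
Proof.
move=> /cvgC_ReIm[ur ui].
have ce : (fun n => expR (complex.Re (u n))) @ \oo --> expR (complex.Re l).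
  exact: (cvg_comp _ _ ur (@continuous_expR R _)).
have cc : (fun n => cos (complex.Im (u n))) @ \oo --> cos (complex.Im l).
  exact: (cvg_comp _ _ ui (@continuous_cos R _)).
have cs : (fun n => sin (complex.Im (u n))) @ \oo --> sin (complex.Im l).
  exact: (cvg_comp _ _ ui (@continuous_sin R _)).
apply/cvgC_ReIm; split.
  by rewrite Re_cexp; under eq_fun do rewrite Re_cexp; apply: cvgM.
have e z : complex.Im (cexp z) = expR (complex.Re z) * sin (complex.Im z).
  by rewrite /cexp cImM /= mul0r addr0.
by rewrite e; under eq_fun do rewrite e; apply: cvgM.
Qed.

(** The argument of - 2 pi i y, for y != 0. *)
Definition quarter_turn y : R := if 0 < y then - (pi / 2) else pi / 2.

(* The boundary point w = - 2 pi i y is approached along the circle of radius 2 pi |y|. *)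
Lemma lerch_integrand_boundary y k s : y != 0 -> e2pi y != 1 -> complex.Re s < 1 ->
  4 <= complex.Re s + k%:R ->
  cintegral D01 (lerch_integrand (0 +i* - (2 * pi * y)) (e2pi y) k s) =
  cGamma (1 - s) * cexp ((s - 1) * (ln (2 * pi * `|y|) +i* quarter_turn y)).
Proof.
move=> y0 zn1 s1 sk; have p0 := pi_gt0 R.
have yp : 0 < 2 * pi * `|y| by rewrite !mulr_gt0// normr_gt0.
have ph1 := pihalf_ge1 R.
(* The factor 1 - 1/(n+2) lies strictly between 0 and 1, so every w n has positive real part. *)
pose v (n : nat) : R := quarter_turn y * (1 - n.+2%:R^-1).
pose om n : C := ln (2 * pi * `|y|) +i* v n.
pose w n := cexp (om n).
pose zeta n := cexp (- w n).
have qa : `|quarter_turn y| = pi / 2.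
  by rewrite /quarter_turn; case: ifP => _; rewrite ?normrN ger0_norm//; lra.
have iv (n : nat) : 0 < (n.+2%:R^-1 : R) < 1.
  by rewrite invr_gt0 ltr0n /= invf_lt1 ?ltr0n// ltr1n.
have vpi n : `|v n| < pi / 2.
  have /andP[h1 h2] := iv n.
  rewrite /v normrM qa [`|1 - _|]gtr0_norm; last by rewrite subr_gt0.
  by rewrite gtr_pMr ?divr_gt0// gtrBl.
have cv : v @ \oo --> quarter_turn y.
  rewrite -[X in _ --> X]mulr1 -[X in _ --> _ X](subr0 1).
  apply: cvgMl_tmp; apply: cvgB; first exact: cvg_cst.
  have := @cvg_harmonic R; rewrite -cvg_shiftS; exact.
have com : om @ \oo --> ((ln (2 * pi * `|y|) +i* quarter_turn y : C) : C^o).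
  by apply/cvgC_ReIm; split => //=; exact: cvg_cst.
have cw : w @ \oo --> ((0 +i* - (2 * pi * y) : C) : C^o).
  have := cvg_cexp com.
  rewrite (_ : cexp (_ +i* _) = 0 +i* - (2 * pi * y))//.
  rewrite /cexp /= lnK ?posrE// /quarter_turn; apply: complex_ext; rewrite !ReIm_simp /=.
    by case: ifP => _; rewrite ?cosN cos_pihalf; ring.
  case: ifPn => [h|]; first by rewrite sinN sin_pihalf gtr0_norm//; ring.
  by rewrite -leNgt => h; rewrite sin_pihalf ler0_norm//; ring.
have cz : zeta @ \oo --> (e2pi y : C^o).
  have := cvg_cexp (cvgCN cw).
  by rewrite (_ : - (0 +i* - (2 * pi * y)) = 0 +i* (2 * pi * y))//; apply: complex_ext;
    rewrite !ReIm_simp ?oppr0 ?opprK.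
have w0 n : 0 < complex.Re (w n).
  rewrite /w Re_cexp mulr_gt0 ?expR_gt0// cos_gt0_pihalf//.
  by have := vpi n; rewrite ltr_norml.
have zl1 n : cmod (zeta n) <= 1.
  by rewrite cmod_cexp cReN expR_le1 oppr_le0 ltW.
pose d := cmod (1 - e2pi y) / 2.
have d0 : 0 < d by rewrite divr_gt0// cmod_gt0 subr_eq0 eq_sym.
(* The uniform bounds hold where |1 - zeta| >= d; this is true from some N on, so the sequences are
   shifted by N. *)
have [N dN] : exists N, forall n, d <= cmod (1 - zeta (n + N)%N).
  have /cvgCP/cvgrPdist_lt/(_ _ d0)[N _ hN] := cz.
  exists N => n; have /= := hN (n + N)%N (leq_addl _ _).
  rewrite sub0r normrN ger0_norm ?cmod_ge0// => h.
  have := cmodD (1 - zeta (n + N)%N) (zeta (n + N)%N - e2pi y).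
  by rewrite addrA subrK; rewrite /d in h *; lra.
have [M HM] := lerch_integrand_le d0 sk.
have [p ps] := npow_polyb s; have [B hB] := npow_decay sk.
have [A hA] := abelsum_lipschitz_z d0 ps hB.
have zy1 : cmod (e2pi y) <= 1 by rewrite cmod_e2pi.
have dy : d <= cmod (1 - e2pi y) by rewrite /d; have := cmod_ge0 (1 - e2pi y); lra.
have zN n : zeta n != 1.
  by apply/eqP => e; have := cmod_cexp (- w n); rewrite -/(zeta n) e cmod1 => /esym/eqP;
    rewrite lt_eqF// expR_lt1 cReN oppr_lt0.
have shiftN (u : nat -> C) (l : C) : u @ \oo --> (l : C^o) -> (fun n => u (n + N)%N) @ \oo --> (l : C^o).
  by move=> ul; apply/cvgC_shiftn.
have cw' := shiftN _ _ cw; have cz' := shiftN _ _ cz.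
have [] := @cintegral_DCT _ D01 (fun n => lerch_integrand (w (n + N)%N) (zeta (n + N)%N) k s)
  (lerch_integrand (0 +i* - (2 * pi * y)) (e2pi y) k s) (fun x => cmod (npow s x) + M)
  (@measurable_D01 R) _ _ (integrable_npow01D M s1) _.
- by move=> n; exact: lerch_integrand_cmeasurable.
- by move=> n x /D01P x01; apply: HM => //; exact: ltW.
- move=> x /D01P/andP[x0 x1]; have x11 : 1 <= 1 + x by lra.
  apply: cvgCM.
    by apply: cvg_cexp; apply: cvgCM (cvgCN cw') (cvgC_cst _).
  apply: cvgCD; first exact: cvgC_cst.
  apply: cvgCM; first exact: cz'.
  apply: (@cvgC_squeeze _ _ _ (fun n => (A * (1 + x) ^+ p) * cmod (zeta (n + N)%N - e2pi y))).
    move=> n; rewrite mulrAC; exact: (hA _ _ (zl1 _) zy1 (dN n) dy).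
  rewrite -[X in _ --> X](mulr0 (A * (1 + x) ^+ p)); apply: cvgMl_tmp.
  by move/cvgCP: cz'.
move=> _ ci; apply: cvgC_unique ci _.
have -> : (fun n => cintegral D01 (lerch_integrand (w (n + N)%N) (zeta (n + N)%N) k s)) =
    (fun n => cGamma (1 - s) * cexp ((s - 1) * om (n + N)%N)).
  apply/funext => n; rewrite lerch_integrand_laplace//.
  exact: (@laplace_gamma _ (om (n + N)%N) s (vpi _) s1).
by apply: cvgCZ; apply: cvg_cexp; apply: cvgCZ; exact: shiftN.
Qed.

Lemma cpow_int_shift (n : int) (lambda : R) w : n%:~R + lambda != 0 ->
  cpow (n%:~R + lambda%:C) w =
  cexp (w * (ln `|n%:~R + lambda| +i* (if 0 < n%:~R + lambda then 0 else pi))).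
Proof.
move=> y0; have -> : n%:~R + lambda%:C = (n%:~R + lambda)%:C.
  by rewrite rmorphD /= rmorph_int.
rewrite /cpow; congr (cexp (w * _)); rewrite /clog cmod_real; congr (_ +i* _).
rewrite /carg /= lexx cmod_real; case: ifPn => [h|].
  by rewrite gtr0_norm// divff// acos1.
by rewrite -leNgt => h; rewrite ler0_norm// invrN mulrN divff// acosN1.
Qed.

(** The constant i e^(- pi i s / 2) equals e^((s - 1)(- pi i / 2)). It turns the principal argument
    of n + lambda, 0 or pi, into - pi/2 or pi/2, the argument of - 2 pi i (n + lambda); for negative
    n + lambda this depends on the convention arg = pi. *)
Lemma gamma_factor (n : int) (lambda : R) s : n%:~R + lambda != 0 ->
  ((0 +i* 1) * cpow (2 * pi)%:C (s - 1) * cGamma (1 - s) * cexp (- ((0 +i* pi) * s / 2)))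
    * cpow (n%:~R + lambda%:C) (s - 1) =
  cGamma (1 - s) * cexp ((s - 1) * (ln (2 * pi * `|n%:~R + lambda|) +i* quarter_turn (n%:~R + lambda))).
Proof.
move=> y0; rewrite cpow_int_shift//; set y := n%:~R + lambda in y0 *.
have p0 := pi_gt0 R; have yp : 0 < `|y| by rewrite normr_gt0.
have p2 : 0 < 2 * pi :> R by rewrite mulr_gt0.
rewrite cpow_real// [ln (_ * `|y|)]lnM ?posrE//.
have -> : (0 +i* 1 : C) = cexp (0 +i* (pi / 2)).
  by rewrite /cexp /= expR0 cos_pihalf sin_pihalf mul1r.
have mulE (a b c d e : C) : a * b * c * d * e = c * (a * b * d * e) by ring.
rewrite mulE -!cexpD; congr (_ * cexp _).
have -> : (2 : C)^-1 = (2^-1 : R)%:C by rewrite fmorphV rmorph_nat.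
by rewrite /quarter_turn; case: ifP => _; apply: complex_ext; rewrite !ReIm_simp /=; field.
Qed.

Lemma lerch_zeta_integrand (lambda : R) k s x : 0 < lambda < 1 -> 0 < x -> 4 <= complex.Re s + k%:R ->
  lerch_zeta lambda x%:C s = npow s x + e2pi lambda * abelsum (e2pi lambda) k (npow s) (1 + x).
Proof. by move=> l01 x0 sk; rewrite (lerch_zetaE l01 x0 sk). Qed.

(** The formula for [lerch_zeta] is known for positive x, and x = 0 is outside its domain; end
    points are null sets, whatever the values there. *)
Lemma integrable_itv_oo_cc (h : R -> R) : mu.-integrable D01 (EFin \o h) -> mu.-integrable I01 (EFin \o h).
Proof.
move=> hi; have mh : measurable_fun D01 h by apply/measurable_EFinP; exact: measurable_int hi.
have mI : measurable_fun I01 h.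
  have e : I01 = [set 0] `|` (D01 `|` [set 1]).
    apply/seteqP; split => x /=; rewrite !in_itv /=.
      move=> /andP[]; rewrite le_eqVlt => /predU1P[<-|x0]; first by left.
      by rewrite le_eqVlt => /predU1P[->|x1]; right; [right|left; rewrite x0].
    by move=> [->|[/andP[x0 x1]|->]]; rewrite ?lexx ?ler01 ?ltW.
  rewrite e; apply/measurable_funU => //.
    by apply: measurableU.
  split; first exact: measurable_fun_set1.
  by apply/measurable_funU => //; split => //; exact: measurable_fun_set1.
apply/integrableP; split; first exact/measurable_EFinP.
move/integrableP : hi => [_];
  rewrite (@integral_itv_bndoo R 0 1 (fun x => `|(EFin \o h) x|%E) true false)//.
apply: measurableT_comp => //; exact/measurable_EFinP.
Qed.

Lemma cintegrable_itv_oo_cc f : cintegrable D01 f -> cintegrable I01 f.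
Proof. by move=> [fr fi]; split; exact: integrable_itv_oo_cc. Qed.

Lemma e2pi_mulC y x : e2pi (y * x) = cexp (- (0 +i* - (2 * pi * y)) * x%:C).
Proof. by rewrite /e2pi; congr cexp; apply: complex_ext; rewrite !ReIm_simp; ring. Qed.

Lemma npow_lipschitz s (a : R) : 0 < a -> exists L, forall x y, a <= x <= 1 -> a <= y <= 1 ->
  cmod (npow s x - npow s y) <= L * `|x - y|.
Proof.
move=> a0; pose M := cmod s * expR (`|complex.Re (s + 1)| * `|ln a|).
exists (2 * M) => x y; wlog yx : x y / y <= x => [wl|] hx hy.
  have [|/ltW] := leP y x => xy; first exact: wl.
  by rewrite cmodB distrC; apply: wl.
rewrite ger0_norm ?subr_ge0//.
apply: (@cMVT_le _ (npow s) (fun x => - s * npow (s + 1) x)) => // t tn.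
  by apply: is_cderive_npow; lra.
rewrite cmodM cmodN ler_wpM2l ?cmod_ge0// cmod_npow ler_expR.
apply: le_trans (ler_norm _) _; rewrite normrM normrN ler_wpM2l//.
have t0 : 0 < t by lra.
have lt0 : ln t <= 0 by apply: ln_le0; lra.
have la0 : ln a <= 0 by apply: ln_le0; lra.
rewrite !ler0_norm// lerN2 ler_ln ?posrE//; lra.
Qed.

Lemma e2pi_lipschitz (c x y : R) : cmod (e2pi (c * x) - e2pi (c * y)) <= 2 * `|2 * pi * c| * `|x - y|.
Proof.
wlog yx : x y / y <= x => [wl|].
  have [|/ltW] := leP y x => xy; first exact: wl.
  by rewrite cmodB distrC; apply: wl.
rewrite [`|x - y|]ger0_norm ?subr_ge0//.
apply: (@cMVT_le _ (fun x => e2pi (c * x)) (fun x => (0 +i* (2 * pi * c)) * e2pi (c * x))) => // t _.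
  exact: is_cderive_e2pi.
rewrite cmodM cmod_e2pi mulr1; apply: le_trans (cmod_le_ReIm _) _.
by rewrite /= normr0 add0r.
Qed.

(** The radius alpha / 2 keeps x away from 0, where x^(-s) may be singular. *)
Lemma lerch_local_lipschitz (lambda alpha : R) k s : 0 < lambda < 1 -> 0 < alpha < 1 ->
  4 <= complex.Re s + k%:R ->
  let f x := e2pi (lambda * x) * lerch_zeta lambda x%:C s in
  exists L, forall x, 0 <= x <= 1 -> `|x - alpha| < alpha / 2 ->
    cmod (f x - f alpha) <= L * `|x - alpha|.
Proof.
move=> l01 /andP[a0 a1] sk f.
have z1 : cmod (e2pi lambda) <= 1 by rewrite cmod_e2pi.
have zn1 := e2pi_neq1 l01.
have [p ps] := npow_polyb (s + 1).
have [B hB] := @npow_decay _ k s sk.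
have [B' hB'] := @npow_decay _ k (s + 1) ltac:(rewrite cReD /=; lra).
have gp : polyb p (fun x => - s * npow (s + 1) x) (cmod s).
  by move=> x x1; rewrite cmodM cmodN ler_wpM2l ?cmod_ge0//; have := ps x x1; rewrite mul1r.
have gd : decay k (fun x => - s * npow (s + 1) x) (cmod s * B').
  by move=> x x1; rewrite iter_fdiffZ cmodM cmodN -mulrA ler_wpM2l ?cmod_ge0//; exact: hB'.
have [K HK] := abelsum_lipschitz_x z1 zn1 (@is_cderive_npow _ s) gp gd hB.
have a20 : 0 < alpha / 2 by rewrite divr_gt0.
have [L hL] := npow_lipschitz s a20.
pose g x := npow s x + e2pi lambda * abelsum (e2pi lambda) k (npow s) (1 + x).
pose G := cmod (g alpha).
exists (L + K + 2 * `|2 * pi * lambda| * G) => x x01 xa.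
have x0 : 0 < x by move: xa; rewrite ltr_norml; lra.
have fE t : 0 < t -> f t = e2pi (lambda * t) * g t.
  by move=> t0; rewrite /f (lerch_zeta_integrand l01 t0 sk).
rewrite !fE//.
have -> : e2pi (lambda * x) * g x - e2pi (lambda * alpha) * g alpha =
  e2pi (lambda * x) * (g x - g alpha) + (e2pi (lambda * x) - e2pi (lambda * alpha)) * g alpha by ring.
rewrite [leRHS]mulrDl; apply: le_trans (cmodD _ _) _;
  rewrite cmodM cmod_e2pi mul1r [cmod ((_ - _) * _)]cmodM -/G; apply: lerD.
  have -> : g x - g alpha = (npow s x - npow s alpha) + e2pi lambda *
    (abelsum (e2pi lambda) k (npow s) (1 + x) - abelsum (e2pi lambda) k (npow s) (1 + alpha)).
    by rewrite /g; ring.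
  rewrite [leRHS]mulrDl; apply: le_trans (cmodD _ _) _; apply: lerD.
    by apply: hL; move: xa; rewrite ltr_norml; lra.
  rewrite cmodM cmod_e2pi mul1r.
  have -> : `|x - alpha| = `|1 + x - (1 + alpha)| by congr (`|_|); ring.
  by apply: HK; lra.
rewrite [leRHS]mulrAC ler_wpM2r ?cmod_ge0//; exact: e2pi_lipschitz.
Qed.

Lemma bisumE (u : int -> C) N :
  bisum u N = u 0 + \sum_(n < N) (u n.+1%:Z + u (- n.+1%:Z)).
Proof.
elim: N => [|N IH].
  by rewrite /bisum big_ord_recr !big_ord0 /= add0r subrr addr0.
rewrite big_ord_recr /= addrA -IH /bisum doubleS.
rewrite big_ord_recr big_ord_recl /=.
rewrite (_ : 0%:Z - N.+1%:Z = - N.+1%:Z); last by rewrite sub0r.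
rewrite (_ : N.*2.+2%:Z - N.+1%:Z = N.+1%:Z); last by lia.
rewrite (eq_bigr (fun k : 'I_N.*2.+1 => u (k%:Z - N%:Z))); last first.
  by move=> i _; congr u; rewrite /bump /=; lia.
by ring.
Qed.

(** Proved directly rather than by dividing the Fourier expansion by its constant, so that
    convergence is independent of the value of Gamma(1 - s). Each half is a conditionally convergent
    sum of z^n x^(s-1) with z = e^(2 pi i alpha) or its inverse, and z != 1 because alpha is
    interior. *)
Lemma cvg_bisum_lerch (lambda alpha : R) s : 0 < lambda < 1 -> 0 < alpha < 1 ->
  complex.Re s < 1 ->
  exists S : C, bisum (fun n : int => e2pi (- (n%:~R * alpha)) * cpow (n%:~R + lambda%:C) (s - 1)) @ \oo
    --> (S : C^o).
Proof.
move=> l01 a01 s1.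
have /andP[l0 l1] := l01.
set u := (fun n : int => _).
have s10 : 0 < complex.Re (1 - s) by rewrite cReD cReN /=; lra.
pose k := Num.bound `|4 - complex.Re (1 - s)|.
have sk : 4 <= complex.Re (1 - s) + k%:R.
  have := ltW (archi_boundP (normr_ge0 (4 - complex.Re (1 - s)))).
  by have := ler_norm (4 - complex.Re (1 - s)); rewrite -/k; lra.
have [B hB] := npow_decay sk.
pose zp := e2pi alpha; pose zm := e2pi (- alpha).
have zp1 : zp != 1 := e2pi_neq1 a01.
have zm1 : zm != 1.
  by rewrite /zm e2piN; apply/eqP => /(congr1 GRing.inv); rewrite invrK invr1; apply/eqP.
have czp : cmod zp <= 1 by rewrite cmod_e2pi.
have czm : cmod zm <= 1 by rewrite cmod_e2pi.
have l11 : 1 <= lambda + 1 by lra.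
(* The moduli n - lambda of the negative half start at 1 - lambda < 1; the index -1 is therefore
   kept apart and the sum taken from 2 - lambda. *)
have l21 : 1 <= 2 - lambda by lra.
have Sm := abelsum_series czm zm1 hB l11 (cvg_npow0 s10 l11).
have Sp := abelsum_series czp zp1 hB l21 (cvg_npow0 s10 l21).
set am := abelsum zm _ _ _ in Sm; set ap := abelsum zp _ _ _ in Sp.
have up (n : nat) : u n.+1%:Z = zm * (zm ^+ n * npow (1 - s) (lambda + 1 + n%:R)).
  have n0 : (0 : R) <= n%:R by [].
  have e : n.+1%:~R + lambda = lambda + 1 + n%:R :> R by rewrite -pmulrn -natr1; ring.
  rewrite /u mulrA -exprS cpow_int_shift e; last by rewrite gt_eqF//; lra.
  rewrite ifT; last by lra.
  rewrite gtr0_norm; last by lra.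
  rewrite /zm -e2piMn /npow; congr (e2pi _ * cexp (_ * _)); last by ring.
  by rewrite -pmulrn; ring.
(* The phase of (n + lambda)^(s-1) at negative n + lambda, whose argument is pi. *)
pose h := cexp ((s - 1) * (0 +i* pi)).
have un (n : nat) : u (- n.+1%:Z) = zp ^+ n.+1 * (h * npow (1 - s) (n.+1%:R - lambda)).
  have n1 : (1 : R) <= n.+1%:R by rewrite ler1n.
  have e : (- n.+1%:Z)%:~R + lambda = - (n.+1%:R - lambda) :> R by rewrite mulrNz -pmulrn; ring.
  rewrite /u cpow_int_shift e; last by rewrite oppr_eq0 gt_eqF//; lra.
  rewrite normrN gtr0_norm; last by lra.
  rewrite ifF; last by apply/negP; lra.
  rewrite /zp -e2piMn /h /npow -cexpD; congr (e2pi _ * cexp _).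
    by rewrite mulrNz -pmulrn; ring.
  by apply: complex_ext; rewrite !ReIm_simp; ring.
pose S := u 0 + (zm * am + (u (- 1%:Z) + h * (zp ^+ 2 * ap))).
exists S.
have c2 : (fun N => \sum_(n < N) u (- n.+1%:Z)) @ \oo --> ((u (- 1%:Z) + h * (zp ^+ 2 * ap) : C) : C^o).
  apply/cvgC_shiftS.
  have := cvgCD (cvgC_cst (u (- 1%:Z))) (cvgCZ h (cvgCZ (zp ^+ 2) Sp)).
  rewrite (_ : (fun n => _) = (fun N => \sum_(n < N.+1) u (- n.+1%:Z)))//.
  apply/funext => N; rewrite big_ord_recl /= seriesE; congr (_ + _).
  rewrite !mulr_sumr; apply: eq_bigr => i _; rewrite un /bump /= add1n.
  rewrite (_ : i.+2%:R - lambda = 2 - lambda + i%:R); last by rewrite -natr1 -natr1; ring.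
  by rewrite !exprS expr0; ring.
have c1 : (fun N => \sum_(n < N) u n.+1%:Z) @ \oo --> ((zm * am : C) : C^o).
  have := cvgCZ zm Sm.
  rewrite (_ : (fun n => _) = (fun N => \sum_(n < N) u n.+1%:Z))//.
  by apply/funext => N; rewrite seriesE mulr_sumr; apply: eq_bigr => i _; rewrite up.
have := cvgCD (cvgC_cst (u 0)) (cvgCD c1 c2).
rewrite (_ : (fun n => _) = bisum u)//.
by apply/funext => N; rewrite bisumE big_split.
Qed.

End LerchFourierExpansion.

Theorem proposition6 (R : realType) (s : R[i]) (lambda : R)
    (hs : complex.Re s < 1) (hlambda : 0 < lambda < 1) :
  let f : R -> R[i] :=
    fun alpha => e2pi (lambda * alpha) * lerch_zeta lambda alpha%:C s in
  let K : R[i] :=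
    (0 +i* 1) * cpow (2 * pi)%:C (s - 1) * cGamma (1 - s)
      * cexp (- ((0 +i* pi) * s / 2)) in
  let c : int -> R[i] :=
    fun n => cpow (n%:~R + lambda%:C) (s - 1) in
  [/\ cintegrable `[0, 1] f,
      forall n : int, fourier_coef f (- n) = K * c n
    & forall alpha : R, 0 < alpha < 1 ->
        exists2 S : R[i],
          bisum (fun n => e2pi (- (n%:~R * alpha)) * c n) @ \oo
            --> (S : R[i]^o)
        & f alpha = K * S].
Proof.
move=> f K c.
have [k sk] : exists k : nat, 4 <= complex.Re s + k%:R.
  exists (Num.bound `|4 - complex.Re s|).
  have := ltW (archi_boundP (normr_ge0 (4 - complex.Re s))).
  by have := ler_norm (4 - complex.Re s); lra.
have zn1 := e2pi_neq1 hlambda.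
(* The factor e^(2 pi i n x) joins e^(2 pi i lambda x) to form e^(-wx) with w = - 2 pi i (n +
   lambda), while zeta is unchanged because e^(2 pi i n) = 1. *)
have fE n x : 0 < x < 1 -> f x * e2pi (n%:~R * x) =
    lerch_integrand (0 +i* - (2 * pi * (n%:~R + lambda))) (e2pi (n%:~R + lambda)) k s x.
  move=> /andP[x0 _]; rewrite /f (lerch_zeta_integrand hlambda x0 sk).
  by rewrite /lerch_integrand -e2pi_mulC [in RHS]e2piD e2pi_int mul1r mulrAC -e2piD -mulrDl [lambda + _]addrC.
have fi : cintegrable `[0, 1] f.
  apply: cintegrable_itv_oo_cc.
  apply: eq_cintegrable (lerch_integrand_cintegrable _ _ zn1 hs sk).
  - exact: measurable_D01.
  - by move=> x /D01P x01; have := fE 0 x x01; rewrite mul0r e2pi0 mulr1 add0r => ->.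
  - by rewrite /= lexx.
  - by rewrite cmod_e2pi.
have coefE n : fourier_coef f (- n) = K * c n.
  have zE : e2pi (n%:~R + lambda) = e2pi lambda by rewrite e2piD e2pi_int mul1r.
  have y0 : n%:~R + lambda != 0.
    by apply: contraNneq zn1 => y0; rewrite -zE y0 e2pi0.
  rewrite fourier_coefE cintegral_bndoo; last first.
    apply: (@cmeasurableS _ `[0, 1]); [exact: measurable_I01|exact: subset_itv_oo_cc|].
    exact/cintegrable_cmeasurable/cintegrable_Me2pi.
  rewrite /K gamma_factor//.
  rewrite -(lerch_integrand_boundary y0 _ hs sk) ?zE//.
  by apply: eq_cintegral => x /D01P x01; rewrite rmorphN opprK fE// zE.
split=> // alpha a01.
have [S cS] := cvg_bisum_lerch hlambda a01 hs; exists S => //.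
have [L fL] := lerch_local_lipschitz hlambda a01 sk.
have a20 : 0 < alpha / 2 by move/andP : a01 => [a0 _]; rewrite divr_gt0.
have cf := fourier_series_pointwise fi a01 a20 fL.
(* The Fourier partial sums tend to f alpha and are K times the partial sums that tend to S. *)
apply: cvgC_unique cf _.
have -> : bisum (fun n : int => e2pi (- (n%:~R * alpha)) * fourier_coef f (- n)) =
    (fun N => K * bisum (fun n : int => e2pi (- (n%:~R * alpha)) * c n) N).
  apply/funext => N; rewrite mulr_sumr; apply: eq_bigr => i _.
  by rewrite coefE mulrCA.
exact: cvgCZ.
Qed.
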